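(* Let $R_0>0$, let $u_0\in L^1(0,\infty)$ be supported in $[0,R_0]$, and let $M=\int_0^\infty u_0(x)\,dx$. For $L\ge R_0$ let $u^L$ and $u^\infty$ be the Hopf--Cole solutions, on $(0,L)$ and on $(0,\infty)$ respectively, of the viscous Burgers problem with conservative boundary conditions and initial datum $u_0$ (see context), and set $$v^L(\xi,t)=\sqrt t\,u^L(\xi\sqrt t,t),\qquad v^\infty(\xi,t)=\sqrt t\,u^\infty(\xi\sqrt t,t).$$ Let $\{\Phi_c\}_{c>0}$, $f_M$ and $\mathcal U_M$ be the explicit functions defined in the context. Then: 1. For every fixed $c>0$, every integer $k\ge 0$ and every $R\in(0,c^{-1/2})$, $$\|v^L(\cdot,cL^2)-\Phi_c\|_{C^k([0,R])}=O(L^{-1})\qquad (L\to\infty).$$ 2. For every fixed $R>0$ and integer $k\ge0$, $\Phi_c\to f_M$ in $C^k([0,R])$ as $c\downarrow0$; and, if $M\neq0$, $$\lim_{c\downarrow0}\,-c\log|\Phi_c(0)-f_M(0)|=1.$$ 3. As $c\to\infty$, $\dfrac1{\sqrt c}\,\Phi_c\!\left(\dfrac{y}{\sqrt c}\right)\to\mathcal U_M(y)$ uniformly for $y\in[0,1]$. 4. For every $R>0$, integer $k\ge0$ and $\varepsilon\in(0,1)$ there are $C_{k,\varepsilon},L_0>0$, independent of $c$ and $L$, such that, whenever $0<c<R^{-2}$, $t=cL^2$ and $L\ge L_0$, $$\|v^L(\cdot,t)-v^\infty(\cdot,t)\|_{C^k([0,R])}\le C_{k,\varepsilon}\,e^{-(1-\varepsilon)/c}.$$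 If $M\neq0$, the exponential constant $1$ is optimal: no such estimate, with constants independent of $c$ and $L$, can hold with $1-\varepsilon$ replaced by a fixed number $\gamma>1$.
   Context: Set $w_0(x)=\exp\left(\int_0^x u_0(z)\,dz\right)$. Interval problem: $u_t-u_{xx}=(u^2)_x$ in $(0,L)\times(0,\infty)$, $u_x=-u^2$ at $x=0$ and at $x=L$, $u(\cdot,0)=u_0$. Its Hopf--Cole solution is $u^L=w^L_x/w^L$, where $w^L>0$ is the classical solution (continuous up to $t=0$) of $w_t=w_{xx}$ in $(0,L)\times(0,\infty)$, $w(0,t)=1$, $w(L,t)=e^M$, $w(\cdot,0)=w_0$. Half-line problem: $u_t-u_{xx}=(u^2)_x$ in $(0,\infty)\times(0,\infty)$, $u_x(0,t)=-u^2(0,t)$, $u(\cdot,0)=u_0$. Its Hopf--Cole solution is $u^\infty=w^\infty_x/w^\infty$, where $w^\infty>0$ is the bounded classical solution of $w_t=w_{xx}$ in $(0,\infty)\times(0,\infty)$, $w(0,t)=1$, $w(\cdot,0)=w_0$. The function $\varphi$ is the solution of $\varphi_\tau=\varphi_{yy}$ on $(0,1)\times(0,\infty)$, $\varphi(0,\tau)=0$, $\varphi(1,\tau)=1$, $\varphi(y,0)=1$; explicitly $$\varphi(y,\tau)=y+\frac2\pi\sum_{n\ge1}\frac{\sin(n\pi y)}{n}e^{-n^2\pi^2\tau},\qquad \tau>0.$$ For $c>0$ and $0\le\xi\le c^{-1/2}$, $$\Phi_c(\xi)=\sqrt c\,\frac{(e^M-1)\,\varphi_y(\xi\sqrt c,c)}{1+(e^M-1)\,\varphi(\xi\sqrt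 c,c)}.$$ Also $$f_M(\xi)=\frac{(e^M-1)\,b(\xi)}{1+(e^M-1)\int_0^\xi b},\quad b(\xi)=\pi^{-1/2}e^{-\xi^2/4},\ \xi\ge0;\qquad \mathcal U_M(y)=\frac{e^M-1}{1+(e^M-1)y},\ 0\le y\le1.$$ *)

(* Defs.v *)
From HB Require Import structures.
From mathcomp Require Export all_boot all_order all_algebra.
From mathcomp Require Export all_classical all_reals all_analysis.

Set Implicit Arguments.
Unset Strict Implicit.
Unset Printing Implicit Defensive.

Export Order.TTheory GRing.Theory Num.Theory.
Export numFieldNormedType.Exports.

#[global] Open Scope classical_set_scope.
#[global] Open Scope ring_scope.

(* Derivatives are taken within a set A, hence are one-sided at the endpoints
   when A is a closed interval: nothing depends on values outside A. *)
Definition diff_quotient (R : realType) (f : R -> R) (x y : R) : R :=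
  (f y - f x) / (y - x).

Definition derivable_within (R : realType) (A : set R) (f : R -> R) (x : R) :=
  cvg (diff_quotient f x y @[y --> within A x^']).

Definition derive_within (R : realType) (A : set R) (f : R -> R) (x : R) : R :=
  lim (diff_quotient f x y @[y --> within A x^']).

Definition derive_within_n (R : realType) (A : set R) (n : nat) (f : R -> R) :
  R -> R := iter n (derive_within A) f.

Definition is_Ck (R : realType) (A : set R) (k : nat) (f : R -> R) : Prop :=
  (forall j x, (j < k)%N -> A x ->
     derivable_within A (derive_within_n A j f) x) /\
  {within A, continuous (derive_within_n A k f)}.

(* The C^k norm  max_(j <= k) sup_A |f^(j)|, extended by +oo outside C^k(A), so
   that a finite upper bound on it includes membership in C^k(A). *)
Definition Ck_norm (R : realType) (A : set R) (k : nat) (f : R -> R) : \bar R :=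
  if `[< is_Ck A k f >] then
    (\big[Order.max/0]_(j < k.+1)
       ereal_sup [set (`|derive_within_n A j f x|)%:E | x in A])%E
  else +oo%E.

Definition mass (R : realType) (u0 : R -> R) : R :=
  \int[@lebesgue_measure R]_(x in `]0, +oo[) u0 x.

Definition w_init (R : realType) (u0 : R -> R) (x : R) : R :=
  expR (\int[@lebesgue_measure R]_(z in `]0, x[) u0 z).

(* X is the closed spatial interval. A function w : (x, t) |-> w x t is a
   classical solution if it is continuous on X x [0, oo) and of class C^(2,1)
   in the interior, where w_t = w_xx. *)
Definition heat_classical (R : realType) (X : set R) (w : R -> R -> R) : Prop :=
  let Q := [set p : R * R | interior X p.1 /\ 0 < p.2] in
  [/\ {within [set p : R * R | X p.1 /\ 0 <= p.2],
         continuous (fun p => w p.1 p.2)},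
      (forall x t, Q (x, t) ->
         [/\ derivable (w^~ t) x 1,
             derivable (derive1 (w^~ t)) x 1,
             derivable (w x) t 1 &
             derive1 (w x) t = derive1n 2 (w^~ t) x]),
      {within Q, continuous (fun p => derive1 (w^~ p.2) p.1)},
      {within Q, continuous (fun p => derive1n 2 (w^~ p.2) p.1)} &
      {within Q, continuous (fun p => derive1 (w p.1) p.2)}].

Definition heat_interval (R : realType) (u0 : R -> R) (L : R)
    (w : R -> R -> R) : Prop :=
  [/\ heat_classical `[0, L] w,
      (forall x t, 0 <= x <= L -> 0 <= t -> 0 < w x t),
      (forall t, 0 < t -> w 0 t = 1),
      (forall t, 0 < t -> w L t = expR (mass u0)) &
      (forall x, 0 <= x <= L -> w x 0 = w_init u0 x)].

Definition heat_halfline (R : realType) (u0 : R -> R)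
    (w : R -> R -> R) : Prop :=
  [/\ heat_classical `[0, +oo[ w,
      (forall x t, 0 <= x -> 0 <= t -> 0 < w x t),
      (exists K, forall x t, 0 <= x -> 0 <= t -> `|w x t| <= K),
      (forall t, 0 < t -> w 0 t = 1) &
      (forall x, 0 <= x -> w x 0 = w_init u0 x)].

Definition hopf_cole (R : realType) (X : set R) (w : R -> R -> R) (x t : R) : R :=
  derive_within X (w^~ t) x / w x t.

Definition rescale (R : realType) (u : R -> R -> R) (xi t : R) : R :=
  Num.sqrt t * u (xi * Num.sqrt t) t.

(* Only used for tau > 0, where the series converges. *)
Definition varphi (R : realType) (y tau : R) : R :=
  y + 2 / pi *
    limn (series (fun m : nat => let n : R := m.+1%:R in
      sin (n * pi * y) / n * expR (- (n ^+ 2 * pi ^+ 2 * tau)))).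

Definition varphi_y (R : realType) (y tau : R) : R := derive1 (@varphi R ^~ tau) y.

Definition Phi (R : realType) (M c xi : R) : R :=
  Num.sqrt c *
  ((expR M - 1) * varphi_y (xi * Num.sqrt c) c /
   (1 + (expR M - 1) * varphi (xi * Num.sqrt c) c)).

Definition b_gauss (R : realType) (xi : R) : R :=
  (Num.sqrt pi)^-1 * expR (- (xi ^+ 2 / 4)).

Definition f_prof (R : realType) (M xi : R) : R :=
  (expR M - 1) * b_gauss xi /
  (1 + (expR M - 1) * \int[@lebesgue_measure R]_(z in `[0, xi]) b_gauss z).

Definition U_prof (R : realType) (M y : R) : R :=
  (expR M - 1) / (1 + (expR M - 1) * y).

(* Main.v *)
From HB Require Import structures.
Require Import Defs.
From mathcomp Require Import measurable_realfun ring lra.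

Set Implicit Arguments.
Unset Strict Implicit.
Unset Printing Implicit Defensive.

(** Through the Hopf-Cole transform the statement is about the heat equation on
    the line. Write d = e^M - 1. The datum w_0 equals 1 at 0 and 1 + d beyond R0;
    reflect it oddly about the point (0, 1), and, for the interval, about the
    point (L, 1 + d) as well. The heat flow of the reflected datum takes the
    prescribed boundary values by symmetry, so by the maximum principle it is the
    solution: w^oo and w^L are Gaussian averages of explicit functions on the line
    ([heat_halfline_flow], [heat_interval_flow]). At time c L^2 and in the
    similarity variable, u = w_x / w becomes the logarithmic slope of the average
    of a rescaled datum, called its profile ([interval_profile],
    [halfline_profile]).

    At the scale L the two reflected data are a staircase 1 + d stair (x / L) and
    a single step 1 + d sgn x, up to a defect that lives within R0 of the points
    of 2L Z ([periodized_defect]). The functions of the statement are the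
    logarithmic slopes of the pure staircase and of the pure step: the Fourier
    series phi is the heat flow of the staircase ([varphiE], [PhiE]), and the
    average of the sign is the primitive of the Gaussian b ([f_profE]).

    Four functions have thus to be compared under Gaussian averages. All
    derivatives of an average fall on the kernel, so the estimates below hold for
    all of them at once; since the maximum principle keeps the averages away from
    0, the estimates pass to the logarithmic slopes in every C^k norm
    ([log_derivative_close]).

    - The defect occupies a width of order 1 / L near each point of a lattice, and
      its average is of that order ([heat_op_lattice]): part 1.

    - The staircase and the step agree for |eta| < 2 / sqrt c, and the two profiles
      agree up to the slightly smaller bound (2 - R0 / L) / sqrt c. What is beyond
      is seen through the Gaussian tail e^(-(2 / sqrt c)^2 / 4) = e^(-1/c)
      ([heat_op_tail]): the limit c -> 0 of part 2, and the upper bound of part 4.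

    - At xi = 0 all averages equal 1 by oddness, and the difference between the
      slopes of the staircase and of the step is d times the average of
      (eta / 2) (stair (eta sqrt c) - sgn eta), which is nonnegative and, for
      c <= 1, at least 1 just beyond 2 / sqrt c: this gives a lower bound of order
      e^(-1/c - 1/sqrt c) ([gap_lower]). It yields the exact rate in part 2, and
      its optimality in part 4 after letting L tend to infinity at fixed c
      ([gap_le_profiles]).

    - For large c the steps become invisible: stair y differs from y by at most 2,
      and the average of eta sqrt c is xi sqrt c, which turns the slope of the
      staircase into d / (1 + d y) ([stair_flat_large]): part 3. *)

(** * Derivatives of real functions, in pointful form *)

Section PointfulDerivatives.
Variable R : realType.
Implicit Types (f g : R -> R) (x a b : R).

Lemma der_cst (k x : R) : is_derive x 1 (fun=> k) 0.
Proof. exact: is_derive_cst. Qed.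

Lemma der_id x : is_derive x 1 (fun y : R => y) 1.
Proof. exact: is_derive_id. Qed.

Lemma der_add f g x a b : is_derive x 1 f a -> is_derive x 1 g b ->
  is_derive x 1 (fun y => f y + g y) (a + b).
Proof. by move=> ? ?; exact: is_deriveD. Qed.

Lemma der_opp f x a : is_derive x 1 f a -> is_derive x 1 (fun y => - f y) (- a).
Proof. by move=> ?; exact: is_deriveN. Qed.

Lemma der_sub f g x a b : is_derive x 1 f a -> is_derive x 1 g b ->
  is_derive x 1 (fun y => f y - g y) (a - b).
Proof. by move=> ? ?; exact: is_deriveB. Qed.

Lemma der_mul f g x a b : is_derive x 1 f a -> is_derive x 1 g b ->
  is_derive x 1 (fun y => f y * g y) (a * g x + f x * b).
Proof.
move=> fa gb; have := is_deriveM fa gb.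
by rewrite /GRing.scale /= addrC [g x * a]mulrC.
Qed.

Lemma der_scale (k : R) f x a : is_derive x 1 f a ->
  is_derive x 1 (fun y => k * f y) (k * a).
Proof.
move=> fa; have := der_mul (der_cst k x) fa.
by rewrite mul0r add0r.
Qed.

Lemma der_comp f g x a b : is_derive (g x) 1 f a -> is_derive x 1 g b ->
  is_derive x 1 (fun y => f (g y)) (a * b).
Proof. by move=> ? ?; exact: (@is_derive1_comp R f g). Qed.

Lemma der_inv f x a : f x != 0 -> is_derive x 1 f a ->
  is_derive x 1 (fun y => (f y)^-1) (- a / f x ^+ 2).
Proof.
move=> f0 fa; have := is_deriveV f0 fa.
by rewrite /GRing.scale /= mulNr mulrC -mulNr.
Qed.

Lemma der_div f g x a b : g x != 0 -> is_derive x 1 f a -> is_derive x 1 g b ->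
  is_derive x 1 (fun y => f y / g y) (a / g x - f x / g x * (b / g x)).
Proof.
move=> g0 fa gb; have := der_mul fa (der_inv g0 gb).
rewrite (_ : _ + _ = a / g x - f x / g x * (b / g x)) //.
by field.
Qed.

Lemma der_affine (p q x : R) : is_derive x 1 (fun y => p + q * y) q.
Proof.
have := der_add (der_cst p x) (der_scale q (der_id x)).
by rewrite add0r mulr1.
Qed.

Lemma der_derive1 f x a : is_derive x 1 f a -> derive1 f x = a.
Proof. by move=> fa; rewrite derive1E derive_val. Qed.

Lemma derivable_der f x : derivable f x 1 -> is_derive x 1 f (derive1 f x).
Proof. by move=> df; apply: DeriveDef => //; rewrite derive1E. Qed.

Lemma der_continuous f x a : is_derive x 1 f a -> {for x, continuous f}.
Proof.
by move=> fa; apply: differentiable_continuous; exact/derivable1_diffP.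
Qed.

Lemma der_unique f x a b : is_derive x 1 f a -> is_derive x 1 f b -> a = b.
Proof. by move=> /der_derive1 <- /der_derive1 <-. Qed.

Lemma der_near f g x a : (\forall y \near x, f y = g y) ->
  is_derive x 1 f a -> is_derive x 1 g a.
Proof. by move=> fg; apply: near_eq_is_derive. Qed.

Lemma der_quotient f x a : is_derive x 1 f a ->
  diff_quotient f x y @[y --> x^'] --> a.
Proof.
move=> fa; have df : derivable f x 1 by [].
have /cvgrPdist_lt H : h^-1 *: (f (h + x) - f x) @[h --> 0^'] --> a.
  have := df; rewrite /derivable => /cvg_ex[l].
  rewrite (_ : (fun h : R => _) = (fun h : R => h^-1 *: (f (h + x) - f x))); last first.
    by apply/funext => h; rewrite /GRing.scale /= mulr1.
  move=> hl; suff <- : l = a by [].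
  rewrite -(@derive_val _ _ _ _ _ _ _ fa) /derive.
  rewrite (_ : (fun h : R => _) = (fun h : R => h^-1 *: (f (h + x) - f x))); last first.
    by apply/funext => h; rewrite /GRing.scale /= mulr1.
  by symmetry; apply: cvg_lim.
apply/cvgrPdist_lt => e e0; have [d /= d0 Hd] := H e e0.
exists d => //= y /= xy yx; have y0 : y - x != 0 by rewrite subr_eq0.
have := Hd (y - x); rewrite /= sub0r opprB => /(_ xy y0).
by rewrite subrK /diff_quotient /GRing.scale /= mulrC.
Qed.

Lemma MVT_le f df (a b K : R) : a <= b ->
  (forall x, a <= x <= b -> is_derive x 1 f (df x)) ->
  (forall x, a <= x <= b -> `|df x| <= K) -> `|f b - f a| <= K * (b - a).
Proof.
move=> ab fd dK.
have [||c cab ->] := @MVT_segment R f df a b ab.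
- by move=> x /itvP xab; apply: fd; rewrite !xab.
- apply: derivable_within_continuous => x; rewrite in_itv/= => xab.
  by have := fd x xab.
rewrite normrM (ger0_norm (_ : 0 <= b - a)) ?subr_ge0//.
by apply: ler_wpM2r; rewrite ?subr_ge0// dK//; move: cab; rewrite in_itv.
Qed.

End PointfulDerivatives.

(** * Integrals over the line *)

Section LineIntegrals.
Variable R : realType.
Implicit Types (f g : R -> R).

Definition line_int f : R := \int[@lebesgue_measure R]_y f y.
Definition summable_fun f : Prop :=
  (@lebesgue_measure R).-integrable setT (EFin \o f).

Lemma summable_measurable f : summable_fun f -> measurable_fun setT f.
Proof. by move=> /integrableP[/measurable_EFinP]. Qed.

Lemma summable_le f g : measurable_fun setT f -> summable_fun g ->
  (forall x, `|f x| <= g x) -> summable_fun f.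
Proof.
move=> mf ig fg; apply: (le_integrable _ _ _ ig) => //.
  exact/measurable_EFinP.
move=> x _ /=; rewrite lee_fin (le_trans (fg x))//; exact: ler_norm.
Qed.

Lemma summableD f g : summable_fun f -> summable_fun g ->
  summable_fun (fun x => f x + g x).
Proof. by move=> fi gi; have := integrableD _ fi gi; apply. Qed.

Lemma summableZ k f : summable_fun f -> summable_fun (fun x => k * f x).
Proof. by move=> fi; have := integrableZl _ k fi; apply. Qed.

Lemma line_intD f g : summable_fun f -> summable_fun g ->
  line_int (fun x => f x + g x) = line_int f + line_int g.
Proof. by move=> ? ?; exact: RintegralD. Qed.

Lemma line_intB f g : summable_fun f -> summable_fun g ->
  line_int (fun x => f x - g x) = line_int f - line_int g.
Proof. by move=> ? ?; exact: RintegralB. Qed.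

Lemma line_intZ k f : summable_fun f ->
  line_int (fun x => k * f x) = k * line_int f.
Proof. by move=> ?; exact: RintegralZl. Qed.

Lemma eq_line_int f g : f =1 g -> line_int f = line_int g.
Proof. by move=> /funext ->. Qed.

Lemma le_line_int f g : summable_fun f -> summable_fun g ->
  (forall x, f x <= g x) -> line_int f <= line_int g.
Proof. by move=> fi gi fg; exact: le_Rintegral. Qed.

Lemma line_int_ge0 f : (forall x, 0 <= f x) -> 0 <= line_int f.
Proof. by move=> f0; exact: Rintegral_ge0. Qed.

Lemma summable_norm f : summable_fun f -> summable_fun (fun x => `|f x|).
Proof.
by move=> fi; apply: (summable_le _ (_ : summable_fun (fun x => `|f x|)));
  first apply: measurableT_comp => //; first exact: summable_measurable;
  last (by move=> x; rewrite normr_id); exact: (integrable_abse fi).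
Qed.

Lemma norm_line_int f g : measurable_fun setT f -> summable_fun g ->
  (forall x, `|f x| <= g x) -> `|line_int f| <= line_int g.
Proof.
move=> mf gi fg; have fi := summable_le mf gi fg.
apply: le_trans (le_normr_Rintegral _ _) _ => //.
by apply: le_line_int => //; exact: summable_norm.
Qed.

Lemma summable_indicM (A : set R) f : measurable A -> summable_fun f ->
  summable_fun (fun x => f x * \1_A x).
Proof.
move=> mA fi; apply: (summable_le _ (summable_norm fi)).
  apply: measurable_funM; [exact: summable_measurable|exact: measurable_indic].
move=> x; rewrite normrM ler_piMr//.
by rewrite indicE; case: (_ \in _); rewrite ?normr1 ?normr0.
Qed.

(** Image measures: a map that multiplies Lebesgue measure by k under preimages
    multiplies integrals by k under composition. Affine maps and reflections are
    the two cases of interest. *)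
Lemma line_int_transfer (phi : R -> R) (k : R) f :
  measurable_fun setT phi -> 0 <= k ->
  (forall A, measurable A ->
     lebesgue_measure (phi @^-1` A) = (k%:E * lebesgue_measure A)%E) ->
  summable_fun f ->
  summable_fun (fun x => f (phi x)) /\ line_int (fun x => f (phi x)) = k * line_int f.
Proof.
move=> mphi k0 mk fi.
have mf := summable_measurable fi.
pose phi' : {mfun (measurableTypeR R) >-> (measurableTypeR R)} :=
  HB.pack phi (isMeasurableFun.Build _ _ _ _ _
    (mphi : @measurable_fun _ _ (measurableTypeR R) (measurableTypeR R) setT phi)).
have ge0 (h : R -> \bar R) : measurable_fun setT h -> (forall x, 0 <= h x)%E ->
    (\int[lebesgue_measure]_x h (phi x) =
     k%:E * \int[lebesgue_measure]_x h x)%E.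
  move=> mh h0.
  have -> : (\int[lebesgue_measure]_x h (phi x) =
      \int[pushforward lebesgue_measure phi']_x h x)%E.
    by rewrite ge0_integral_pushforward.
  have -> : (k%:E * \int[lebesgue_measure]_x h x =
      \int[mscale (NngNum k0) lebesgue_measure]_x h x)%E.
    by rewrite ge0_integral_mscale.
  by apply: eq_measure_integral => A mA _; exact: mk.
have mEf : measurable_fun setT (EFin \o f) by exact/measurable_EFinP.
have E : (\int[lebesgue_measure]_x (f (phi x))%:E =
          k%:E * \int[lebesgue_measure]_x (f x)%:E)%E.
  rewrite integralE [in RHS]integralE.
  have Hp := ge0 _ (measurable_funepos mEf) (funepos_ge0 _).
  have Hn := ge0 _ (measurable_funeneg mEf) (funeneg_ge0 _).
  have pc : (fun x => (f (phi x))%:E)^\+%E = (fun x => (EFin \o f)^\+%E (phi x)).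
    by rewrite -[RHS]/((EFin \o f)^\+%E \o phi) -funepos_comp.
  have nc : (fun x => (f (phi x))%:E)^\-%E = (fun x => (EFin \o f)^\-%E (phi x)).
    by rewrite -[RHS]/((EFin \o f)^\-%E \o phi) -funeneg_comp.
  rewrite pc nc Hp Hn -muleBr//.
  by apply: integrable_add_def.
have F : summable_fun (f \o phi).
  apply/integrableP; split; first by apply/measurable_EFinP; exact: measurableT_comp.
  have := ge0 (fun x => `|f x|%:E) _ _; rewrite /= => -> //.
  - by rewrite lte_mul_pinfty//; have /integrableP[] := fi.
  - by apply/measurable_EFinP; exact: measurableT_comp.
split => //; rewrite /line_int /Rintegral E fineM//.
exact: integrable_fin_num.
Qed.

(** Lebesgue measure is characterised by its values on intervals, so its image
    under an affine bijection is a multiple of itself; integrals are then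
    transferred along that bijection. *)
Lemma lebesgue_measure_affine (a b : R) (A : set R) : 0 < a -> measurable A ->
  lebesgue_measure ((fun y : R => b + a * y) @^-1` A) =
  (a^-1%:E * lebesgue_measure A)%E.
Proof.
move=> a0 mA.
have mphi : measurable_fun setT (fun y : R => b + a * y).
  by apply: measurable_funD => //; exact: measurable_funM.
pose m := mscale (NngNum (ltW a0))
  (@measure_function_pushforward__canonical__measure_function_Measure _ _
     (measurableTypeR R) (measurableTypeR R) _ (@lebesgue_measure R) _ mphi).
have H := @lebesgue_measure_unique R m.
suff HA : lebesgue_measure A = m A.
  by rewrite HA /m/= /mscale/= /pushforward muleA -EFinM mulVf ?gt_eqF// mul1e.
apply: H => //.
move=> X [[x y] _ <-] /=.
rewrite /m /= /mscale /= /pushforward (_ : _ @^-1` _ = `](x - b) / a, (y - b) / a]%classic).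
  have lm (u v : R) : lebesgue_measure `]u, v]%classic =
      (if (u < v)%R then (v - u)%:E else 0)%E.
    by rewrite lebesgue_measure_itv /= lte_fin.
  rewrite !lm ltr_pM2r ?invr_gt0// ltrD2r.
  case: ifP => _; last by rewrite mule0.
  by rewrite -EFinM; congr EFin; field; rewrite gt_eqF.
apply/seteqP; split => z /=; rewrite !in_itv/= ltr_pdivrMr// ler_pdivlMr//; lra.
Qed.

Lemma line_int_affine (a b : R) f : 0 < a -> summable_fun f ->
  summable_fun (fun y => f (b + a * y)) /\
  line_int (fun y => f (b + a * y)) = a^-1 * line_int f.
Proof.
move=> a0 fi.
have mphi : measurable_fun setT (fun y : R => b + a * y).
  by apply: measurable_funD => //; exact: measurable_funM.
apply: (line_int_transfer mphi _ _ fi); first by rewrite invr_ge0 ltW.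
by move=> A mA; exact: lebesgue_measure_affine.
Qed.

Lemma line_int_reflect (b : R) f : summable_fun f ->
  summable_fun (fun y => f (b - y)) /\ line_int (fun y => f (b - y)) = line_int f.
Proof.
move=> fi.
have [gi ge] : summable_fun (fun y => f (- y)) /\ line_int (fun y => f (- y)) = line_int f.
  have := @line_int_transfer -%R 1 f _ ler01 _ fi; rewrite mul1r; apply => //.
  by move=> A mA; rewrite mul1e; exact: lebesgue_measureN.
have [hi he] := line_int_affine (- b) ltr01 gi.
rewrite -ge; move: he hi; rewrite invr1 mul1r => <-.
rewrite (_ : (fun y => f (- (- b + 1 * y))) = (fun y => f (b - y)))//.
by apply/funext => y; rewrite mul1r opprD opprK.
Qed.

End LineIntegrals.

(** * The Gaussian kernel and its derivatives *)

Section GaussKernel.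
Variable R : realType.
Implicit Types (s xi eta d r : R).

(** The self-similar heat kernel at time 1, of total mass 1. *)
Definition hker s : R := b_gauss s / 2.

(** Hermite-type polynomials: the j-th derivative of the kernel is the kernel
    times this polynomial. *)
Definition kpoly (j : nat) : {poly R} :=
  iter j (fun p => p^`() - 2^-1 *: ('X * p)) 1.

Definition kder (j : nat) s : R := (kpoly j).[s] * hker s.

Lemma hker_gt0 s : 0 < hker s.
Proof.
by rewrite /hker /b_gauss !mulr_gt0 ?invr_gt0 ?sqrtr_gt0 ?pi_gt0 ?expR_gt0.
Qed.

Lemma kder0E s : kder 0 s = hker s.
Proof. by rewrite /kder /kpoly /= -polyC1 hornerC mul1r. Qed.

Lemma kpoly1 : kpoly 1 = - (2^-1 *: 'X).
Proof. by rewrite /kpoly /= mulr1 -polyC1 derivC sub0r. Qed.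

Lemma kder1E s : kder 1 s = - (s / 2) * hker s.
Proof. by rewrite /kder kpoly1 hornerN hornerZ hornerX; ring. Qed.

Lemma kder2E s : kder 2 s = (s ^+ 2 / 4 - 2^-1) * hker s.
Proof.
rewrite /kder (_ : kpoly 2 = (kpoly 1)^`() - 2^-1 *: ('X * kpoly 1))// kpoly1.
rewrite poly.derivN derivZ derivX hornerD !hornerN !hornerZ hornerM hornerN hornerZ hornerX.
by rewrite -polyC1 hornerC; field.
Qed.

Lemma hkerN s : hker (- s) = hker s.
Proof. by rewrite /hker /b_gauss sqrrN. Qed.

Lemma der_hker s : is_derive s 1 hker (- (s / 2) * hker s).
Proof.
have H : is_derive s 1 (fun y : R => - (y ^+ 2 / 4)) (- (s / 2)).
  have K := der_opp (der_mul (der_mul (der_id s) (der_id s)) (der_cst (4^-1 : R) s)).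
  rewrite (_ : - (s / 2) = - ((1 * s + s * 1) * 4^-1 + s * s * 0)); last by field.
  exact: K.
have E := der_comp (is_derive_expR _) H.
have F := der_mul (der_scale (Num.sqrt (pi : R))^-1 E) (der_cst (2^-1 : R) s).
rewrite (_ : - (s / 2) * hker s =
  (Num.sqrt pi)^-1 * (expR (- (s ^+ 2 / 4)) * - (s / 2)) / 2 +
   (Num.sqrt pi)^-1 * expR (- (s ^+ 2 / 4)) * 0) //.
by rewrite /hker /b_gauss; ring.
Qed.

Lemma der_kder j s : is_derive s 1 (kder j) (kder j.+1 s).
Proof.
have := der_mul (is_derive_poly (kpoly j) s) (der_hker s).
rewrite (_ : _ + _ = kder j.+1 s)//.
by rewrite /kder /= hornerD hornerN hornerZ hornerM hornerX; ring.
Qed.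

Lemma measurable_kder j : measurable_fun setT (kder j).
Proof. by apply: continuous_measurable_fun => s; exact: der_continuous (der_kder j s). Qed.

Lemma measurable_kder_shift j xi : measurable_fun setT (fun eta => kder j (xi - eta)).
Proof.
apply: (measurableT_comp (measurable_kder j)).
by apply: measurable_funB.
Qed.

(** Any polynomial is absorbed by an arbitrarily small part of a Gaussian. *)
Lemma poly_le_gauss (p : {poly R}) d : 0 < d ->
  exists2 C, 0 <= C & forall s, `|p.[s]| <= C * expR (d * s ^+ 2).
Proof.
elim/poly_ind: p d => [|p c IH] d d0.
  by exists 0 => // s; rewrite horner0 normr0 mul0r.
have d20 : 0 < d / 2 by rewrite divr_gt0.
have [C C0 HC] := IH _ d20.
exists (C * (1 + (d / 2)^-1) + `|c|) => [|s].
  by rewrite addr_ge0// mulr_ge0// addr_ge0// ltW// invr_gt0.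
rewrite hornerD hornerM hornerX hornerC (le_trans (ler_normD _ _))// mulrDl lerD//; last first.
  by rewrite ler_peMr// -[X in X <= _]expR0 ler_expR mulr_ge0 ?sqr_ge0// ltW.
rewrite normrM (_ : d * s ^+ 2 = d / 2 * s ^+ 2 + d / 2 * s ^+ 2); last by field.
rewrite expRD mulrACA ler_pM ?HC//.
have e1 := expR_ge1Dx (d / 2 * s ^+ 2).
have : (1 + (d / 2)^-1) * (1 + d / 2 * s ^+ 2) <= (1 + (d / 2)^-1) * expR (d / 2 * s ^+ 2).
  by apply: ler_wpM2l => //; rewrite addr_ge0// ltW// invr_gt0.
apply: le_trans.
have -> : (1 + (d / 2)^-1) * (1 + d / 2 * s ^+ 2) =
  1 + s ^+ 2 + ((d / 2)^-1 + d / 2 * s ^+ 2) by field; rewrite gt_eqF.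
have t0 : 0 <= (d / 2)^-1 + d / 2 * s ^+ 2.
  by apply: addr_ge0; [rewrite ltW// invr_gt0|rewrite mulr_ge0 ?sqr_ge0// ltW].
apply: (@le_trans _ _ (1 + s ^+ 2)); last by rewrite lerDl.
rewrite -[s ^+ 2]real_normK ?num_real//; have := normr_ge0 s.
set u := `|s| => u0; nra.
Qed.

Lemma summable_gauss a : 0 < a -> summable_fun (fun s : R => expR (- (a * s ^+ 2))).
Proof.
move=> a0.
have sa : 0 < Num.sqrt a by rewrite sqrtr_gt0.
have [H _] := line_int_affine 0 sa (@integrableT_gauss R).
move: H; rewrite (_ : (fun y => _) = (fun s : R => expR (- (a * s ^+ 2)))); last first.
  by apply/funext => y; rewrite /gauss_fun add0r exprMn sqr_sqrtr// ltW.
by apply.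
Qed.

Lemma summable_gauss_le (f : R -> R) C a : measurable_fun setT f -> 0 < a ->
  (forall s, `|f s| <= C * expR (- (a * s ^+ 2))) -> summable_fun f.
Proof.
move=> mf a0 fC; apply: (summable_le mf _ fC).
exact: summableZ (summable_gauss a0).
Qed.

Lemma kder_bound j d : 0 < d ->
  exists2 C, 0 <= C & forall s, `|kder j s| <= C * expR (- ((1 - d) / 4 * s ^+ 2)).
Proof.
move=> d0; have d40 : 0 < d / 4 by rewrite divr_gt0.
have [C C0 HC] := poly_le_gauss (kpoly j) d40.
have k0 : 0 <= (Num.sqrt (pi : R))^-1 / 2 by rewrite divr_ge0// invr_ge0 sqrtr_ge0.
exists (C * ((Num.sqrt pi)^-1 / 2)) => [|s]; first by rewrite mulr_ge0.
rewrite normrM (gtr0_norm (hker_gt0 s)) /hker /b_gauss.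
rewrite (_ : - ((1 - d) / 4 * s ^+ 2) = d / 4 * s ^+ 2 + (- (s ^+ 2 / 4))); last by field.
rewrite expRD mulrACA.
rewrite (_ : (Num.sqrt pi)^-1 * _ / 2 = (Num.sqrt pi)^-1 / 2 * expR (- (s ^+ 2 / 4))); last by ring.
by apply: ler_wpM2r => //; rewrite mulr_ge0// expR_ge0.
Qed.

(** Completing the square: moving the centre of a Gaussian within a bounded set
    costs an arbitrarily small part of the exponent; the linear weight is
    absorbed in the same way. *)
Lemma kder_shift_bound j d r : 0 < d < 1 ->
  exists2 C, 0 <= C & forall xi eta, `|xi| <= r ->
    `|kder j (xi - eta)| * (1 + `|eta|) <= C * expR (- ((1 - d) / 4 * eta ^+ 2)).
Proof.
(* As (1 - e)^2 - e >= 1 - 3 e = 1 - d, one third of d is spent on the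
   polynomial factor, one on the shift and one on the weight 1 + |eta|. *)
move=> /andP[d0 d1]; pose e := d / 3.
have e0 : 0 < e by rewrite /e divr_gt0.
have e40 : 0 < e / 4 by rewrite divr_gt0.
have [C C0 HC] := kder_bound j e0.
have [D D0 HD] := poly_le_gauss ('X + 1) e40.
exists (C * expR ((e^-1 - 1) / 4 * r ^+ 2) * D) => [|xi eta xir].
  by rewrite !mulr_ge0// expR_ge0.
apply: (@le_trans _ _ (C * expR ((e^-1 - 1) / 4 * r ^+ 2) *
   expR (- ((1 - e) ^+ 2 / 4 * eta ^+ 2)) * (D * expR (e / 4 * eta ^+ 2)))).
  apply: ler_pM => //; last first.
    have := HD `|eta|; rewrite hornerD hornerX -polyC1 hornerC [`|eta| + 1]addrC.
    by rewrite real_normK ?num_real// ger0_norm// addr_ge0.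
  apply: (le_trans (HC _)); rewrite -[X in _ <= X]mulrA ler_wpM2l// -expRD ler_expR.
  have r2 : xi ^+ 2 <= r ^+ 2.
    by rewrite -[xi ^+ 2]real_normK ?num_real// lerXn2r ?nnegrE// (le_trans _ xir).
  have e1 : e < 1 by rewrite /e ltr_pdivrMr//; lra.
  have key : (1 - e) * eta ^+ 2 <= (xi - eta) ^+ 2 + (e^-1 - 1) * xi ^+ 2.
    rewrite -subr_ge0.
    have -> : (xi - eta) ^+ 2 + (e^-1 - 1) * xi ^+ 2 - (1 - e) * eta ^+ 2 =
       e^-1 * (xi - e * eta) ^+ 2 by field; rewrite gt_eqF.
    by rewrite mulr_ge0 ?sqr_ge0// ltW// invr_gt0.
  have i1 : 1 <= e^-1 by rewrite invr_ge1 ?unitfE ?gt_eqF ?ltW.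
  have K2 : (1 - e) * ((1 - e) * eta ^+ 2) <= (1 - e) * ((xi - eta) ^+ 2 + (e^-1 - 1) * xi ^+ 2).
    by rewrite ler_wpM2l// subr_ge0 ltW.
  have K3 : (1 - e) * ((e^-1 - 1) * xi ^+ 2) <= (e^-1 - 1) * r ^+ 2.
    apply: (@le_trans _ _ ((e^-1 - 1) * xi ^+ 2)).
      have p0 : 0 <= (e^-1 - 1) * xi ^+ 2 by rewrite mulr_ge0 ?sqr_ge0// subr_ge0.
      by move: p0 e0 e1; set p := _ * xi ^+ 2; nra.
    by rewrite ler_wpM2l// subr_ge0.
  move: K2 K3; rewrite !mulrDr; set X := (1 - e) * (xi - eta) ^+ 2.
  have -> : - ((1 - e) / 4 * (xi - eta) ^+ 2) = - X / 4 by rewrite /X; field.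
  set Y := (1 - e) * ((1 - e) * eta ^+ 2).
  have -> : (1 - e) ^+ 2 / 4 * eta ^+ 2 = Y / 4 by rewrite /Y; field.
  set Z := (1 - e) * (_ * xi ^+ 2); set T := (e^-1 - 1) * r ^+ 2.
  have -> : (e^-1 - 1) / 4 * r ^+ 2 = T / 4 by rewrite /T; ring.
  lra.
rewrite mulrACA -[X in _ <= X]mulr1 -!mulrA ler_wpM2l// ler_wpM2l ?expR_ge0//.
rewrite ler_wpM2l// mulr1 -expRD ler_expR.
have s0 := sqr_ge0 eta; rewrite /e; nra.
Qed.

Lemma line_int_hker : summable_fun hker /\ line_int hker = 1.
Proof.
have h2 : 0 < (2^-1 : R) by rewrite invr_gt0.
have [H E] := line_int_affine 0 h2 (@integrableT_gauss R).
have hE : hker = fun s => ((Num.sqrt pi)^-1 / 2) * gauss_fun (0 + 2^-1 * s).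
  apply/funext => s; rewrite /hker /b_gauss /gauss_fun add0r exprMn mulrAC.
  by congr (_ * expR _); field.
rewrite hE; split; first exact: summableZ.
rewrite line_intZ// E /line_int /Rintegral integralT_gauss invrK /=.
by field; rewrite gt_eqF// sqrtr_gt0 pi_gt0.
Qed.

Lemma summable_kder j : summable_fun (kder j).
Proof.
have h2 : 0 < (2^-1 : R) by rewrite invr_gt0.
have [C C0 HC] := kder_bound j h2.
apply: (summable_gauss_le (C := C) (a := 8^-1) (measurable_kder j)) => // s.
by rewrite (_ : 8^-1 = (1 - 2^-1) / 4)//; field.
Qed.

End GaussKernel.

(** * Gaussian averages and their derivatives *)

Section HeatOperator.
Variable R : realType.
Implicit Types (f g : R -> R) (x t xi eta d r A : R).

Lemma der_line_int (f df : R -> R -> R) (a e : R) (G : R -> R) : 0 < e ->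
  (forall x, `|x - a| < e -> summable_fun (f x)) ->
  (forall x y, `|x - a| < e -> is_derive x 1 (f ^~ y) (df x y)) ->
  summable_fun G ->
  (forall x y, `|x - a| < e -> `|df x y| <= G y) ->
  is_derive a 1 (fun x => line_int (f x)) (line_int (df a)).
Proof.
move=> e0 fs fd Gs dG.
have I x : `]a - e, a + e[%classic x -> `|x - a| < e.
  by rewrite /= in_itv/= ltr_norml => /andP[? ?]; lra.
have Ia : `]a - e, a + e[%classic a by rewrite /= in_itv/=; lra.
have d1 x y : `]a - e, a + e[%classic x -> partial1of2 f x y = df x y.
  by move=> xI; apply: der_derive1; apply: fd; exact: I.
have D := @derivable_under_integral R _ _ lebesgue_measure f setT measurableT a
  (a - e) (a + e) Ia.
have E := @differentiation_under_integral R _ _ lebesgue_measure f setT measurableT a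
  (a - e) (a + e) Ia.
have h1 x : `]a - e, a + e[%classic x ->
  (@lebesgue_measure R).-integrable setT (EFin \o f x) by move=> xI; apply: fs; exact: I.
have h2 x y : `]a - e, a + e[%classic x -> setT y -> derivable (f ^~ y) x 1.
  by move=> xI _; have := fd x y (I _ xI).
have h3 y : 0 <= G y by apply: le_trans (dG a y (I _ Ia)).
have h4 x y : `]a - e, a + e[%classic x -> setT y -> `|partial1of2 f x y| <= G y.
  by move=> xI _; rewrite d1//; apply: dG; exact: I.
apply: DeriveDef; first exact: (D h1 h2 G h3 Gs h4).
rewrite -derive1E (E h1 h2 G h3 Gs h4) /line_int.
by apply: eq_Rintegral => y _; exact: d1.
Qed.

(** Linear growth is the natural class here because the staircase grows like the
    identity. *)
Definition lin_growth A f :=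
  measurable_fun setT f /\ forall eta, `|f eta| <= A * (1 + `|eta|).

(** The index counts the derivatives that fall on the kernel; for j = 0 this is
    the heat flow at time 1. *)
Definition heat_op (j : nat) f xi : R :=
  line_int (fun eta => kder j (xi - eta) * f eta).

Lemma lin_growth_ge0 A f : lin_growth A f -> 0 <= A.
Proof.
by move=> [_ /(_ 0)]; rewrite normr0 addr0 mulr1; exact: le_trans.
Qed.

Lemma lin_growthB A B f g : lin_growth A f -> lin_growth B g ->
  lin_growth (A + B) (fun eta => f eta - g eta).
Proof.
move=> [mf fA] [mg gB]; split; first exact: measurable_funB.
by move=> eta; rewrite (le_trans (ler_normB _ _))// mulrDl lerD.
Qed.

Lemma lin_growth_bounded A f : measurable_fun setT f ->
  (forall eta, `|f eta| <= A) -> lin_growth A f.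
Proof.
move=> mf fA; split => // eta; apply: le_trans (fA _) _.
by rewrite ler_peMr ?lerDl// (le_trans _ (fA 0)).
Qed.

Lemma lin_growthD A B f g : lin_growth A f -> lin_growth B g ->
  lin_growth (A + B) (fun eta => f eta + g eta).
Proof.
move=> [mf fA] [mg gB]; split; first exact: measurable_funD.
by move=> eta; rewrite (le_trans (ler_normD _ _))// mulrDl lerD.
Qed.

Lemma lin_growthZ A k f : lin_growth A f -> lin_growth (`|k| * A) (fun eta => k * f eta).
Proof.
move=> [mf fA]; split; first exact: measurable_funM.
by move=> eta; rewrite normrM -mulrA ler_wpM2l.
Qed.

Lemma lin_growth_id : lin_growth 1 (fun eta => eta).
Proof. by split => [|eta]; [exact: measurable_id|rewrite mul1r lerDr]. Qed.

Lemma measurable_heat_op j f xi : measurable_fun setT f ->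
  measurable_fun setT (fun eta => kder j (xi - eta) * f eta).
Proof. by move=> mf; apply: measurable_funM => //; exact: measurable_kder_shift. Qed.

Lemma heat_op_dominated j d r : 0 < d < 1 -> exists2 C, 0 <= C &
  forall A f xi, lin_growth A f -> `|xi| <= r -> forall eta,
  `|kder j (xi - eta) * f eta| <= C * A * expR (- ((1 - d) / 4 * eta ^+ 2)).
Proof.
move=> dd; have [C C0 HC] := kder_shift_bound j r dd.
exists C => // A f xi fA xir eta; have A0 := lin_growth_ge0 fA.
have [mf fb] := fA; rewrite normrM.
apply: (@le_trans _ _ (`|kder j (xi - eta)| * (A * (1 + `|eta|)))).
  by rewrite ler_wpM2l.
rewrite mulrCA mulrAC mulrC ler_wpM2r//.
exact: HC.
Qed.

Lemma summable_heat_op j A f xi : lin_growth A f ->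
  summable_fun (fun eta => kder j (xi - eta) * f eta).
Proof.
move=> fA; have h2 : 0 < (2^-1 : R) < 1 by lra.
have [C C0 HC] := heat_op_dominated j `|xi| h2.
apply: (summable_gauss_le (C := C * A) (a := (1 - 2^-1) / 4)); last exact: HC.
  by apply: measurable_heat_op; case: fA.
lra.
Qed.

(** A function that vanishes on [-rho, rho] is only seen through the Gaussian
    tail beyond rho. *)
Lemma heat_op_tail j d r : 0 < d < 1 -> exists2 C, 0 <= C &
  forall A f rho xi, lin_growth A f -> 0 <= rho ->
  (forall eta, `|eta| < rho -> f eta = 0) -> `|xi| <= r ->
  `|heat_op j f xi| <= C * A * expR (- ((1 - d) / 4 * rho ^+ 2)).
Proof.
(* The exponent splits as (1 - d / 2) / 4 = (1 - d) / 4 + d / 8: the first term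
   is evaluated at rho, the second keeps the Gaussian summable. *)
move=> /andP[d0 d1]; have d2 : 0 < d / 2 < 1 by lra.
have [C C0 HC] := heat_op_dominated j r d2.
have d8 : 0 < d / 8 by lra.
have I0 : 0 <= line_int (fun s => expR (- (d / 8 * s ^+ 2))).
  by apply: line_int_ge0 => s; exact: expR_ge0.
exists (C * line_int (fun s => expR (- (d / 8 * s ^+ 2)))) => [|A f rho xi fA r0 f0 xir].
  by rewrite mulr_ge0.
have A0 := lin_growth_ge0 fA.
rewrite [X in _ <= X](_ : _ = line_int (fun s => C * A * expR (- ((1 - d) / 4 * rho ^+ 2)) *
   expR (- (d / 8 * s ^+ 2)))); last first.
  by rewrite line_intZ; [ring|exact: summable_gauss].
apply: norm_line_int => [||eta].
- by apply: measurable_heat_op; case: fA.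
- exact/summableZ/summable_gauss.
have [/f0 ->|rh] := ltP `|eta| rho.
  by rewrite mulr0 normr0 !mulr_ge0 ?expR_ge0.
apply: le_trans (HC A f xi fA xir eta) _.
rewrite -[X in _ <= X]mulrA ler_wpM2l ?mulr_ge0// -expRD ler_expR.
have : rho ^+ 2 <= eta ^+ 2.
  by rewrite -[eta ^+ 2]real_normK ?num_real// lerXn2r ?nnegrE.
by have := sqr_ge0 eta; nra.
Qed.

Lemma heat_op_growth j r : exists2 C, 0 <= C & forall A f xi,
  lin_growth A f -> `|xi| <= r -> `|heat_op j f xi| <= C * A.
Proof.
have h2 : 0 < (2^-1 : R) < 1 by lra.
have [C C0 HC] := heat_op_tail j r h2; exists C => // A f xi fA xr.
have := HC A f 0 xi fA (lexx _) _ xr.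
(* With rho = 0 the tail estimate bounds the whole average. *)
rewrite expr0n mulr0 oppr0 expR0 mulr1; apply => eta.
by rewrite ltNge normr_ge0.
Qed.

(** The derivative falls on the kernel, so f need not even be continuous. *)
Lemma der_heat_op j A f xi : lin_growth A f ->
  is_derive xi 1 (heat_op j f) (heat_op j.+1 f xi).
Proof.
move=> fA; have h2 : 0 < (2^-1 : R) < 1 by lra.
have [C C0 HC] := heat_op_dominated j.+1 (`|xi| + 1) h2.
apply: (@der_line_int (fun x eta => kder j (x - eta) * f eta)
  (fun x eta => kder j.+1 (x - eta) * f eta) xi 1
  (fun eta => C * A * expR (- ((1 - 2^-1) / 4 * eta ^+ 2)))) => //.
- by move=> x _; exact: summable_heat_op fA.
- move=> x y _.
  have D : is_derive x 1 (fun z => z - y) 1.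
    by have := der_sub (der_id x) (der_cst y x); rewrite subr0.
  have := der_mul (der_comp (f := kder j) (g := fun z => z - y) (der_kder j (x - y)) D) (der_cst (f y) x).
  by rewrite mulr1 mulr0 addr0.
- by apply/summableZ/summable_gauss; lra.
- move=> x y xi1; apply: HC => //.
  by rewrite -[x](subrK xi) (le_trans (ler_normD _ _))// addrC lerD2l ltW.
Qed.

Lemma heat_opB j A B f g xi : lin_growth A f -> lin_growth B g ->
  heat_op j (fun eta => f eta - g eta) xi = heat_op j f xi - heat_op j g xi.
Proof.
move=> fA gB; rewrite /heat_op -line_intB//; last 2 first.
- exact: summable_heat_op fA.
- exact: summable_heat_op gB.
by apply: eq_line_int => y; rewrite mulrBr.
Qed.

Lemma heat_opZ j A k f xi : lin_growth A f ->
  heat_op j (fun eta => k * f eta) xi = k * heat_op j f xi.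
Proof.
move=> fA; rewrite /heat_op -line_intZ//; last exact: summable_heat_op fA.
by apply: eq_line_int => y; rewrite mulrCA.
Qed.

(** Moving the variable from the kernel to f gives bounds that are uniform in
    xi. *)
Lemma heat_op_shift j A f xi : lin_growth A f ->
  summable_fun (fun s => kder j s * f (xi - s)) /\
  heat_op j f xi = line_int (fun s => kder j s * f (xi - s)).
Proof.
move=> fA; have [H E] := line_int_reflect xi (summable_heat_op j xi fA).
rewrite /heat_op -E.
rewrite (_ : (fun s => kder j s * f (xi - s)) =
  (fun y => kder j (xi - (xi - y)) * f (xi - y)))//.
by apply/funext => s; rewrite subKr.
Qed.

Lemma heat_op_bounded j : exists2 C, 0 <= C & forall A f xi,
  measurable_fun setT f -> (forall eta, `|f eta| <= A) -> `|heat_op j f xi| <= C * A.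
Proof.
have sk := summable_kder R j.
exists (line_int (fun s => `|kder j s|)) => [|A f xi mf fA].
  exact: line_int_ge0.
have A0 : 0 <= A by apply: le_trans (fA 0).
have [H ->] := heat_op_shift j xi (lin_growth_bounded mf fA).
rewrite mulrC -line_intZ; last exact: summable_norm.
apply: norm_line_int; first exact: summable_measurable.
  exact/summableZ/summable_norm.
by move=> s; rewrite normrM mulrC ler_wpM2r.
Qed.

End HeatOperator.

(** * The heat flow on the line *)

Section HeatFlow.
Variable R : realType.
Implicit Types (f g : R -> R) (x t xi eta d r A : R).

(** The Gaussian variable is rescaled so that the formula makes sense at t = 0,
    where it returns g. *)
Definition heat_flow g x t : R := line_int (fun s => hker s * g (x - Num.sqrt t * s)).

Lemma heat_flow0 g x : heat_flow g x 0 = g x.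
Proof.
have [h1 h2] := line_int_hker R; rewrite /heat_flow sqrtr0.
rewrite -[RHS]mulr1 -h2 -line_intZ//; apply: eq_line_int => s.
by rewrite mul0r subr0 mulrC.
Qed.

Lemma lin_growth_scale A g k : 0 <= k -> lin_growth A g ->
  lin_growth (A * (1 + k)) (fun eta => g (eta * k)).
Proof.
move=> k0 gA; have A0 := lin_growth_ge0 gA; case: gA => mg gA; split.
  by apply: (measurableT_comp mg); exact: measurable_funM.
move=> eta; apply: le_trans (gA _) _; rewrite -mulrA ler_wpM2l// normrM (ger0_norm k0).
by have := normr_ge0 eta; nra.
Qed.

(** In the similarity variable the flow at time t is the flow at time 1 of the
    rescaled datum. *)
Lemma heat_flowE A g xi t : 0 < t -> lin_growth A g ->
  heat_flow g (xi * Num.sqrt t) t = heat_op 0 (fun eta => g (eta * Num.sqrt t)) xi.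
Proof.
move=> t0 gA; have [_ ->] := heat_op_shift 0 xi (lin_growth_scale (sqrtr_ge0 t) gA).
by apply: eq_line_int => s; rewrite kder0E mulrBl [s * _]mulrC.
Qed.

Lemma heat_flowE' A g x t : 0 < t -> lin_growth A g ->
  heat_flow g x t = heat_op 0 (fun eta => g (eta * Num.sqrt t)) (x / Num.sqrt t).
Proof.
move=> t0 gA; rewrite -(heat_flowE _ t0 gA) divfK// gt_eqF// sqrtr_gt0//.
Qed.

Lemma der_heat_op_scaled j A g x t : 0 < t -> lin_growth A g ->
  is_derive x 1 (fun y => heat_op j (fun eta => g (eta * Num.sqrt t)) (y / Num.sqrt t))
   (heat_op j.+1 (fun eta => g (eta * Num.sqrt t)) (x / Num.sqrt t) / Num.sqrt t).
Proof.
move=> t0 gA.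
have D : is_derive x 1 (fun z => z / Num.sqrt t) (Num.sqrt t)^-1.
  by have := der_mul (der_id x) (der_cst (Num.sqrt t)^-1 x); rewrite mul1r mulr0 addr0.
exact: (der_comp (der_heat_op j _ (lin_growth_scale (sqrtr_ge0 t) gA)) D).
Qed.

Lemma heat_op_unscale j A g x t : 0 < t -> lin_growth A g ->
  summable_fun (fun y => (Num.sqrt t)^-1 * kder j ((x - y) / Num.sqrt t) * g y) /\
  heat_op j (fun eta => g (eta * Num.sqrt t)) (x / Num.sqrt t) =
  line_int (fun y => (Num.sqrt t)^-1 * kder j ((x - y) / Num.sqrt t) * g y).
Proof.
move=> t0 gA; have st : 0 < Num.sqrt t by rewrite sqrtr_gt0.
have sti : 0 < (Num.sqrt t)^-1 by rewrite invr_gt0.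
have sm := summable_heat_op j (x / Num.sqrt t) (lin_growth_scale (sqrtr_ge0 t) gA).
have [H E] := line_int_affine 0 sti sm.
have K : (fun y => (Num.sqrt t)^-1 * kder j ((x - y) / Num.sqrt t) * g y) =
   (fun y => (Num.sqrt t)^-1 * (kder j (x / Num.sqrt t - (0 + (Num.sqrt t)^-1 * y)) *
      g ((0 + (Num.sqrt t)^-1 * y) * Num.sqrt t))).
  apply/funext => y; rewrite add0r mulrBl [y / _]mulrC.
  by rewrite (_ : (Num.sqrt t)^-1 * y * Num.sqrt t = y) ?mulrA// mulrAC mulVf ?gt_eqF// mul1r.
rewrite K; split; first exact: summableZ.
by rewrite line_intZ// E invrK mulrA mulVf ?gt_eqF// mul1r.
Qed.

(** The heat equation for the kernel: the time derivative is expressed by the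
    second space derivative. *)
Lemma der_hker_time (z t : R) : 0 < t ->
  is_derive t 1 (fun u => (Num.sqrt u)^-1 * hker (z / Num.sqrt u))
    (t^-1 * ((Num.sqrt t)^-1 * kder 2 (z / Num.sqrt t))).
Proof.
move=> t0; have st : 0 < Num.sqrt t by rewrite sqrtr_gt0.
have ds := is_derive1_sqrt t0.
have di := der_inv (lt0r_neq0 st) ds.
have dz := der_scale z di.
have dk := der_comp (f := @hker R) (g := fun y => z / Num.sqrt y) (der_hker (z * (Num.sqrt t)^-1)) dz.
have := der_mul di dk; rewrite kder2E.
set a := (X in is_derive _ _ _ X -> _); set b := (X in _ -> is_derive _ _ _ X).
suff -> : a = b by [].
rewrite /a /b.
have st2 : t = Num.sqrt t * Num.sqrt t by rewrite -expr2 sqr_sqrtr// ltW.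
have -> : t^-1 = (Num.sqrt t * Num.sqrt t)^-1 by rewrite -st2.
set h := hker _; set q := Num.sqrt t.
by field; rewrite gt_eqF.
Qed.

(** Domination of the time derivative of the kernel, uniform for u near t as
    required to differentiate under the integral. *)
Lemma kder2_time_bound (t : R) : 0 < t -> exists2 C, 0 <= C &
  forall u z, `|u - t| < t / 2 ->
  `|u^-1 * ((Num.sqrt u)^-1 * kder 2 (z / Num.sqrt u))| * (1 + `|z|) <=
    C * expR (- ((16 * t)^-1 * z ^+ 2)).
Proof.
move=> t0; have st : 0 < Num.sqrt (t / 2) by rewrite sqrtr_gt0; lra.
have h2 : 0 < (2^-1 : R) by lra.
have t16 : 0 < (48 * t)^-1 by rewrite invr_gt0; lra.
have t3 : 0 < (4 : R)^-1 by lra.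
have [C C0 HC] := kder_bound 2 t3.
have [D D0 HD] := poly_le_gauss ('X + 1) t16.
exists ((t / 2)^-1 * ((Num.sqrt (t / 2))^-1 * C) * D) => [|u z].
  by rewrite !mulr_ge0// invr_ge0 ltW//; lra.
rewrite ltr_norml => /andP[u1 u2]; have u0 : 0 < u by lra.
have tu : t / 2 <= u by lra.
have su : 0 < Num.sqrt u by rewrite sqrtr_gt0.
apply: (@le_trans _ _ (((t / 2)^-1 * ((Num.sqrt (t / 2))^-1 *
    (C * expR (- ((1 - 4^-1) / 4 * (z / Num.sqrt u) ^+ 2))))) *
    (D * expR ((48 * t)^-1 * z ^+ 2)))).
  apply: ler_pM => //.
    rewrite normrM (gtr0_norm (_ : 0 < u^-1)) ?invr_gt0//.
    rewrite normrM (gtr0_norm (_ : 0 < (Num.sqrt u)^-1)) ?invr_gt0//.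
    have nn v : 0 < v -> 0 <= v^-1 :> R by move=> v0; rewrite invr_ge0 ltW.
    apply: ler_pM; [exact: nn|by rewrite mulr_ge0// nn| |].
      by rewrite lef_pV2 ?posrE//; lra.
    apply: ler_pM; [exact: nn|by []| |exact: HC].
    by rewrite lef_pV2 ?posrE// ler_sqrt// ltW.
  have := HD `|z|; rewrite hornerD hornerX -polyC1 hornerC [`|z| + 1]addrC.
  by rewrite real_normK ?num_real// ger0_norm// addr_ge0.
rewrite [X in X <= _](_ : _ = (t / 2)^-1 * ((Num.sqrt (t / 2))^-1 * C) * D *
  (expR (- ((1 - 4^-1) / 4 * (z / Num.sqrt u) ^+ 2)) * expR ((48 * t)^-1 * z ^+ 2))); last by ring.
rewrite ler_wpM2l//; first by rewrite !mulr_ge0// invr_ge0 ltW//; lra.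
rewrite -expRD ler_expR expr_div_n sqr_sqrtr; last exact: ltW.
have : (2 * t)^-1 * z ^+ 2 <= z ^+ 2 / u.
  by rewrite mulrC ler_wpM2l ?sqr_ge0// lef_pV2 ?posrE; lra.
have -> : (16 * t)^-1 * z ^+ 2 = (2 * t)^-1 * z ^+ 2 / 8 by field; rewrite gt_eqF.
have -> : (48 * t)^-1 * z ^+ 2 = (2 * t)^-1 * z ^+ 2 / 24 by field; rewrite gt_eqF.
have : 0 <= (2 * t)^-1 * z ^+ 2 by rewrite mulr_ge0 ?sqr_ge0// invr_ge0; lra.
set p := (2 * t)^-1 * _; set q := _ / u; lra.
Qed.

(** Both the space and the time derivative of the heat flow are obtained by
    differentiating the kernel, for which the heat equation is explicit. *)
Lemma heat_flow_der A g x t : 0 < t -> lin_growth A g ->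
  [/\ forall y : R, is_derive y 1 (heat_flow g ^~ t)
        (heat_op 1 (fun eta => g (eta * Num.sqrt t)) (y / Num.sqrt t) / Num.sqrt t),
      is_derive x 1 (fun y => heat_op 1 (fun eta => g (eta * Num.sqrt t)) (y / Num.sqrt t) / Num.sqrt t)
        (t^-1 * heat_op 2 (fun eta => g (eta * Num.sqrt t)) (x / Num.sqrt t)) &
      is_derive t 1 (heat_flow g x)
        (t^-1 * heat_op 2 (fun eta => g (eta * Num.sqrt t)) (x / Num.sqrt t))].
Proof.
move=> t0 gA; have st : 0 < Num.sqrt t by rewrite sqrtr_gt0.
have A0 := lin_growth_ge0 gA.
split.
- move=> y; have := der_heat_op_scaled 0 y t0 gA.
  rewrite (_ : (fun y : R => heat_op 0 _ (y / Num.sqrt t)) = heat_flow g ^~ t)//.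
  by apply/funext => z; rewrite (heat_flowE' _ t0 gA).
- have := der_mul (der_heat_op_scaled 1 x t0 gA) (der_cst (Num.sqrt t)^-1 x).
  rewrite mulr0 addr0 -mulrA -invfM -expr2 sqr_sqrtr; last exact: ltW.
  by rewrite mulrC.
have [C C0 HC] := kder2_time_bound t0.
have t2 : 0 < t / 2 by lra.
have [s2 ->] := heat_op_unscale 2 x t0 gA.
rewrite -line_intZ//.
have t16 : 0 < (16 * t)^-1 by rewrite invr_gt0; lra.
have D := @der_line_int _ (fun u y => (Num.sqrt u)^-1 * hker ((x - y) / Num.sqrt u) * g y)
 (fun u y => u^-1 * ((Num.sqrt u)^-1 * kder 2 ((x - y) / Num.sqrt u) * g y)) t (t / 2)
 (fun y => A * (1 + `|x|) * C * expR (- ((16 * t)^-1 * (x - y) ^+ 2))) t2.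
apply: (der_near _ (D _ _ _ _)).
- near=> u; have u0 : 0 < u by near: u; exact: lt_nbhsr.
  rewrite (heat_flowE' x u0 gA); have [_ ->] := heat_op_unscale 0 x u0 gA.
  by apply: eq_line_int => y; rewrite kder0E.
- move=> u ut; have u0 : 0 < u by move: ut; rewrite ltr_norml; lra.
  have [+ _] := heat_op_unscale 0 x u0 gA.
  rewrite (_ : (fun y => _) = (fun y => (Num.sqrt u)^-1 * hker ((x - y) / Num.sqrt u) * g y))//.
  by apply/funext => y; rewrite kder0E.
- move=> u y ut; have u0 : 0 < u by move: ut; rewrite ltr_norml; lra.
  have := der_mul (der_hker_time (x - y) u0) (der_cst (g y) u).
  by rewrite mulr0 addr0 [X in _ -> is_derive _ _ _ X]mulrA.
- apply: summableZ.
  by have [] := line_int_reflect x (summable_gauss t16).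
move=> u y ut; rewrite mulrA normrM.
apply: (@le_trans _ _ (`|u^-1 * ((Num.sqrt u)^-1 * kder 2 ((x - y) / Num.sqrt u))| *
  (A * ((1 + `|x|) * (1 + `|x - y|))))).
  rewrite ler_wpM2l//; case: gA => _ /(_ y) /le_trans; apply; rewrite ler_wpM2l//.
  have : `|y| <= `|x| + `|x - y|.
    by rewrite (_ : y = x - (x - y)) ?(le_trans (ler_normB _ _))// ?subKr//.
  have := normr_ge0 x; have := normr_ge0 (x - y); nra.
have := HC u (x - y) ut.
have k0 : 0 <= A * (1 + `|x|) by rewrite mulr_ge0// addr_ge0.
move=> /(ler_wpM2l k0); set p := `|u^-1 * _|; set q := expR _.
rewrite (_ : p * (A * ((1 + `|x|) * (1 + `|x - y|))) = A * (1 + `|x|) * (p * (1 + `|x - y|))); last by ring.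
by rewrite -(mulrA _ C q).
Unshelve. all: by end_near.
Qed.

End HeatFlow.

(** * Continuity and symmetries of the heat flow *)

Section HeatFlowContinuity.
Variable R : realType.
Implicit Types (f g : R -> R) (x t xi eta d r A : R).

(** A form of uniform continuity that is stable under averaging: it holds for
    the uniformly continuous functions, bounds the growth, and integrates
    directly against the Gaussian. *)
Definition almost_lipschitz g := forall e, 0 < e -> exists2 C, 0 <= C &
  forall x y, `|g x - g y| <= e + C * `|x - y|.

Lemma almost_lipschitz_continuous g : almost_lipschitz g -> continuous g.
Proof.
move=> gU x; apply/cvgrPdist_le => e e0.
have e2 : 0 < e / 2 by lra.
have [C C0 HC] := gU _ e2.
have d0 : 0 < e / 2 / (C + 1) by rewrite divr_gt0//; lra.
near=> y; apply: le_trans (HC _ _) _.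
have : `|x - y| <= e / 2 / (C + 1) by near: y; exact: cvgr_dist_le.
rewrite ler_pdivlMr; last lra.
by have := normr_ge0 (x - y); nra.
Unshelve. all: by end_near.
Qed.

Lemma almost_lipschitz_growth g : almost_lipschitz g ->
  exists A, lin_growth A g.
Proof.
move=> gU; have [C C0 HC] := gU 1 ltr01.
exists (`|g 0| + 1 + C); split.
  by apply: continuous_measurable_fun; exact: almost_lipschitz_continuous.
move=> y; rewrite -[g y](subrK (g 0)); apply: le_trans (ler_normD _ _) _.
have := HC y 0; rewrite subr0.
by have := normr_ge0 y; have := normr_ge0 (g 0); nra.
Qed.

Lemma lin_growth_affine A g p k : lin_growth A g ->
  lin_growth (A * (1 + `|p| + `|k|)) (fun eta => g (p + k * eta)).
Proof.
move=> gA; have A0 := lin_growth_ge0 gA; case: gA => mg gA; split.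
  apply: (measurableT_comp mg); apply: measurable_funD => //; exact: measurable_funM.
move=> eta; apply: le_trans (gA _) _; rewrite -mulrA ler_wpM2l//.
have := ler_normD p (k * eta); rewrite normrM.
by have := normr_ge0 eta; have := normr_ge0 p; have := normr_ge0 k; nra.
Qed.

Lemma summable_heat_flow A g x t : lin_growth A g ->
  summable_fun (fun s => hker s * g (x - Num.sqrt t * s)).
Proof.
move=> gA; have [H _] := heat_op_shift 0 0 (lin_growth_affine x (Num.sqrt t) gA).
move: H; rewrite (_ : (fun s => _) = (fun s => hker s * g (x - Num.sqrt t * s)))//.
by apply/funext => s; rewrite kder0E sub0r mulrN.
Qed.

Lemma summable_hker_abs : summable_fun (fun s : R => hker s * `|s|).
Proof.
have := summableZ 2 (summable_norm (summable_kder R 1)).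
rewrite (_ : (fun s => _) = (fun s : R => hker s * `|s|))//.
apply/funext => s; rewrite kder1E normrM normrN normrM (gtr0_norm (hker_gt0 _)).
by rewrite (ger0_norm (_ : 0 <= 2^-1)) ?invr_ge0//; field.
Qed.

(** Continuity in both variables at once, down to t = 0: the kernel has a finite
    first moment, so the modulus of continuity of g is averaged directly. *)
Lemma heat_flow_continuous g : almost_lipschitz g ->
  continuous (fun p : R * R => heat_flow g p.1 p.2).
Proof.
move=> gU [x0 t0]; have [A gA] := almost_lipschitz_growth gU.
apply/cvgrPdist_le => e e0 /=.
have e3 : 0 < e / 3 by lra.
have [C C0 HC] := gU _ e3.
pose m := line_int (fun s : R => hker s * `|s|).
have m0 : 0 <= m by apply: line_int_ge0 => s; rewrite mulr_ge0// ltW// hker_gt0.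
have [h1 h2] := line_int_hker R.
have K x t : `|heat_flow g x0 t0 - heat_flow g x t| <=
    e / 3 + C * `|x0 - x| + C * `|Num.sqrt t0 - Num.sqrt t| * m.
  rewrite /heat_flow -line_intB; last 2 first.
  - exact: summable_heat_flow gA.
  - exact: summable_heat_flow gA.
  have -> : e / 3 + C * `|x0 - x| + C * `|Num.sqrt t0 - Num.sqrt t| * m =
      line_int (fun s => (e / 3 + C * `|x0 - x|) * hker s +
        C * `|Num.sqrt t0 - Num.sqrt t| * (hker s * `|s|)).
    rewrite line_intD; last 2 first.
    - exact: summableZ.
    - exact/summableZ/summable_hker_abs.
    rewrite !line_intZ//; first by rewrite h2 mulr1.
    exact: summable_hker_abs.
  apply: norm_line_int.
  - apply: measurable_funB; exact: (summable_measurable (summable_heat_flow _ _ gA)).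
  - apply: summableD; first exact: summableZ.
    exact/summableZ/summable_hker_abs.
  move=> s; rewrite -mulrBr normrM (gtr0_norm (hker_gt0 _)).
  rewrite [X in _ <= X](_ : _ = hker s * (e / 3 + C * (`|x0 - x| +
     `|Num.sqrt t0 - Num.sqrt t| * `|s|))); last by ring.
  apply: ler_wpM2l; first exact/ltW/hker_gt0.
  apply: le_trans (HC _ _) _.
  rewrite lerD2l ler_wpM2l// -normrM.
  rewrite (_ : _ - _ = (x0 - x) - (Num.sqrt t0 - Num.sqrt t) * s); last by ring.
  exact: ler_normB.
have d1 : 0 < e / 3 / (C + 1) by rewrite divr_gt0//; lra.
have d2 : 0 < e / 3 / (C * m + 1) by rewrite divr_gt0// ltr_wpDl ?mulr_ge0.
have c1 : p.1 @[p --> (x0, t0)] --> x0 by exact: cvg_fst.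
have c2 : Num.sqrt p.2 @[p --> (x0, t0)] --> Num.sqrt t0.
  by apply: (@cvg_comp _ _ _ snd Num.sqrt) (@cvg_snd _ _ _ _ _) (@sqrt_continuous R t0).
move/cvgrPdist_le : c1 => /(_ _ d1) c1; move/cvgrPdist_le : c2 => /(_ _ d2) c2.
near=> p.
have p1 : `|x0 - p.1| <= e / 3 / (C + 1) by near: p; exact: c1.
have p2 : `|Num.sqrt t0 - Num.sqrt p.2| <= e / 3 / (C * m + 1) by near: p; exact: c2.
apply: le_trans (K _ _) _.
have Cm : 0 < C * m + 1 by rewrite ltr_wpDl ?mulr_ge0.
have C1 : 0 < C + 1 by lra.
move: p1 p2; rewrite (ler_pdivlMr _ _ C1) (ler_pdivlMr _ _ Cm).
have := normr_ge0 (x0 - p.1); have := normr_ge0 (Num.sqrt t0 - Num.sqrt p.2).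
by set u := `|x0 - _|; set v := `|Num.sqrt _ - _|; nra.
Unshelve. all: by end_near.
Qed.

(** The kernel is even, so a datum that is odd about (p, c) has average c at p
    at all times: reflections realise Dirichlet conditions. *)
Lemma heat_flow_odd A g p c t : lin_growth A g ->
  (forall x, g (2 * p - x) = 2 * c - g x) -> heat_flow g p t = c.
Proof.
move=> gA gs; have [h1 h2] := line_int_hker R.
have S := summable_heat_flow p t gA.
have [_ E] := line_int_reflect 0 S.
have : heat_flow g p t = 2 * c - heat_flow g p t.
  rewrite {1}/heat_flow -E.
  have -> : 2 * c - heat_flow g p t =
    line_int (fun s => 2 * c * hker s - hker s * g (p - Num.sqrt t * s)).
    rewrite line_intB//; last exact: summableZ.
    by rewrite line_intZ// h2 mulr1.
  apply: eq_line_int => s; rewrite sub0r hkerN.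
  rewrite (_ : p - Num.sqrt t * - s = 2 * p - (p - Num.sqrt t * s)); last by ring.
  by rewrite gs; ring.
lra.
Qed.

End HeatFlowContinuity.

(** * The maximum principle and uniqueness *)

Section MaximumPrinciple.
Variable R : realType.
Implicit Types (f g h : R -> R) (d : R -> R -> R) (x t : R).

Lemma second_derivative_max f f1 q x :
  (\forall y \near x, is_derive (y : R) (1 : R) f (f1 y)) -> is_derive x 1 f1 q ->
  (\forall y \near x, f y <= f x) -> q <= 0.
Proof.
move=> nf f1q nmax; rewrite leNgt; apply/negP => q0.
have [e1 /= e10 H1] := nf; have [e2 /= e20 H2] := nmax.
have f1x : f1 x = 0.
  pose e := Num.min e1 e2.
  have e0 : 0 < e by rewrite lt_min e10.
  have I y : y \in `]x - e, x + e[ -> `|x - y| < e.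
    by rewrite in_itv/= ltr_norml => /andP[? ?]; lra.
  have D : is_derive x 1 f 0.
    apply: (@derive1_at_max _ f (x - e) (x + e)) => //.
    - lra.
    - move=> y /I; rewrite lt_min => /andP[ye _].
      by have := H1 y ye.
    - by rewrite in_itv/=; lra.
    - by move=> y /I; rewrite lt_min => /andP[_ ye]; exact: H2.
  apply: (der_unique _ D); apply: H1; by rewrite /= subrr normr0.
have /cvgrPdist_lt /(_ _ q0) [e3 /= e30 H3] := der_quotient f1q.
pose e := Num.min e1 (Num.min e2 e3).
have e0 : 0 < e by rewrite !lt_min e10 e20.
pose y := x + e / 2.
have xy : x < y by rewrite /y; lra.
have B z : x <= z -> z <= y -> `|x - z| < e.
  by move=> xz zy; rewrite distrC ger0_norm ?subr_ge0//; move: zy; rewrite /y; lra.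
have [c /andP[xc cy] E] : exists2 c, x < c < y & f y - f x = f1 c * (y - x).
  have [||c cxy ->] := @MVT R f f1 x y xy.
  - move=> z; rewrite in_itv/= => /andP[xz zy]; apply: H1.
    by have := B z (ltW xz) (ltW zy); rewrite lt_min => /andP[].
  - apply: derivable_within_continuous => z; rewrite in_itv/= => /andP[xz zy].
    by have := B z xz zy; rewrite lt_min => /andP[/H1 ? _].
  by exists c => //; move: cxy; rewrite in_itv.
have c3 : `|x - c| < e3 by have := B c (ltW xc) (ltW cy); rewrite !lt_min => /andP[_ /andP[]].
have y2 : `|x - y| < e2 by have := B y (ltW xy) (lexx y); rewrite !lt_min => /andP[_ /andP[]].
have := H3 c c3; rewrite /diff_quotient f1x subr0 => /(_ (negbT (gt_eqF xc))).
have : 0 < c - x by rewrite subr_gt0.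
have := H2 y y2; move: E.
move=> E fy cx; rewrite ltr_norml => /andP[_].
rewrite ltrBlDr -ltrBlDl subrr ltNge => /negP; apply.
rewrite pmulr_lle0 ?invr_gt0//.
have yx : 0 < y - x by rewrite subr_gt0.
by rewrite -(pmulr_lle0 _ yx) -E subr_le0.
Qed.

Lemma time_derivative_max h t q : is_derive t 1 h q ->
  (\forall s \near t, s <= t -> h s <= h t) -> 0 <= q.
Proof.
move=> hq [e1 /= e10 H1]; rewrite leNgt; apply/negP => q0.
have q0' : 0 < - q by rewrite oppr_gt0.
have /cvgrPdist_lt /(_ _ q0') [e2 /= e20 H2] := der_quotient hq.
pose e := Num.min e1 e2.
have e0 : 0 < e by rewrite lt_min e10.
pose s := t - e / 2.
have st : s < t by rewrite /s; lra.
have : `|t - s| < e by rewrite ger0_norm ?subr_ge0 ?ltW//; rewrite /s; lra.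
rewrite lt_min => /andP[s1 s2].
have := H2 s s2; rewrite lt_eqF// => /(_ isT).
have := H1 s s1 (ltW st); rewrite /diff_quotient => hs.
rewrite ltr_norml => /andP[+ _]; rewrite opprK.
rewrite ltrBrDl -ltrBrDr subrr ltNge => /negP; apply.
by apply: mulr_le0; rewrite ?invr_le0 subr_le0// ltW.
Qed.

(** The witness q is the common value of the second space derivative and of the
    time derivative. *)
Definition heat_at d x t := exists (d1 : R -> R) (q : R),
  [/\ \forall y \near x, is_derive (y : R) (1 : R) (d ^~ t) (d1 y),
      is_derive x 1 d1 q & is_derive t 1 (d x) q].

Lemma heat_at_sub d e x t : heat_at d x t -> heat_at e x t ->
  heat_at (fun x t => d x t - e x t) x t.
Proof.
move=> [d1 [q [D1 D2 D3]]] [e1 [q' [E1 E2 E3]]].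
exists (fun y => d1 y - e1 y), (q - q'); split; [|exact: der_sub|exact: der_sub].
near=> y; apply: der_sub; [near: y; exact: D1|near: y; exact: E1].
Unshelve. all: by end_near.
Qed.

Lemma heat_at_cst (k : R) x t : heat_at (fun _ _ => k) x t.
Proof.
exists (fun=> 0), 0; split; [|exact: der_cst|exact: der_cst].
by near=> y; exact: der_cst.
Unshelve. all: by end_near.
Qed.

Lemma heat_at_quadratic (k x t : R) : heat_at (fun x t => k * (x ^+ 2 + 2 * t)) x t.
Proof.
exists (fun y => k * (2 * y)), (k * 2); split.
- near=> y; apply: der_scale.
  have := der_add (der_mul (der_id y) (der_id y)) (der_cst (2 * t) y).
  rewrite mul1r mulr1 addr0 (_ : y + y = 2 * y); last by ring.
  exact.
- by apply: der_scale; have := der_scale 2 (der_id x); rewrite mulr1.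
- apply: der_scale; exact: der_affine.
Unshelve. all: by end_near.
Qed.

Lemma heat_at_flow A g x t : 0 < t -> lin_growth A g -> heat_at (heat_flow g) x t.
Proof.
move=> t0 gA; have [h1 h2 h3] := heat_flow_der x t0 gA.
by eexists; eexists; split; [near=> y; exact: h1|exact: h2|exact: h3].
Unshelve. all: by end_near.
Qed.

Lemma heat_classical_at (X : set R) d x t : heat_classical X d ->
  interior X x -> 0 < t -> heat_at d x t.
Proof.
move=> [_ H _ _ _] Xx t0.
have nX : \forall y \near x, interior X y by exact: open_nbhs_nbhs (conj (@open_interior _ X) Xx).
have [h1 h2 h3 h4] := H x t (conj Xx t0).
exists (derive1 (d ^~ t)), (derive1n 2 (d ^~ t) x); split.
- near=> y; apply: derivable_der.
  have Xy : interior X y by near: y.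
  by have [] := H y t (conj Xy t0).
- exact: derivable_der.
- by rewrite -h4; exact: derivable_der.
Unshelve. all: by end_near.
Qed.

Lemma within_continuousB (A : set (R * R)) (f g : R * R -> R) :
  {within A, continuous f} -> {within A, continuous g} ->
  {within A, continuous (fun p => f p - g p)}.
Proof. by move=> cf cg p; apply: cvgB; [exact: cf|exact: cg]. Qed.

(** What uniqueness uses of a classical solution. *)
Definition heat_solution (X : set R) d :=
  {within [set p : R * R | X p.1 /\ 0 <= p.2], continuous (fun p => d p.1 p.2)} /\
  forall x t, interior X x -> 0 < t -> heat_at d x t.

Lemma heat_classical_solution (X : set R) d : heat_classical X d -> heat_solution X d.
Proof.
move=> hd; split; first by case: hd.
by move=> x t; exact: heat_classical_at.
Qed.

(** Subtracting a small multiple of time makes the inequality strict: at a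
    positive maximum the time derivative would have to be nonnegative while the
    second space derivative is nonpositive. *)
Lemma max_principle l T d : 0 < l -> 0 < T ->
  {within [set p : R * R | 0 <= p.1 <= l /\ 0 <= p.2 <= T],
     continuous (fun p => d p.1 p.2)} ->
  (forall x t, 0 < x < l -> 0 < t <= T -> heat_at d x t) ->
  (forall x, 0 <= x <= l -> d x 0 <= 0) ->
  (forall t, 0 < t <= T -> d 0 t <= 0 /\ d l t <= 0) ->
  forall x t, 0 <= x <= l -> 0 <= t <= T -> d x t <= 0.
Proof.
move=> l0 T0 dc dh di db x1 t1 x1l t1T; rewrite leNgt; apply/negP => dp.
(* With this slope d - e t is still positive at (x1, t1). *)
pose e := d x1 t1 / (2 * T).
have e0 : 0 < e by rewrite divr_gt0// mulr_gt0.
pose K := [set p : R * R | 0 <= p.1 <= l /\ 0 <= p.2 <= T].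
have KE : K = `[0, l]%classic `*` `[0, T]%classic.
  by apply/seteqP; split => p /=; rewrite !in_itv.
have cK : compact K by rewrite KE; apply: compact_setX; exact: segment_compact.
have fc : {within K, continuous (fun p => d p.1 p.2 - e * p.2)}.
  apply: within_continuousB dc _; apply: continuous_subspaceT => p.
  by apply: cvgMr; exact: cvg_snd.
have K1 : K (x1, t1) by [].
have [c cK' Hc] := compact_EVT_max (ex_intro _ _ K1) cK fc.
move: cK'; rewrite inE => -[]; case: c Hc => x t /= Hc xl tT.
have H1 : d x1 t1 - e * t1 <= d x t - e * t by apply: (Hc (x1, t1)); rewrite inE.
have pos : 0 < d x t - e * t.
  apply: lt_le_trans H1; rewrite subr_gt0.
  have : e * t1 <= e * T by apply: ler_wpM2l; [exact: ltW|case/andP: t1T].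
  have : e * T = d x1 t1 / 2 by rewrite /e; field; rewrite gt_eqF.
  lra.
have [t0 tT'] := andP tT; have [x0 xl'] := andP xl.
have dpos : 0 < d x t by apply: lt_le_trans pos _; rewrite lerBlDr lerDl mulr_ge0// ltW.
have t0' : 0 < t.
  rewrite lt_neqAle t0 andbT; apply/eqP => t00.
  by move: dpos; rewrite -t00 ltNge di.
have [b1 b2] := db t (introT andP (conj t0' tT')).
have x0' : 0 < x.
  rewrite lt_neqAle x0 andbT; apply/eqP => x00.
  by move: dpos; rewrite -x00 ltNge b1.
have xl'' : x < l.
  rewrite lt_neqAle xl' andbT; apply/eqP => xll.
  by move: dpos; rewrite xll ltNge b2.
have [d1 [q [D1 D2 D3]]] := dh x t (introT andP (conj x0' xl'')) (introT andP (conj t0' tT')).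
have q0 : q <= 0.
  apply: (second_derivative_max D1 D2).
  have : \forall y \near x, y \in `]0, l[ by apply: near_in_itvoo; rewrite in_itv/= x0'.
  apply: filterS => y; rewrite in_itv/= => /andP[y0 yl].
  have := Hc (y, t); rewrite inE /= => /(_ _).
  rewrite lerD2r; apply; split=> //; by rewrite !ltW.
have qe : 0 <= q - e.
  have := der_sub D3 (der_scale e (der_id t)); rewrite mulr1 => D4.
  apply: (time_derivative_max D4).
  near=> s => st; have := Hc (x, s); rewrite inE /=; apply.
  split => //; rewrite (le_trans st tT') andbT ltW//.
  near: s; exact: lt_nbhsr.
lra.
Unshelve. all: by end_near.
Qed.

(** On the half-line the parabolic barrier x^2 + 2t confines a bounded solution
    to an interval whose length is then sent to infinity. *)
Lemma max_principle_halfline K d :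
  {within [set p : R * R | 0 <= p.1 /\ 0 <= p.2], continuous (fun p => d p.1 p.2)} ->
  (forall x t, 0 <= x -> 0 <= t -> d x t <= K) ->
  (forall x t, 0 < x -> 0 < t -> heat_at d x t) ->
  (forall x, 0 <= x -> d x 0 <= 0) -> (forall t, 0 < t -> d 0 t <= 0) ->
  forall x t, 0 <= x -> 0 <= t -> d x t <= 0.
Proof.
move=> dc dK dh di db x t x0 t0; rewrite leNgt; apply/negP => dp.
(* The barrier |K| (x^2 + 2 t) / l^2 dominates d at x = l, and at (x, t) it
   equals B / l^2 times d x t, which is too small once l > B and l >= 1. *)
pose B := `|K| * (x ^+ 2 + 2 * t) / d x t.
have B0 : 0 <= B.
  apply: mulr_ge0; last by rewrite invr_ge0 ltW.
  by apply: mulr_ge0 => //; rewrite addr_ge0 ?sqr_ge0// mulr_ge0.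
pose l := x + B + 1; have l1 : 1 <= l by rewrite /l; lra.
have l0 : 0 < l by lra.
have T0 : 0 < t + 1 by lra.
pose k := `|K| / l ^+ 2.
have k0 : 0 <= k by rewrite divr_ge0 ?sqr_ge0.
have H : d x t - k * (x ^+ 2 + 2 * t) <= 0.
  apply: (@max_principle l (t + 1) (fun x t => d x t - k * (x ^+ 2 + 2 * t))) => //.
  - apply: (@continuous_subspaceW _ _ _ [set p : R * R | 0 <= p.1 /\ 0 <= p.2]).
      by move=> p /= [/andP[? _] /andP[? _]].
    apply: within_continuousB dc _; apply: continuous_subspaceT => p.
    apply: cvgMr; apply: cvgD.
      by apply: (cvgM (@cvg_fst _ _ _ _ _) (@cvg_fst _ _ _ _ _)).
    by apply: cvgMr; exact: cvg_snd.
  - move=> y s /andP[y0 _] /andP[s0 _]; apply: heat_at_sub; first exact: dh.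
    exact: heat_at_quadratic.
  - move=> y /andP[y0 _]; rewrite subr_le0 (le_trans (di y y0))// mulr_ge0//.
    by rewrite mulr0 addr0 sqr_ge0.
  - move=> s /andP[s0 _]; split; rewrite subr_le0.
      by rewrite (le_trans (db s s0))// mulr_ge0// addr_ge0 ?sqr_ge0// mulr_ge0// ltW.
    rewrite (le_trans (dK l s (ltW l0) (ltW s0)))// (le_trans (ler_norm _))//.
    rewrite /k -mulrA ler_peMr// mulrDr mulVf ?gt_eqF ?exprn_gt0// lerDl.
    by rewrite mulr_ge0 ?invr_ge0 ?sqr_ge0// mulr_ge0// ltW.
  - by rewrite x0 /l; lra.
  - by rewrite t0; lra.
move: H; rewrite subr_le0 leNgt => /negP; apply.
have E : `|K| * (x ^+ 2 + 2 * t) = B * d x t by rewrite /B divfK// gt_eqF.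
rewrite /k mulrAC E ltr_pdivrMr ?exprn_gt0// mulrC ltr_pM2l//.
by move: B0 x0; rewrite /l; nra.
Qed.

Lemma heat_flow_solution (X : set R) g : almost_lipschitz g -> heat_solution X (heat_flow g).
Proof.
move=> gU; have [A gA] := almost_lipschitz_growth gU.
split; first by apply: continuous_subspaceT; exact: heat_flow_continuous.
by move=> x t _ t0; exact: heat_at_flow gA.
Qed.

Lemma heat_cst_solution (X : set R) k : heat_solution X (fun _ _ => k).
Proof.
split; first by apply: continuous_subspaceT => p; exact: cvg_cst.
by move=> x t _ _; exact: heat_at_cst.
Qed.

Lemma interval_comparison l d e : 0 < l ->
  heat_solution `[0, l] d -> heat_solution `[0, l] e ->
  (forall t, 0 < t -> d 0 t <= e 0 t) -> (forall t, 0 < t -> d l t <= e l t) ->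
  (forall x, 0 <= x <= l -> d x 0 <= e x 0) ->
  forall x t, 0 <= x <= l -> 0 <= t -> d x t <= e x t.
Proof.
move=> l0 [dc dh] [ec eh] b0 bl i x t xl t0; rewrite -subr_le0.
have T0 : 0 < t + 1 by lra.
have tT : 0 <= t <= t + 1 by rewrite t0; lra.
apply: (@max_principle l (t + 1) (fun x t => d x t - e x t)) => //.
- apply: (@continuous_subspaceW _ _ _ [set p : R * R | `[0, l]%classic p.1 /\ 0 <= p.2]).
    by move=> p /= [? /andP[? _]]; split => //; rewrite in_itv.
  exact: within_continuousB.
- move=> y s yl /andP[s0 _].
  have Y : interior `[0, l] y by rewrite interior_itv_bnd /= in_itv.
  by apply: heat_at_sub; [exact: dh|exact: eh].
- by move=> y yl; rewrite subr_le0 i.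
- by move=> s /andP[s0 _]; rewrite !subr_le0 b0// bl.
Qed.

Lemma halfline_comparison K d e :
  heat_solution `[0, +oo[ d -> heat_solution `[0, +oo[ e ->
  (forall x t, 0 <= x -> 0 <= t -> d x t - e x t <= K) ->
  (forall t, 0 < t -> d 0 t <= e 0 t) -> (forall x, 0 <= x -> d x 0 <= e x 0) ->
  forall x t, 0 <= x -> 0 <= t -> d x t <= e x t.
Proof.
move=> [dc dh] [ec eh] deK b0 i x t x0 t0; rewrite -subr_le0.
apply: (@max_principle_halfline K (fun x t => d x t - e x t)) => //.
- apply: (@continuous_subspaceW _ _ _ [set p : R * R | `[0, +oo[%classic p.1 /\ 0 <= p.2]).
    by move=> p /= [p1 p2]; split => //; rewrite in_itv/= p1.
  exact: within_continuousB.
- move=> y s y0 s0.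
  have Y : interior (`[0, +oo[%classic : set R) y by rewrite interior_itv_bndy /= in_itv/= y0.
  by apply: heat_at_sub; [exact: dh|exact: eh].
- by move=> y y0; rewrite subr_le0 i.
- by move=> s s0; rewrite subr_le0 b0.
Qed.

(** A classical solution on [0, l] is the heat flow of its datum, extended by
    odd reflection about both boundary values. *)
Lemma heat_interval_flow l a b w g : 0 < l -> heat_solution `[0, l] w ->
  (forall t, 0 < t -> w 0 t = a) -> (forall t, 0 < t -> w l t = b) ->
  (forall x, 0 <= x <= l -> w x 0 = g x) -> almost_lipschitz g ->
  (forall x, g (- x) = 2 * a - g x) -> (forall x, g (2 * l - x) = 2 * b - g x) ->
  forall x t, 0 <= x <= l -> 0 <= t -> w x t = heat_flow g x t.
Proof.
move=> l0 ws w0 wl wi gU g0 gl x t xl t0; have [A gA] := almost_lipschitz_growth gU.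
have fs := heat_flow_solution `[0, l] gU.
have f0 s : heat_flow g 0 s = a by apply: (heat_flow_odd _ gA) => y; rewrite mulr0 sub0r.
have fl s : heat_flow g l s = b by exact: (heat_flow_odd _ gA).
apply/eqP; rewrite eq_le; apply/andP; split; apply: interval_comparison xl t0 => // [s sp|s sp|y yl].
- by rewrite w0// f0.
- by rewrite wl// fl.
- by rewrite wi// heat_flow0.
- by rewrite w0// f0.
- by rewrite wl// fl.
- by rewrite wi// heat_flow0.
Qed.

Lemma heat_flow_bounded K g x t : measurable_fun setT g -> (forall y, `|g y| <= K) ->
  `|heat_flow g x t| <= K.
Proof.
move=> mg gK; have [h1 h2] := line_int_hker R.
rewrite -[K]mulr1 -h2 -line_intZ//; apply: norm_line_int.
- exact: (summable_measurable (summable_heat_flow x t (lin_growth_bounded mg gK))).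
- exact: summableZ.
move=> s; rewrite normrM (gtr0_norm (hker_gt0 _)) mulrC.
by apply: ler_wpM2r => //; exact/ltW/hker_gt0.
Qed.

(** Boundedness is what selects the solution on the half-line. *)
Lemma heat_halfline_flow K K' a w g : heat_solution `[0, +oo[ w ->
  (forall x t, 0 <= x -> 0 <= t -> `|w x t| <= K) ->
  (forall t, 0 < t -> w 0 t = a) -> (forall x, 0 <= x -> w x 0 = g x) ->
  almost_lipschitz g -> (forall x, `|g x| <= K') -> (forall x, g (- x) = 2 * a - g x) ->
  forall x t, 0 <= x -> 0 <= t -> w x t = heat_flow g x t.
Proof.
move=> ws wK w0 wi gU gK g0 x t x0 t0; have [A gA] := almost_lipschitz_growth gU.
have fs := heat_flow_solution `[0, +oo[ gU.
have f0 s : heat_flow g 0 s = a by apply: (heat_flow_odd _ gA) => y; rewrite mulr0 sub0r.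
have dK y s : 0 <= y -> 0 <= s -> `|w y s - heat_flow g y s| <= K + K'.
  move=> y0 s0; apply: le_trans (ler_normB _ _) _; rewrite lerD ?wK//.
  by apply: heat_flow_bounded => //; case: gA.
apply/eqP; rewrite eq_le; apply/andP; split.
- apply: (halfline_comparison (K := K + K') ws fs) x0 t0 => [y s y0 s0|s sp|y y0].
  + by apply: le_trans (ler_norm _) _; exact: dK.
  + by rewrite w0// f0.
  + by rewrite wi// heat_flow0.
- apply: (halfline_comparison (K := K + K') fs ws) x0 t0 => [y s y0 s0|s sp|y y0].
  + by apply: le_trans (ler_norm _) _; rewrite distrC; exact: dK.
  + by rewrite w0// f0.
  + by rewrite wi// heat_flow0.
Qed.

End MaximumPrinciple.

(** * One-sided derivatives and norms of smooth functions *)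

Section WithinDerivatives.
Variable R : realType.
Implicit Types (A : set R) (f g : R -> R) (F : nat -> R -> R) (x : R).

Definition nonisolated A x := forall e, 0 < e ->
  exists y, [/\ A y, y != x & `|x - y| < e].

Lemma nonisolated_segment (r x : R) : 0 < r -> `[0, r]%classic x ->
  nonisolated `[0, r]%classic x.
Proof.
move=> r0; rewrite /= in_itv/= => /andP[x0 xr] e e0.
have [xr2|xr2] := ltP x (r / 2).
  pose d := Num.min (e / 2) (r / 2).
  have d0 : 0 < d by rewrite lt_min; apply/andP; split; lra.
  have [de dr] : d <= e / 2 /\ d <= r / 2 by split; rewrite ge_min lexx ?orbT.
  exists (x + d); split; first by rewrite /= in_itv/=; lra.
    by rewrite -subr_eq0 addrC addKr gt_eqF.
  by rewrite opprD addNKr normrN gtr0_norm//; lra.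
pose d := Num.min (e / 2) (r / 2).
have d0 : 0 < d by rewrite lt_min; apply/andP; split; lra.
have [de dr] : d <= e / 2 /\ d <= r / 2 by split; rewrite ge_min lexx ?orbT.
exists (x - d); split; first by rewrite /= in_itv/=; lra.
  by rewrite -subr_eq0 addrC addKr oppr_eq0 gt_eqF.
by rewrite subKr gtr0_norm//; lra.
Qed.

Lemma nonisolated_sub A (B : set R) x : A `<=` B -> nonisolated A x -> nonisolated B x.
Proof. by move=> AB aA e /aA [y [/AB ? ? ?]]; exists y. Qed.

Lemma within_punctured_proper A x : nonisolated A x -> ProperFilter (within A x^').
Proof.
move=> aA; apply: Build_ProperFilter_ex => P; rewrite /within /= => -[e /= e0 He].
have [y [Ay yx xy]] := aA e e0.
by exists y; exact: (He y xy yx Ay).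
Qed.

(** One-sided derivatives of a function with a smooth extension are computed on
    the extension; all derivatives within an interval are obtained in this way. *)
Lemma derive_withinE A f (F0 : R -> R) x (l : R) : A x -> nonisolated A x ->
  (forall y, A y -> f y = F0 y) -> is_derive x 1 F0 l ->
  derivable_within A f x /\ derive_within A f x = l.
Proof.
move=> Ax aA fF dF; have PF := within_punctured_proper aA.
have H : diff_quotient f x y @[y --> within A x^'] --> l.
  have H0 : diff_quotient F0 x y @[y --> within A x^'] --> l.
    by apply: cvg_trans (der_quotient dF); apply: cvg_app; exact: cvg_within.
  apply: cvg_trans H0; apply: near_eq_cvg.
  rewrite near_withinE; near=> y => Ay.
  by rewrite /diff_quotient !fF.
split; first by apply/cvg_ex; exists l.
by apply: cvg_lim => //; exact: norm_hausdorff.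
Unshelve. all: by end_near.
Qed.

Variables (A : set R) (f : R -> R) (F : nat -> R -> R).
Hypothesis accA : forall x, A x -> nonisolated A x.
Hypothesis fF : forall x, A x -> f x = F 0 x.
Hypothesis dF : forall j x, A x -> is_derive x 1 (F j) (F j.+1 x).

Lemma derive_within_nE j x : A x -> derive_within_n A j f x = F j x.
Proof.
elim: j x => [|j IH] x Ax; first exact: fF.
by have [] := derive_withinE Ax (accA Ax) IH (dF j Ax).
Qed.

Lemma derivatives_Ck k : is_Ck A k f.
Proof.
split=> [j x _ Ax|].
  by have [] := derive_withinE Ax (accA Ax) (@derive_within_nE j) (dF j Ax).
apply: (@subspace_eq_continuous _ _ _ (F k)).
  by move=> x; rewrite inE => Ax; symmetry; exact: derive_within_nE.
apply: continuous_in_subspaceT => x; rewrite inE => Ax.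
exact: der_continuous (dF k Ax).
Qed.

Lemma Ck_norm_le k (B : R) : 0 <= B ->
  (forall j x, (j <= k)%N -> A x -> `|F j x| <= B) -> (Ck_norm A k f <= B%:E)%E.
Proof.
move=> B0 FB; rewrite /Ck_norm; case: asboolP => [_|]; last by have := derivatives_Ck k.
apply/bigmax_leP; split => [|j _]; first by rewrite lee_fin.
apply: ge_ereal_sup => _ [x Ax <-]; rewrite lee_fin derive_within_nE//.
by apply: FB => //; rewrite -ltnS.
Qed.

End WithinDerivatives.

Section CkNorm.
Variable R : realType.
Implicit Types (A : set R) (f : R -> R).

Lemma Ck_norm_ge0 A k f : (0 <= Ck_norm A k f)%E.
Proof.
rewrite /Ck_norm; case: ifP => _; last exact: leey.
exact: bigmax_ge_id.
Qed.

Lemma Ck_norm_point A k f x (C : R) : A x -> (Ck_norm A k f <= C%:E)%E -> `|f x| <= C.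
Proof.
move=> Ax; rewrite /Ck_norm; case: ifP => _; last by rewrite leye_eq.
move=> /bigmax_leP [_ /(_ ord0 isT)] H; rewrite -lee_fin; apply: le_trans H.
by apply: ereal_sup_ubound; exists x.
Qed.

End CkNorm.

(** * Derivatives of a logarithmic derivative *)

Section LogarithmicDerivative.
Variable R : realType.

(** The quotients u_j = h_j / h_0 of the successive derivatives of a positive
    function satisfy u_j' = u_(j+1) - u_j u_1, so the derivatives of the
    logarithmic derivative u_1 are universal polynomials in the u_j. *)
Inductive qexp := Qvar of nat | Qsub of qexp & qexp | Qadd of qexp & qexp
  | Qmul of qexp & qexp.

Fixpoint qeval (u : nat -> R) e := match e with
  | Qvar j => u j | Qsub a b => qeval u a - qeval u b
  | Qadd a b => qeval u a + qeval u b | Qmul a b => qeval u a * qeval u b end.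

Fixpoint qder e := match e with
  | Qvar j => Qsub (Qvar j.+1) (Qmul (Qvar j) (Qvar 1))
  | Qsub a b => Qsub (qder a) (qder b)
  | Qadd a b => Qadd (qder a) (qder b)
  | Qmul a b => Qadd (Qmul (qder a) b) (Qmul a (qder b)) end.

Lemma der_qeval (h : nat -> R -> R) x e : h 0 x != 0 ->
  (forall j, is_derive x 1 (h j) (h j.+1 x)) ->
  is_derive x 1 (fun y => qeval (fun j => h j y / h 0 y) e)
    (qeval (fun j => h j x / h 0 x) (qder e)).
Proof.
move=> h0 dh; elim: e => [j|a IHa b IHb|a IHa b IHb|a IHa b IHb] /=.
- exact: der_div.
- exact: der_sub.
- exact: der_add.
- exact: der_mul.
Qed.

Lemma qeval_bound (B : nat -> R) e : exists2 C, 0 <= C & forall u,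
  (forall j, `|u j| <= B j) -> `|qeval u e| <= C.
Proof.
elim: e => [j|a [Ca a0 Ha] b [Cb b0 Hb]|a [Ca a0 Ha] b [Cb b0 Hb]|a [Ca a0 Ha] b [Cb b0 Hb]].
- by exists `|B j| => // u /(_ j) H; rewrite (le_trans H)// ler_norm.
- exists (Ca + Cb) => [|u uB /=]; first exact: addr_ge0.
  by rewrite (le_trans (ler_normB _ _))// lerD// ?Ha ?Hb.
- exists (Ca + Cb) => [|u uB /=]; first exact: addr_ge0.
  by rewrite (le_trans (ler_normD _ _))// lerD// ?Ha ?Hb.
- exists (Ca * Cb) => [|u uB /=]; first exact: mulr_ge0.
  by rewrite normrM ler_pM ?Ha ?Hb.
Qed.

(** A polynomial is Lipschitz on bounded sets. *)
Lemma qeval_lipschitz (B : nat -> R) e : exists2 C, 0 <= C & forall u v d,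
  0 <= d -> (forall j, `|u j| <= B j) -> (forall j, `|v j| <= B j) ->
  (forall j, `|u j - v j| <= B j * d) -> `|qeval u e - qeval v e| <= C * d.
Proof.
elim: e => [j|a [Ca a0 Ha] b [Cb b0 Hb]|a [Ca a0 Ha] b [Cb b0 Hb]|a [Ca a0 Ha] b [Cb b0 Hb]].
- exists `|B j| => // u v d d0 _ _ /(_ j) H; rewrite (le_trans H)//.
  by rewrite ler_wpM2r// ler_norm.
- exists (Ca + Cb) => [|u v d d0 uB vB uv /=]; first exact: addr_ge0.
  rewrite (_ : _ - _ = (qeval u a - qeval v a) - (qeval u b - qeval v b)); last by ring.
  by rewrite (le_trans (ler_normB _ _))// mulrDl lerD// ?Ha ?Hb.
- exists (Ca + Cb) => [|u v d d0 uB vB uv /=]; first exact: addr_ge0.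
  rewrite (_ : _ - _ = (qeval u a - qeval v a) + (qeval u b - qeval v b)); last by ring.
  by rewrite (le_trans (ler_normD _ _))// mulrDl lerD// ?Ha ?Hb.
- have [Da Da0 HDa] := qeval_bound B a; have [Db Db0 HDb] := qeval_bound B b.
  exists (Ca * Db + Da * Cb) => [|u v d d0 uB vB uv /=].
    by rewrite addr_ge0// mulr_ge0.
  rewrite (_ : _ - _ = (qeval u a - qeval v a) * qeval u b +
     qeval v a * (qeval u b - qeval v b)); last by ring.
  rewrite (le_trans (ler_normD _ _))// (mulrDl (Ca * Db)) !normrM lerD//.
    by rewrite mulrAC ler_pM ?Ha ?HDb.
  by rewrite -mulrA ler_pM ?Hb ?HDa.
Qed.

(** Closeness of two smooth positive functions, derivative by derivative,
    passes to their logarithmic derivatives in every C^k norm. *)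
Lemma log_derivative_close (B : nat -> R) (m : R) (k : nat) : 0 < m -> exists2 C, 0 <= C &
  forall (r d : R) (h g : nat -> R -> R) (F : R -> R), 0 < r -> 0 <= d ->
  (forall j (x : R), is_derive x 1 (h j) (h j.+1 x)) ->
  (forall j (x : R), is_derive x 1 (g j) (g j.+1 x)) ->
  (forall x : R, 0 <= x <= r -> m <= h 0 x /\ m <= g 0 x) ->
  (forall j (x : R), 0 <= x <= r ->
    [/\ `|h j x| <= B j, `|g j x| <= B j & `|h j x - g j x| <= B j * d]) ->
  (forall x : R, 0 <= x <= r -> F x = h 1 x / h 0 x - g 1 x / g 0 x) ->
  (Ck_norm `[0%R, r]%classic k F <= (C * d)%:E)%E.
Proof.
(* In h_i / h_0 - g_i / g_0 an error on h_i costs 1 / m, and an error on h_0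
   costs a factor B 0 / m^2 at most. *)
move=> m0; pose c := m^-1 + `|B 0| / m ^+ 2.
have c0 : 0 <= c.
  by apply: addr_ge0; [rewrite invr_ge0 ltW|rewrite divr_ge0 ?sqr_ge0].
pose B' j := `|B j| * c.
have L e := qeval_lipschitz B' e.
have [C HC] : {C : nat -> R | forall j, 0 <= C j /\ forall u v d,
  0 <= d -> (forall j, `|u j| <= B' j) -> (forall j, `|v j| <= B' j) ->
  (forall j, `|u j - v j| <= B' j * d) ->
  `|qeval u (iter j qder (Qvar 1)) - qeval v (iter j qder (Qvar 1))| <= C j * d}.
  have H j : {C | 0 <= C /\ forall u v d,
    0 <= d -> (forall j, `|u j| <= B' j) -> (forall j, `|v j| <= B' j) ->
    (forall j, `|u j - v j| <= B' j * d) ->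
    `|qeval u (iter j qder (Qvar 1)) - qeval v (iter j qder (Qvar 1))| <= C * d}.
    by apply: cid; have [C ? ?] := L (iter j qder (Qvar 1)); exists C.
  by exists (fun j => sval (H j)) => j; exact: (svalP (H j)).
exists (\sum_(j < k.+1) C j) => [|r d h g F r0 d0 dh dg hgm hgB FE].
  by apply: sumr_ge0 => j _; case: (HC j).
have S0 : 0 <= \sum_(j < k.+1) C j by apply: sumr_ge0 => j _; case: (HC j).
pose u (h : nat -> R -> R) x j := h j x / h 0 x.
have inR x : `[0, r]%classic x -> 0 <= x <= r by rewrite /= in_itv.
apply: (@Ck_norm_le R _ _ (fun j x => qeval (u h x) (iter j qder (Qvar 1)) -
  qeval (u g x) (iter j qder (Qvar 1)))).
- by move=> x; exact: nonisolated_segment.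
- by move=> x /inR xr; rewrite FE.
- move=> j x /inR /hgm [hm gm]; apply: der_sub; apply: der_qeval => //.
    by rewrite gt_eqF// (lt_le_trans m0).
  by rewrite gt_eqF// (lt_le_trans m0).
- by rewrite mulr_ge0.
move=> j x jk /inR xr; have [hm gm] := hgm x xr.
have [h0 g0] : 0 < h 0 x /\ 0 < g 0 x by rewrite !(lt_le_trans m0).
have ub i (w : nat -> R -> R) : 0 < w 0 x -> m <= w 0 x -> `|w i x| <= B i -> `|u w x i| <= B' i.
  move=> w0 wm wB; rewrite /u normrM normfV (gtr0_norm w0) /B' /c mulrDr.
  apply: (@le_trans _ _ (`|B i| / m)); last first.
    by rewrite lerDl mulr_ge0// divr_ge0 ?sqr_ge0.
  rewrite ler_pM ?invr_ge0 ?(ltW w0)//; first by rewrite (le_trans wB)// ler_norm.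
  by rewrite lef_pV2 ?posrE.
have [HC0 HCj] := HC j.
apply: (@le_trans _ _ (C j * d)).
  apply: HCj => // i.
  - by have [? _ _] := hgB i x xr; exact: ub.
  - by have [_ ? _] := hgB i x xr; exact: ub.
  have [hi gi di] := hgB i x xr; have [hi0 gi0 di0] := hgB 0%N x xr.
  have -> : u h x i - u g x i = (h i x - g i x) / h 0 x -
     g i x / g 0 x * ((h 0 x - g 0 x) / h 0 x).
    by rewrite /u; field; rewrite !gt_eqF.
  rewrite (le_trans (ler_normB _ _))// /B' /c mulrDr mulrDl lerD//.
    rewrite normrM normfV (gtr0_norm h0) mulrAC ler_pM ?invr_ge0 ?(ltW h0)//.
      by rewrite (le_trans di)// ler_wpM2r// ler_norm.
    by rewrite lef_pV2 ?posrE.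
  rewrite (_ : `|B i| * (`|B 0| / m ^+ 2) * d = `|B i| / m * (`|B 0| * d / m)); last first.
    by field; rewrite gt_eqF.
  rewrite !normrM !normfV (gtr0_norm h0) (gtr0_norm g0).
  have mi w : m <= w -> w^-1 <= m^-1 by move=> mw; rewrite lef_pV2 ?posrE// (lt_le_trans m0).
  apply: ler_pM; rewrite ?mulr_ge0 ?invr_ge0 ?(ltW h0) ?(ltW g0)//.
    rewrite ler_pM ?invr_ge0 ?(ltW g0) ?mi//.
    by rewrite (le_trans gi)// ler_norm.
  rewrite ler_pM ?invr_ge0 ?(ltW h0) ?mi//.
  by rewrite (le_trans di0)// ler_wpM2r// ler_norm.
rewrite ler_wpM2r//.
have jk' : (j < k.+1)%N by rewrite ltnS.
rewrite (bigD1 (Ordinal jk'))//= lerDl.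
by apply: sumr_ge0 => i _; case: (HC i).
Qed.

End LogarithmicDerivative.

(** * The sawtooth series *)

Section SawtoothSeries.
Variable R : realType.
Implicit Types (x y u s t a b : R) (N n : nat).

Lemma der_nonincreasing (f df : R -> R) a b : a <= b ->
  (forall x, a <= x <= b -> is_derive x 1 f (df x)) ->
  (forall x, a <= x <= b -> df x <= 0) -> f b <= f a.
Proof.
move=> ab fd dle; rewrite -subr_le0.
have [||c cab ->] := @MVT_segment R f df a b ab.
- by move=> x /itvP xab; apply: fd; rewrite !xab.
- apply: derivable_within_continuous => x; rewrite in_itv/= => xab.
  by have := fd x xab.
by rewrite mulr_le0_ge0 ?subr_ge0// dle//; move: cab; rewrite in_itv.
Qed.

Lemma sin_lipschitz x y : `|sin x - sin y| <= `|x - y|.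
Proof.
wlog yx : x y / y <= x => [H|].
  by case/orP: (le_total y x) => /H //; rewrite distrC [`|y - x|]distrC.
rewrite [`|x - y|]ger0_norm ?subr_ge0// -[x - y]mul1r.
by apply: (@MVT_le _ sin cos) => // z _; exact: cos_max.
Qed.

Lemma sin_norm_le x : `|sin x| <= `|x|.
Proof. by have := sin_lipschitz x 0; rewrite sin0 !subr0. Qed.

Lemma cos_ge_half u : `|u| <= 1 -> 2^-1 <= cos u.
Proof.
move=> u1; have -> : u = u / 2 + u / 2 by field.
rewrite cosD; have := cos2Dsin2 (u / 2); have := sin_norm_le (u / 2).
rewrite normrM (ger0_norm (_ : 0 <= 2^-1)) ?invr_ge0// => H.
have : sin (u / 2) ^+ 2 <= 4^-1.
  rewrite -[_ ^+ 2]real_normK ?num_real//.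
  have := normr_ge0 (sin (u / 2)); nra.
rewrite !expr2; lra.
Qed.

Lemma sin_ge_quarter s : 0 <= s <= 2 -> s / 4 <= sin s.
Proof.
move=> /andP[s0 s2]; have -> : sin s = 2 * (sin (s / 2) * cos (s / 2)).
  rewrite -[in LHS](_ : s / 2 + s / 2 = s); last by field.
  by rewrite sinD; ring.
have c1 : 2^-1 <= cos (s / 2).
  by apply: cos_ge_half; rewrite ger0_norm ?divr_ge0//; lra.
have : s / 4 <= sin (s / 2).
  have : - sin (s / 2) + (s / 2) / 2 <= - sin 0 + 0 / 2.
    apply: (@der_nonincreasing (fun z => - sin z + z / 2) (fun z => - cos z + 2^-1)).
    - by rewrite divr_ge0.
    - move=> z _; have h1 := der_opp (f := sin) (is_derive_sin z).
      have := der_mul (der_id z) (der_cst (2^-1 : R) z); rewrite mul1r mulr0 addr0 => h2.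
      exact: der_add h1 h2.
    - move=> z /andP[z0 zs]; rewrite addrC subr_le0; apply: cos_ge_half.
      by rewrite ger0_norm//; lra.
  rewrite sin0 mul0r oppr0 addr0; lra.
nra.
Qed.

Definition sinsum N x : R := \sum_(n < N) sin (n.+1%:R * x) / n.+1%:R.

Lemma sinsumN N x : sinsum N (- x) = - sinsum N x.
Proof.
by rewrite /sinsum -sumrN; apply: eq_bigr => n _; rewrite mulrN sinN mulNr.
Qed.

Lemma sin_nat_pi n : sin (n%:R * pi : R) = 0.
Proof.
elim: n => [|n IH]; first by rewrite mul0r sin0.
by rewrite -natr1 mulrDl mul1r sinDpi IH oppr0.
Qed.

Lemma sin_period n x : sin (x + n%:R * (pi *+ 2)) = sin x.
Proof.
elim: n => [|n IH]; first by rewrite mul0r addr0.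
by rewrite -natr1 mulrDl mul1r addrA sinD2pi.
Qed.

Lemma sinsum_period N (m : nat) x : sinsum N (x + m%:R * (pi *+ 2)) = sinsum N x.
Proof.
apply: eq_bigr => n _; congr (_ / _).
by rewrite mulrDr mulrA -natrM sin_period.
Qed.

Lemma sinsum_periodz N (m : int) x : sinsum N (x + m%:~R * (pi *+ 2)) = sinsum N x.
Proof.
case: m => m; first exact: sinsum_period.
rewrite NegzE mulrNz mulNr -[in RHS](subrK (m.+1%:R * (pi *+ 2)) x).
by rewrite sinsum_period.
Qed.

Lemma der_sinsum N x :
  is_derive x 1 (sinsum N) (\sum_(n < N) cos (n.+1%:R * x)).
Proof.
elim: N => [|N IH].
  rewrite big_ord0 (_ : sinsum 0 = fun=> 0); first exact: der_cst.
  by apply/funext => y; rewrite /sinsum big_ord0.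
rewrite big_ord_recr /= (_ : sinsum N.+1 = fun y => sinsum N y + sin (N.+1%:R * y) / N.+1%:R).
  apply: der_add => //.
  have H := der_scale N.+1%:R (der_id x).
  have H2 := der_comp (f := sin) (is_derive_sin (N.+1%:R * x)) H.
  have := der_mul H2 (der_cst (N.+1%:R^-1 : R) x).
  by rewrite mulr0 addr0 mulr1 mulfK// pnatr_eq0.
by apply/funext => y; rewrite /sinsum big_ord_recr.
Qed.

(** The sum telescopes after multiplication by 2 sin (x / 2). *)
Lemma dirichlet_kernel N x : 2 * sin (x / 2) * (\sum_(n < N) cos (n.+1%:R * x)) =
  sin ((N%:R + 2^-1) * x) - sin (x / 2).
Proof.
elim: N => [|N IH]; first by rewrite big_ord0 mulr0 add0r mulrC subrr.
rewrite big_ord_recr /= mulrDr IH.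
rewrite (_ : (N.+1%:R + 2^-1) * x = N.+1%:R * x + x / 2); last by field.
rewrite (_ : (N%:R + 2^-1) * x = N.+1%:R * x - x / 2); last by rewrite -natr1; field.
by rewrite sinB sinD; ring.
Qed.

(** Integrating the Dirichlet kernel by parts: adding cos ((N + 1/2) x) over
    (2N + 1) sin (x / 2) to the error removes its oscillating part, and what is
    left is dominated by the derivative of 1 / ((2N + 1) sin (x / 2)). *)
Lemma sinsum_error N x : 0 < x <= pi ->
  `|sinsum N x - (pi - x) / 2| <= 8 / ((N%:R + 2^-1) * x).
Proof.
move=> /andP[x0 xpi].
have [/andP[_ pi2] _] := pihalf_02_cos_pihalf R.
pose K := N%:R + 2^-1 : R.
have K0 : 0 < K by rewrite ltr_wpDl// invr_gt0.
pose W y := cos (K * y) / (2 * K * sin (y / 2)).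
pose V y := (2 * K * sin (y / 2))^-1.
pose E y := sinsum N y - (pi - y) / 2.
have sp y : x <= y <= pi -> 0 < sin (y / 2) /\ 0 <= cos (y / 2).
  move=> /andP[xy ypi]; split.
    have : y / 2 / 4 <= sin (y / 2) by apply: sin_ge_quarter; lra.
    by apply: lt_le_trans; rewrite !divr_gt0//; exact: lt_le_trans xy.
  by apply: cos_ge0_pihalf; lra.
have half y : is_derive y 1 (fun z : R => z / 2) 2^-1.
  by have := der_mul (der_id y) (der_cst (2^-1 : R) y); rewrite mul1r mulr0 addr0.
have dden y : is_derive y 1 (fun z => 2 * K * sin (z / 2)) (K * cos (y / 2)).
  have := der_scale (2 * K) (der_comp (f := sin) (g := fun z : R => z / 2) (is_derive_sin (y / 2)) (half y)).
  by rewrite (_ : 2 * K * (cos (y / 2) / 2) = K * cos (y / 2)) //; field.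
have dE y : x <= y <= pi -> is_derive y 1 E (sin (K * y) / (2 * sin (y / 2))).
  move=> yx; have [s0 _] := sp y yx.
  have H := der_sub (der_cst pi y) (der_id y).
  have := der_sub (der_sinsum N y) (der_mul H (der_cst (2^-1 : R) y)).
  rewrite (_ : _ - (_ + _) = sin (K * y) / (2 * sin (y / 2))) //.
  have -> : sin (K * y) = sin (y / 2) + 2 * sin (y / 2) * (\sum_(n < N) cos (n.+1%:R * y)).
    by rewrite dirichlet_kernel; ring.
  by field; rewrite gt_eqF.
have dn y : x <= y <= pi -> 2 * K * sin (y / 2) != 0.
  by move=> yx; have [s0 _] := sp y yx; rewrite gt_eqF// !mulr_gt0.
have dV y : x <= y <= pi -> is_derive y 1 V (- (cos (y / 2) / (4 * K * sin (y / 2) ^+ 2))).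
  move=> yx; have [s0 _] := sp y yx; have := der_inv (f := fun z => 2 * K * sin (z / 2)) (dn y yx) (dden y).
  rewrite (_ : - _ / _ = - (cos (y / 2) / (4 * K * sin (y / 2) ^+ 2)))//.
  by field; rewrite !gt_eqF.
have dW y : x <= y <= pi -> is_derive y 1 W
    (- (sin (K * y) / (2 * sin (y / 2))) - cos (K * y) * (cos (y / 2) / (4 * K * sin (y / 2) ^+ 2))).
  move=> yx; have [s0 _] := sp y yx.
  have H := der_comp (f := cos) (is_derive_cos (K * y)) (der_scale K (der_id y)).
  have := der_div (g := fun z => 2 * K * sin (z / 2)) (dn y yx) H (dden y).
  set A := (X in is_derive _ _ _ X -> _); set B := (X in _ -> is_derive _ _ _ X).
  by suff -> : A = B by []; rewrite /A /B; field; rewrite !gt_eqF.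
have pipi : x <= (pi : R) <= pi by rewrite xpi lexx.
have E_pi : E pi = 0.
  rewrite /E subrr mul0r subr0 /sinsum big1// => n _.
  by rewrite sin_nat_pi mul0r.
have W_pi : W pi = 0.
  rewrite /W (_ : K * pi = N%:R * pi + pi / 2); last by rewrite /K; ring.
  by rewrite cosDpihalf sin_nat_pi oppr0 mul0r.
have V0 y : x <= y <= pi -> 0 < V y.
  by move=> yx; have [s0 _] := sp y yx; rewrite invr_gt0 !mulr_gt0.
have q0 y : x <= y <= pi -> 0 <= cos (y / 2) / (4 * K * sin (y / 2) ^+ 2).
  move=> yx; have [s0 c0] := sp y yx.
  by rewrite divr_ge0// !mulr_ge0 ?sqr_ge0// ltW.
have up : (E pi + W pi) + V pi <= (E x + W x) + V x.
  apply: (@der_nonincreasing (fun y => (E y + W y) + V y) (fun y =>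
    (sin (K * y) / (2 * sin (y / 2)) + (- (sin (K * y) / (2 * sin (y / 2))) -
      cos (K * y) * (cos (y / 2) / (4 * K * sin (y / 2) ^+ 2)))) +
      - (cos (y / 2) / (4 * K * sin (y / 2) ^+ 2)))) => //.
    move=> y yx; apply: der_add; last exact: dV.
    by apply: der_add; [exact: dE|exact: dW].
  move=> y yx; have := q0 y yx; set q := cos (y / 2) / _ => q0'.
  have := cos_geN1 (K * y); nra.
have lo : V pi - (E pi + W pi) <= V x - (E x + W x).
  apply: (@der_nonincreasing (fun y => V y - (E y + W y)) (fun y =>
    - (cos (y / 2) / (4 * K * sin (y / 2) ^+ 2)) -
    (sin (K * y) / (2 * sin (y / 2)) + (- (sin (K * y) / (2 * sin (y / 2))) -
      cos (K * y) * (cos (y / 2) / (4 * K * sin (y / 2) ^+ 2)))))) => //.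
    move=> y yx; apply: der_sub; first exact: dV.
    by apply: der_add; [exact: dE|exact: dW].
  move=> y yx; have := q0 y yx; set q := cos (y / 2) / _ => q0'.
  have := cos_le1 (K * y); nra.
have xx : x <= x <= pi by rewrite lexx.
have WV : `|W x| <= V x.
  rewrite /W normrM -/(V x) (gtr0_norm (V0 x xx)).
  by rewrite ler_piMl ?cos_max// ltW// V0.
have Vpi := V0 pi pipi.
have VE : V x <= 4 / (K * x).
  rewrite /V (_ : 4 / (K * x) = (K * x / 4)^-1); last by rewrite invf_div.
  have [s0 _] := sp x xx.
  rewrite lef_pV2 ?posrE ?divr_gt0 ?mulr_gt0//.
  have : x / 2 / 4 <= sin (x / 2) by apply: sin_ge_quarter; lra.
  by move=> /(ler_wpM2l (ltW K0)); lra.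
rewrite -/(E x) -/K; have -> : 8 / (K * x) = 2 * (4 / (K * x)) by ring.
move: WV; rewrite !ler_norml => /andP[W1 W2].
move: up lo; rewrite E_pi W_pi addr0 add0r subr0 => up lo.
by apply/andP; split; lra.
Qed.

(** The convergence is not uniform near 0, but the sums stay bounded: below the
    scale 1 / N each term is at most x, and beyond it the error bound applies. *)
Lemma sinsum_bounded_pos N x : 0 <= x <= pi -> `|sinsum N x| <= 18.
Proof.
move=> /andP[x0 xpi]; have [/andP[_ pi2] _] := pihalf_02_cos_pihalf R.
have [NX|NX] := leP ((N%:R + 2^-1) * x) 2^-1.
  have : `|sinsum N x| <= N%:R * x.
    apply: le_trans (ler_norm_sum _ _ _) _.
    apply: (@le_trans _ _ (\sum_(n < N) x)); last by rewrite sumr_const card_ord mulr_natl.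
    apply: ler_sum => n _; rewrite normrM normfV normr_nat ler_pdivrMr ?ltr0n//.
    by apply: le_trans (sin_norm_le _) _; rewrite ger0_norm ?mulr_ge0// mulrC.
  have : 0 <= x / 2 by lra.
  lra.
have xp : 0 < x.
  by rewrite lt_neqAle x0 andbT; apply: contraTneq NX => <-; rewrite mulr0 -leNgt invr_ge0.
have xx : 0 < x <= pi by rewrite xp.
have := sinsum_error N xx.
have : 8 / ((N%:R + 2^-1) * x) <= 16.
  rewrite ler_pdivrMr; last by apply: lt_trans NX; rewrite invr_gt0.
  lra.
by move=> H1 /le_trans/(_ H1); rewrite !ler_norml => /andP[? ?]; apply/andP; split; lra.
Qed.

Lemma sinsum_cvg x : 0 < x <= pi -> sinsum N x @[N --> \oo] --> (pi - x) / 2.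
Proof.
move=> /[dup] xx /andP[x0 _]; apply/cvgrPdist_le => e e0.
near=> N; rewrite distrC; apply: le_trans (sinsum_error N xx) _.
have Nx : 0 < (N%:R + 2^-1) * x by rewrite mulr_gt0// ltr_wpDl// invr_gt0.
rewrite ler_pdivrMr// mulrA -ler_pdivrMr// -ler_pdivrMl//.
have : e^-1 * (8 / x) <= N%:R by near: N; exact: nbhs_infty_ger.
by move=> /le_trans; apply; rewrite lerDl invr_ge0.
Unshelve. all: by end_near.
Qed.

(** * The staircase *)

Definition cell y : R := (Num.floor ((y + 1) / 2))%:~R.

(** The datum 1 on (0, 1), reflected oddly about the points (0, 0) and (1, 1): an
    odd staircase with steps of height 2 at the even integers. *)
Definition stair y : R := 2 * cell y + Num.sg (y - 2 * cell y).

Lemma cell_itv y : -1 <= y - 2 * cell y < 1.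
Proof.
have := floor_itv ((y + 1) / 2); rewrite intrD -/(cell y).
set n := cell y; lra.
Qed.

Lemma cell_eq y (m : int) : -1 <= y - 2 * m%:~R < 1 -> cell y = m%:~R.
Proof.
move=> H; congr (_%:~R); apply: floor_def; rewrite intrD.
by move: H; set n : R := m%:~R; lra.
Qed.

Lemma stair_bounded y : `|stair y - y| <= 2.
Proof.
rewrite /stair; have := cell_itv y; set n := cell y => /andP[n1 n2].
have : `|Num.sg (y - 2 * n)| <= 1 by rewrite normr_sg; case: eqP.
by rewrite !ler_norml; lra.
Qed.

Lemma stair_sg y : `|y| < 2 -> stair y = Num.sg y.
Proof.
rewrite ltr_norml => /andP[y1 y2]; rewrite /stair.
have [h1|h1] := ltP y (-1).
  rewrite (@cell_eq y (-1)); last by rewrite mulrNz; lra.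
  by rewrite mulrNz gtr0_sg ?ltr0_sg; lra.
have [h2|h2] := ltP y 1.
  by rewrite (@cell_eq y 0) ?mulr0 ?subr0 ?add0r//; lra.
rewrite (@cell_eq y 1); last lra.
by rewrite ltr0_sg ?gtr0_sg; lra.
Qed.

(** The partial sums, at time 0, of the series that defines phi. *)
Definition stair_approx N y : R := y + 2 / pi * sinsum N (pi * y).

Lemma stair_approx_shift N y :
  stair_approx N y = 2 * cell y + stair_approx N (y - 2 * cell y).
Proof.
rewrite /stair_approx; set n := cell y.
have -> : sinsum N (pi * y) = sinsum N (pi * (y - 2 * n)).
  rewrite -(sinsum_periodz N (Num.floor ((y + 1) / 2)) (pi * (y - 2 * n))).
  by congr sinsum; rewrite -/(cell y) -/n -mulr_natl; ring.
ring.
Qed.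

Lemma stair_approxN N y : stair_approx N (- y) = - stair_approx N y.
Proof. by rewrite /stair_approx mulrN sinsumN mulrN opprD. Qed.

Lemma stair_approx_bounded N y : `|stair_approx N y - y| <= 18.
Proof.
have pi0 := pi_gt0 R.
have [/andP[_ pi2] _] := pihalf_02_cos_pihalf R.
have pi1 : 2 <= pi :> R by exact: pi_ge2.
have H z : -1 <= z < 1 -> `|stair_approx N z - z| <= 18.
  move=> /andP[z1 z2]; rewrite /stair_approx addrC addKr normrM.
  have p0 : 0 <= 2 / pi :> R by rewrite divr_ge0// ltW.
  rewrite (ger0_norm p0).
  have S : `|sinsum N (pi * z)| <= 18.
    have [z0|z0] := leP 0 z.
      by apply: sinsum_bounded_pos; rewrite mulr_ge0 ?(ltW pi0)// ler_piMr ?(ltW pi0)// ltW.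
    rewrite -[z]opprK mulrN sinsumN normrN; apply: sinsum_bounded_pos.
    by rewrite mulr_ge0 ?(ltW pi0) ?oppr_ge0 ?(ltW z0)// ler_piMr ?(ltW pi0)//; lra.
  have p1 : 2 / pi <= 1 :> R by rewrite ler_pdivrMr// mul1r.
  have := normr_ge0 (sinsum N (pi * z)); nra.
rewrite stair_approx_shift; have := H _ (cell_itv y).
by rewrite (_ : _ + _ - y = stair_approx N (y - 2 * cell y) - (y - 2 * cell y)); last ring.
Qed.

Lemma stair_approx_cvg y : stair_approx N y @[N --> \oo] --> stair y.
Proof.
have pi0 := pi_gt0 R.
have H z : 0 < z <= 1 -> stair_approx N z @[N --> \oo] --> (1 : R).
  move=> /andP[z0 z1].
  have E : z + 2 / pi * ((pi - pi * z) / 2) = 1 :> R.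
    have pn : pi != 0 :> R by rewrite gt_eqF.
    by move: pn; set p : R := pi; clearbody p => pn; field.
  rewrite -[X in _ --> X]E.
  apply: cvgD; first exact: cvg_cst.
  by apply: cvgMr; apply: sinsum_cvg; rewrite mulr_gt0//= ler_piMr// ltW.
under eq_fun do rewrite stair_approx_shift.
apply: cvgD; first exact: cvg_cst.
have := cell_itv y; set z := y - _ => /andP[z1 z2].
have [z0|z0|<-] := ltgtP 0 z.
- by rewrite gtr0_sg//; apply: H; rewrite z0 ltW.
- rewrite ltr0_sg// -[z]opprK; under eq_fun do rewrite stair_approxN.
  by apply: cvgN; apply: H; lra.
- rewrite sgr0; under eq_fun do rewrite /stair_approx mulr0 add0r.
  have -> : (fun N => 2 / pi * sinsum N 0) = fun=> (0 : R).
    apply/funext => N; rewrite /sinsum big1 ?mulr0// => n _.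
    by rewrite mulr0 sin0 mul0r.
  exact: cvg_cst.
Qed.

Lemma stair_approx_growth N : lin_growth 19 (stair_approx N).
Proof.
split.
  apply: continuous_measurable_fun => y.
  have H := der_comp (f := sinsum N) (der_sinsum N (pi * y)) (der_scale pi (der_id y)).
  exact: der_continuous (der_add (der_id y) (der_scale (2 / pi) H)).
move=> y; rewrite -[stair_approx N y](subrK y) (le_trans (ler_normD _ _))//.
by have := stair_approx_bounded N y; have := normr_ge0 y; lra.
Qed.

Lemma measurable_stair : measurable_fun setT stair.
Proof.
apply: (measurable_fun_cvg (fun N => (stair_approx_growth N).1)) => y _.
exact: stair_approx_cvg.
Qed.

Lemma stair_growth : lin_growth 19 stair.
Proof.
split; first exact: measurable_stair.
move=> y; rewrite -[stair y](subrK y) (le_trans (ler_normD _ _))//.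
by have := stair_bounded y; have := normr_ge0 y; lra.
Qed.

(** * The Fourier series of phi is the heat flow of the staircase *)

Lemma heat_flow_id x t : heat_flow (fun y : R => y) x t = x.
Proof.
have gA : lin_growth 1 (fun y : R => y).
  by split => [|y]; [exact: measurable_id|rewrite mul1r lerDr].
by apply: (heat_flow_odd _ gA) => y; ring.
Qed.

Lemma heat_flow_antisym A (g : R -> R) x t : lin_growth A g ->
  (forall y, g (- y) = - g y) -> heat_flow g (- x) t = - heat_flow g x t.
Proof.
move=> gA gN; have [_ E] := line_int_reflect 0 (summable_heat_flow (- x) t gA).
have -> : - heat_flow g x t = line_int (fun s => -1 * (hker s * g (x - Num.sqrt t * s))).
  by rewrite line_intZ ?mulN1r//; exact: summable_heat_flow gA.
rewrite {1}/heat_flow -E; apply: eq_line_int => s; rewrite sub0r hkerN.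
by rewrite (_ : - x - _ * - s = - (x - Num.sqrt t * s)) ?gN; ring.
Qed.

Lemma der_expR_scaled (k u : R) :
  is_derive u 1 (fun v => expR (k * v)) (expR (k * u) * k).
Proof.
have := der_comp (f := expR) (is_derive_expR (k * u)) (der_scale k (der_id u)).
by rewrite mulr1.
Qed.

Lemma sin_growth (a : R) : lin_growth 1 (fun y : R => sin (a * y)).
Proof.
apply: lin_growth_bounded => [|y]; last exact: sin_max.
apply: continuous_measurable_fun => y.
exact: der_continuous (der_comp (f := sin) (is_derive_sin (a * y)) (der_scale a (der_id y))).
Qed.

(** The heat flow damps each sine mode; this is read off from uniqueness on the
    half-line, where the damped mode is visibly a bounded solution. *)
Lemma heat_flow_sin (a x t : R) : 0 <= t ->
  heat_flow (fun y => sin (a * y)) x t = sin (a * x) * expR (- a ^+ 2 * t).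
Proof.
move=> t0; pose w := fun x t => sin (a * x) * expR (- a ^+ 2 * t).
have sb y : `|sin (a * y)| <= 1 by exact: sin_max.
have gA := sin_growth a.
have pos z : 0 <= z -> heat_flow (fun y => sin (a * y)) z t = w z t.
  move=> z0; symmetry.
  apply: (@heat_halfline_flow R 1 1 0 w) => //.
  - split.
      apply: continuous_subspaceT => p.
      apply: cvgM.
        apply: (@continuous_comp _ _ _ fst (fun z => sin (a * z)) p); first exact: cvg_fst.
        exact: der_continuous (der_comp (f := sin) (is_derive_sin _) (der_scale a (der_id p.1))).
      apply: (@continuous_comp _ _ _ snd (fun z => expR (- a ^+ 2 * z)) p); first exact: cvg_snd.
      exact: der_continuous (der_expR_scaled (- a ^+ 2) p.2).
    move=> y s _ s0.
    have ds u : is_derive u 1 (fun v => sin (a * v)) (cos (a * u) * a).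
      by have := der_comp (f := sin) (is_derive_sin (a * u)) (der_scale a (der_id u)); rewrite mulr1.
    have dc u : is_derive u 1 (fun v => cos (a * v)) (- sin (a * u) * a).
      by have := der_comp (f := cos) (is_derive_cos (a * u)) (der_scale a (der_id u)); rewrite mulr1.
    exists (fun y => cos (a * y) * a * expR (- a ^+ 2 * s)), (- sin (a * y) * a * a * expR (- a ^+ 2 * s)).
    split.
    + near=> u; have := der_mul (ds u) (der_cst (expR (- a ^+ 2 * s)) u).
      by rewrite mulr0 addr0.
    + have := der_mul (der_mul (dc y) (der_cst a y)) (der_cst (expR (- a ^+ 2 * s)) y).
      by rewrite !mulr0 !addr0.
    + have := der_scale (sin (a * y)) (der_expR_scaled (- a ^+ 2) s).
      by rewrite (_ : sin (a * y) * _ = - sin (a * y) * a * a * expR (- a ^+ 2 * s))//; ring.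
  - move=> y s y0 s0; rewrite normrM (gtr0_norm (expR_gt0 _)) mulr_ile1 ?expR_ge0//.
    rewrite -[X in _ <= X]expR0 ler_expR mulNr oppr_le0 mulr_ge0 ?sqr_ge0//.
  - by move=> s s0; rewrite /w mulr0 sin0 mul0r.
  - by move=> y y0; rewrite /w mulr0 expR0 mulr1.
  - move=> e e0; exists `|a| => // u v; apply: le_trans (sin_lipschitz _ _) _.
    by rewrite -mulrBr normrM lerDr ltW.
  - by move=> y; rewrite mulrN sinN mulr0 sub0r.
have [x0|x0] := leP 0 x; first exact: pos.
rewrite -[x]opprK (heat_flow_antisym _ _ gA).
  have nx : 0 <= - x by rewrite oppr_ge0 ltW.
  by rewrite (pos _ nx) /w opprK mulrN sinN mulNr opprK.
by move=> y; rewrite mulrN sinN.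
Unshelve. all: by end_near.
Qed.

Lemma heat_flowD A B (f g : R -> R) x t : lin_growth A f -> lin_growth B g ->
  heat_flow (fun y => f y + g y) x t = heat_flow f x t + heat_flow g x t.
Proof.
move=> fA gB; rewrite /heat_flow -line_intD.
- by apply: eq_line_int => s; rewrite mulrDr.
- exact: summable_heat_flow fA.
- exact: summable_heat_flow gB.
Qed.

Lemma heat_flowZ A (k : R) (f : R -> R) x t : lin_growth A f ->
  heat_flow (fun y => k * f y) x t = k * heat_flow f x t.
Proof.
move=> fA; rewrite /heat_flow -line_intZ; last exact: summable_heat_flow fA.
by apply: eq_line_int => s; rewrite mulrCA.
Qed.

Lemma heat_flow_stair_approx N y t : 0 <= t ->
  heat_flow (stair_approx N) y t = y + 2 / pi *
    series (fun m : nat => sin (m.+1%:R * pi * y) / m.+1%:R *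
      expR (- (m.+1%:R ^+ 2 * pi ^+ 2 * t))) N.
Proof.
move=> t0.
have sg n := sin_growth (n.+1%:R * pi).
have H : (exists A, lin_growth A (fun z => sinsum N (pi * z))) /\
    heat_flow (fun z => sinsum N (pi * z)) y t =
    series (fun m : nat => sin (m.+1%:R * pi * y) / m.+1%:R *
      expR (- (m.+1%:R ^+ 2 * pi ^+ 2 * t))) N.
  elim: N => [|N [[A IHA] IH]].
    rewrite (_ : (fun z => _) = fun=> 0); last first.
      by apply/funext => z; rewrite /sinsum big_ord0.
    split; first by exists 0; split => [|z]; [exact: measurable_cst|rewrite normr0 mul0r].
    rewrite /series /= big_geq// /heat_flow /line_int.
    by under eq_Rintegral do rewrite mulr0; rewrite Rintegral_cst// mul0r.
  rewrite (_ : (fun z => _) = fun z => sinsum N (pi * z) + N.+1%:R^-1 * sin (N.+1%:R * pi * z)); last first.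
    by apply/funext => z; rewrite /sinsum big_ord_recr /= mulrA [_^-1 * _]mulrC.
  split; first by exists (A + `|N.+1%:R^-1| * 1); exact: lin_growthD IHA (lin_growthZ _ (sg N)).
  rewrite (heat_flowD _ _ IHA (lin_growthZ _ (sg N))) (heat_flowZ _ _ _ (sg N)).
  rewrite IH heat_flow_sin// /series /= big_nat_recr//=; congr (_ + _).
  by rewrite exprMn mulNr mulrA [_^-1 * _]mulrC.
have [[A gA] E] := H; rewrite /stair_approx.
rewrite (heat_flowD _ _ (lin_growth_id R) (lin_growthZ _ gA)) heat_flow_id.
by rewrite (heat_flowZ _ _ _ gA) E.
Qed.

(** Each partial sum of phi is the flow of the corresponding partial sum of the
    staircase, mode by mode; these are dominated by a function of linear growth,
    so the flow passes to the limit. *)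
Lemma varphiE y t : 0 <= t -> varphi y t = heat_flow stair y t.
Proof.
move=> t0.
have C : heat_flow (stair_approx N) y t @[N --> \oo] --> heat_flow stair y t.
  have sm N := summable_heat_flow y t (stair_approx_growth N).
  have ss := summable_heat_flow y t stair_growth.
  pose G s := 19 * ((1 + `|y|) * hker s + Num.sqrt t * (hker s * `|s|)).
  have Gs : summable_fun G.
    apply/summableZ/summableD; first by apply: summableZ; case: (line_int_hker R).
    exact/summableZ/summable_hker_abs.
  apply: fine_cvg; rewrite fineK; last exact: integrable_fin_num.
  apply: (@dominated_cvg _ _ _ lebesgue_measure setT _ (fun N s => (hker s *
    stair_approx N (y - Num.sqrt t * s))%:E) (fun s => (hker s * stair (y - Num.sqrt t * s))%:E)
    (EFin \o G)) => //=.
  - by move=> N; apply/measurable_EFinP; exact: summable_measurable.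
  - move=> s _; apply: cvg_EFin; first exact: nearW.
    by apply: cvgMr; exact: stair_approx_cvg.
  - move=> N s _; rewrite lee_fin normrM (gtr0_norm (hker_gt0 _)) /G.
    rewrite (_ : 19 * _ = hker s * (19 * (1 + `|y| + Num.sqrt t * `|s|))); last by ring.
    apply: ler_wpM2l; first exact/ltW/hker_gt0.
    have [_ /(_ (y - Num.sqrt t * s))] := stair_approx_growth N.
    move=> /le_trans; apply; rewrite ler_wpM2l// -addrA lerD2l.
    by rewrite (le_trans (ler_normB _ _))// normrM (ger0_norm (sqrtr_ge0 t)).
have pi0 := pi_gt0 R.
pose S := series (fun m : nat => sin (m.+1%:R * pi * y) / m.+1%:R *
      expR (- (m.+1%:R ^+ 2 * pi ^+ 2 * t))).
have CS : S N @[N --> \oo] --> (heat_flow stair y t - y) / (2 / pi).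
  have -> : S = fun N => (heat_flow (stair_approx N) y t - y) / (2 / pi).
    apply/funext => N; rewrite heat_flow_stair_approx// addrC addKr mulrC mulKf//.
    by rewrite gt_eqF// divr_gt0.
  by apply: cvgMl; apply: cvgB => //; exact: cvg_cst.
rewrite /varphi; have -> := cvg_lim _ CS; last exact: norm_hausdorff.
by rewrite mulrC divfK ?gt_eqF ?divr_gt0// addrC subrK.
Qed.

End SawtoothSeries.

(** * The reflected datum *)

Section ReflectedDatum.
Variable R : realType.
Implicit Types (x y eta : R).

Lemma cellD2 y : cell (y + 2) = cell y + 1.
Proof.
rewrite (@cell_eq _ (y + 2) (Num.floor ((y + 1) / 2) + 1)); first by rewrite intrD.
by rewrite intrD -/(cell y); have := cell_itv y; lra.
Qed.

Lemma cellN y : y - 2 * cell y != -1 -> cell (- y) = - cell y.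
Proof.
move=> ne; rewrite (@cell_eq _ (- y) (- Num.floor ((y + 1) / 2))) ?mulrNz//.
rewrite -/(cell y); have /andP[h1 h2] := cell_itv y.
have h3 : -1 < y - 2 * cell y by rewrite lt_neqAle eq_sym ne.
by apply/andP; split; lra.
Qed.

Lemma cellN_edge y : y - 2 * cell y = -1 -> cell (- y) = 1 - cell y.
Proof.
move=> ye; rewrite (@cell_eq _ (- y) (1 - Num.floor ((y + 1) / 2))) ?intrB//.
by rewrite -/(cell y); apply/andP; split; lra.
Qed.

Variables (w : R -> R) (d R0 K : R).
Hypothesis wC : almost_lipschitz w.
Hypothesis wN : forall x, w (- x) = 2 - w x.
Hypothesis R0pos : 0 < R0.
Hypothesis w_far : forall x, R0 <= x -> w x = 1 + d.
Hypothesis w_bound : forall x, `|w x| <= K.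

Lemma w_farN x : x <= - R0 -> w x = 1 - d.
Proof. by move=> xR; rewrite -[x]opprK wN w_far; [ring|rewrite lerNr]. Qed.

(** The datum w, equal to 1 + d beyond R0 and odd about (0, 1), continued to the
    line by odd reflection about (L, 1 + d) as well: a copy of w in each period
    2L, raised by 2d from one period to the next. *)
Definition periodized L x : R := w (x - 2 * L * cell (x / L)) + 2 * d * cell (x / L).

Definition defect x : R := w x - 1 - d * Num.sg x.

Lemma defect_far x : R0 <= `|x| -> defect x = 0.
Proof.
rewrite /defect; have [x0|x0] := leP 0 x; rewrite ?(ger0_norm x0) ?(ltr0_norm x0) => xR.
  rewrite w_far// gtr0_sg; last by exact: lt_le_trans xR.
  by ring.
by rewrite w_farN ?ltr0_sg//; [ring|rewrite lerNr].
Qed.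

Lemma norm_sg_le1 x : `|Num.sg x| <= 1 :> R.
Proof. by rewrite normr_sg; case: eqP. Qed.

Lemma K_ge0 : 0 <= K. Proof. exact: le_trans (w_bound 0). Qed.

Lemma defect_bound x : `|defect x| <= K + 1 + `|d|.
Proof.
rewrite /defect (le_trans (ler_normB _ _))// lerD//.
  by rewrite (le_trans (ler_normB _ _))// normr1 lerD2r.
by rewrite normrM ler_piMr// norm_sg_le1.
Qed.

Lemma sg_scale L x : 0 < L -> Num.sg (x / L) = Num.sg x.
Proof. by move=> L0; rewrite sgrM (gtr0_sg (_ : 0 < L^-1)) ?invr_gt0// mulr1. Qed.

(** Once the staircase is removed, one copy of the defect is left around each
    point of 2L Z. *)
Lemma periodized_defect L x : 0 < L ->
  periodized L x - (1 + d * stair (x / L)) = defect (x - 2 * L * cell (x / L)).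
Proof.
move=> L0; rewrite /periodized /defect /stair.
have -> : x / L - 2 * cell (x / L) = (x - 2 * L * cell (x / L)) / L.
  by field; rewrite gt_eqF.
by rewrite sg_scale//; ring.
Qed.

Lemma periodized_shift L x : 0 < L -> periodized L (2 * L + x) = periodized L x + 2 * d.
Proof.
move=> L0; rewrite /periodized.
have -> : (2 * L + x) / L = x / L + 2 by field; rewrite gt_eqF.
rewrite cellD2 (_ : 2 * L + x - _ = x - 2 * L * cell (x / L)); ring.
Qed.

Lemma periodizedN L x : R0 <= L -> periodized L (- x) = 2 - periodized L x.
Proof.
move=> RL; have L0 : 0 < L by exact: lt_le_trans RL.
rewrite /periodized mulNr; have [e|e] := eqVneq (x / L - 2 * cell (x / L)) (-1).
  rewrite cellN_edge//.
  have E : x - 2 * L * cell (x / L) = - L.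
    have := congr1 ( *%R L) e; rewrite mulrBr mulrCA divff ?gt_eqF//; lra.
  rewrite (_ : - x - _ = - L); last by move: E; lra.
  by rewrite E w_farN ?lerN2//; ring.
rewrite cellN// (_ : - x - _ = - (x - 2 * L * cell (x / L))); last by ring.
by rewrite wN; ring.
Qed.

Lemma periodized_reflect L x : R0 <= L ->
  periodized L (2 * L - x) = 2 * (1 + d) - periodized L x.
Proof.
move=> RL; have L0 : 0 < L by exact: lt_le_trans RL.
by rewrite periodized_shift// periodizedN//; ring.
Qed.

(** The first reflection about L produces what is already there: beyond R0 both
    data are constant. The interval is therefore not felt until 2L - R0. *)
Lemma periodized_near L x : R0 <= L -> `|x| < 2 * L - R0 -> periodized L x = w x.
Proof.
move=> RL; have L0 : 0 < L by exact: lt_le_trans RL.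
have R00 : 0 < R0 by exact: R0pos.
rewrite ltr_norml => /andP[x1 x2]; rewrite /periodized.
have [h1|h1] := ltP x (- L).
  rewrite (@cell_eq _ (x / L) (-1)).
    rewrite mulrNz mulr1z w_far; last lra.
    by rewrite w_farN; [ring|lra].
  have b1 : -3 <= x / L by rewrite ler_pdivlMr//; lra.
  have b2 : x / L < -1 by rewrite ltr_pdivrMr//; lra.
  by rewrite mulrNz mulr1z; lra.
have [h2|h2] := ltP x L.
  rewrite (@cell_eq _ (x / L) 0) ?mulr0 ?subr0 ?addr0//.
  by rewrite ler_pdivlMr// ltr_pdivrMr//; lra.
rewrite (@cell_eq _ (x / L) 1).
  by rewrite mulr1z w_farN ?[in RHS]w_far; lra.
have b1 : 1 <= x / L by rewrite ler_pdivlMr//; lra.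
have b2 : x / L < 3 by rewrite ltr_pdivrMr//; lra.
by rewrite mulr1z; lra.
Qed.

Lemma periodized_growth L x : R0 <= L ->
  `|periodized L x - (1 + d * (x / L))| <= K + 1 + 3 * `|d|.
Proof.
move=> RL; have L0 : 0 < L by exact: lt_le_trans RL.
rewrite (_ : _ - _ = periodized L x - (1 + d * stair (x / L)) +
   d * (stair (x / L) - x / L)); last by ring.
rewrite periodized_defect// (le_trans (ler_normD _ _))//.
have := defect_bound (x - 2 * L * cell (x / L)); rewrite normrM.
have := ler_wpM2l (normr_ge0 d) (stair_bounded (x / L)); lra.
Qed.

Lemma periodized_almost_lipschitz L : R0 <= L -> almost_lipschitz (periodized L).
Proof.
move=> RL; have L0 : 0 < L by exact: lt_le_trans RL.
move=> e e0; have e2 : 0 < e / 2 by lra.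
have [C C0 HC] := wC e2.
pose B := K + 1 + 3 * `|d|.
have B0 : 0 <= B by have := K_ge0; have := normr_ge0 d; rewrite /B; lra.
have D0 : 0 <= (B + `|d|) / L by rewrite divr_ge0 ?(ltW L0)// addr_ge0.
exists (C + (B + `|d|) / L) => [|x y]; first exact: addr_ge0.
wlog xy : x y / x <= y => [H|].
  by case/orP: (le_total x y) => xy; [|rewrite distrC [`|x - y|]distrC]; exact: H.
rewrite distrC [`|x - y|]distrC (ger0_norm (_ : 0 <= y - x)) ?subr_ge0//.
pose nx := Num.floor ((x / L + 1) / 2); pose ny := Num.floor ((y / L + 1) / 2).
have nxy : nx <= ny.
  apply: le_floor; rewrite ler_pM2r ?invr_gt0// lerD2r.
  by rewrite ler_pM2r ?invr_gt0.
have cx : cell (x / L) = nx%:~R by []. have cy : cell (y / L) = ny%:~R by [].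
have ix := cell_itv (x / L); have iy := cell_itv (y / L).
have tx : x / L * L = x by rewrite divfK// gt_eqF.
have ty : y / L * L = y by rewrite divfK// gt_eqF.
have yx0 : 0 <= y - x by rewrite subr_ge0.
have DD : 0 <= (B + `|d|) / L * (y - x) by rewrite mulr_ge0.
have CC : 0 <= C * (y - x) by rewrite mulr_ge0.
(* More than a period apart, both values are compared with the line 1 + d x / L.
   *)
have [far|near] := leP (2 * L) (y - x).
  have := periodized_growth x RL; have := periodized_growth y RL; rewrite -/B => gy gx.
  have -> : periodized L y - periodized L x =
    (periodized L y - (1 + d * (y / L))) - (periodized L x - (1 + d * (x / L))) +
     d * ((y - x) / L) by ring.
  apply: le_trans (ler_normD _ _) _; rewrite normrM (ger0_norm (_ : 0 <= (y - x) / L)).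
    have : B * 2 <= B * ((y - x) / L) by rewrite ler_wpM2l// ler_pdivlMr.
    have -> : (C + (B + `|d|) / L) * (y - x) = C * (y - x) + (B * ((y - x) / L) + `|d| * ((y - x) / L)) by ring.
    have := ler_normB (periodized L y - (1 + d * (y / L))) (periodized L x - (1 + d * (x / L))).
    lra.
  by rewrite divr_ge0// ltW.
have [eqn|nen] := eqVneq nx ny.
  rewrite /periodized cx cy eqn.
  rewrite (_ : w (y - _) + _ - _ = w (y - 2 * L * ny%:~R) - w (x - 2 * L * ny%:~R)); last by ring.
  apply: le_trans (HC _ _) _.
  rewrite (_ : _ - _ - _ = y - x); last by ring.
  by rewrite ger0_norm// mulrDl; lra.
(* In adjacent cells the increment is taken through the junction, where both
   branches have the same value. *)
have n1 : ny = nx + 1.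
  have lt1 : nx + 1 <= ny by rewrite lezD1 lt_neqAle nen.
  apply/eqP; rewrite eq_le lt1 andbT -ltzD1 -(ltr_int R) !intrD -cx -cy.
  have : (y / L - x / L) * L < 2 * L by rewrite mulrBl tx ty.
  rewrite ltr_pM2r//; lra.
have cyx : cell (y / L) = cell (x / L) + 1 by rewrite cy n1 intrD -cx.
rewrite /periodized cyx.
set n := cell (x / L) in ix *.
have xr : x - 2 * L * n <= L.
  have : (x / L - 2 * n) * L <= 1 * L by rewrite ler_pM2r// ltW//; case/andP: ix.
  by rewrite mulrBl tx; lra.
have yr : - L <= y - 2 * L * (n + 1).
  have : -1 * L <= (y / L - 2 * (n + 1)) * L.
    by rewrite ler_pM2r//; move: iy; rewrite cyx -/n => /andP[].
  by rewrite mulrBl ty; lra.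
rewrite (_ : _ - _ = (w (y - 2 * L * (n + 1)) - w (- L)) + (w L - w (x - 2 * L * n))); last first.
  have w1 : w L = 1 + d by exact: w_far.
  have w2 : w (- L) = 1 - d by apply: w_farN; rewrite lerN2.
  by rewrite w1 w2; ring.
apply: le_trans (ler_normD _ _) _.
have := HC (y - 2 * L * (n + 1)) (- L); have := HC L (x - 2 * L * n).
rewrite (ger0_norm (_ : 0 <= L - _)) ?subr_ge0// (ger0_norm (_ : 0 <= _ - - L)) ?subr_ge0//.
by rewrite mulrDl; lra.
Qed.

End ReflectedDatum.

(** * The Hopf-Cole datum *)

Lemma measure_itv_co (R : realType) (x y : R) :
  lebesgue_measure `[x, y[%classic = (if (x < y)%R then (y - x)%:E else 0)%E.
Proof. by rewrite lebesgue_measure_itv /= lte_fin. Qed.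

Lemma line_int_block (R : realType) (k x y : R) : x <= y ->
  summable_fun (fun z : R => k * \1_`[x, y[ z) /\
  line_int (fun z : R => k * \1_`[x, y[ z) = k * (y - x).
Proof.
move=> xy.
have ys0 : summable_fun (fun z : R => \1_`[x, y[ z).
  apply/integrableP; split.
    by apply/measurable_EFinP; exact: measurable_indic.
  have -> : (\int[lebesgue_measure]_z `|(EFin \o (fun z : R => \1_`[x, y[ z)) z| =
      \int[lebesgue_measure]_z (\1_`[x, y[ z)%:E)%E.
    by apply: eq_integral => z _ /=; rewrite ger0_norm.
  by rewrite integral_indic// setIT [X in (X < _)%E]measure_itv_co; case: ifP => _; rewrite ltry.
split; first exact: summableZ.
rewrite line_intZ//; congr (_ * _).
rewrite /line_int /Rintegral integral_indic// setIT [X in fine X]measure_itv_co.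
by move: xy; rewrite le_eqVlt => /predU1P[->|->//]; rewrite ltxx subrr.
Qed.

Lemma odd_jump (R : realType) (a b c e x y : R) :
  `|a - 1| <= e / 2 + c * y -> `|b - 1| <= e / 2 + c * - x ->
  `|a - (2 - b)| <= e + c * (y - x).
Proof.
move=> h1 h2; rewrite (_ : a - (2 - b) = (a - 1) + (b - 1)); last by ring.
apply: le_trans (ler_normD _ _) _; lra.
Qed.

Section HopfColeDatum.
Variable R : realType.
Notation mu := (@lebesgue_measure R).
Variables (R0 : R) (u0 : R -> R).
Hypothesis R0pos : 0 < R0.
Hypothesis iu0 : mu.-integrable `]0, +oo[ (EFin \o u0).
Hypothesis supp : {ae mu, forall x, R0 < x -> u0 x = 0}.
Implicit Types (x y : R).

Let v x : R := u0 x * \1_`]0, +oo[ x.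

Let vS : summable_fun v.
Proof.
have := iu0; rewrite integrable_mkcond//; apply: eq_integrable => // x _.
by rewrite patchE /= /v indicE; case: ifP => xI; rewrite ?mulr1 ?mulr0.
Qed.

Lemma int_init x : \int[mu]_(z in `]0, x[) u0 z = line_int (fun z => v z * \1_`]0, x[ z).
Proof.
rewrite Rintegral_mkcond; apply: eq_Rintegral => z _.
rewrite patchE /v !indicE /=; case: ifP => zI; last by rewrite mulr0.
rewrite (_ : z \in `]0, +oo[%classic = true) ?mulr1//.
move: zI => /set_mem /=; rewrite in_itv/= => /andP[z0 _].
by apply/mem_set; rewrite /= in_itv/= z0.
Qed.

Lemma mass_init : mass u0 = line_int v.
Proof.
rewrite /mass Rintegral_mkcond; apply: eq_Rintegral => z _.
by rewrite patchE /v indicE /=; case: ifP => zI; rewrite ?mulr1 ?mulr0.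
Qed.

Let N := line_int (fun z => `|v z|).

Lemma int_init_bound x : `|\int[mu]_(z in `]0, x[) u0 z| <= N.
Proof.
rewrite int_init; apply: norm_line_int.
- by apply: measurable_funM; [exact: (summable_measurable vS)|exact: measurable_indic].
- exact: summable_norm.
move=> z; rewrite normrM ler_piMr// indicE.
by case: (_ \in _); rewrite ?normr1 ?normr0.
Qed.

Lemma int_init_far x : R0 <= x -> \int[mu]_(z in `]0, x[) u0 z = mass u0.
Proof.
move=> Rx; rewrite int_init mass_init /line_int /Rintegral; congr fine.
apply: ae_eq_integral => //.
- by apply/measurable_EFinP/measurable_funM; [exact: (summable_measurable vS)|exact: measurable_indic].
- by apply/measurable_EFinP; exact: (summable_measurable vS).
have nR : {ae mu, forall z, z != R0}.
  exists [set R0]; split => //; first exact: lebesgue_measure_set1.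
  by move=> z /= /negP; rewrite negbK => /eqP.
apply: (negligibleS _ (negligibleU supp nR)) => z /= nP.
apply: contrapT => /not_orP[/contrapT sz /contrapT zR]; apply: nP => _; congr EFin.
rewrite indicE; have [zx|xz] := ltP z x.
  have [z0|z0] := ltP 0 z; first by rewrite (_ : z \in `]0, x[%classic = true) ?mulr1//; apply/mem_set; rewrite /= in_itv/= z0.
  rewrite /v indicE (_ : z \in `]0, +oo[%classic = false) ?mulr0 ?mul0r//.
  by apply/negP; rewrite inE /= in_itv/= andbT ltNge z0.
have Rz : R0 < z by rewrite lt_neqAle eq_sym zR (le_trans Rx).
by rewrite /v sz// !mul0r.
Qed.

(** Cutting the density at height n: what is above carries little mass, and what
    is below has a Lipschitz primitive. *)
Lemma int_init_almost_lipschitz e : 0 < e -> exists2 C, 0 <= C & forall x y, 0 <= x -> x <= y ->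
  `|\int[mu]_(z in `]0, y[) u0 z - \int[mu]_(z in `]0, x[) u0 z| <= e + C * (y - x).
Proof.
move=> e0; pose t (n : nat) z := Num.max (`|v z| - n%:R) 0.
have mv := summable_measurable vS.
have mt n : measurable_fun setT (t n).
  by apply: measurable_maxr => //; apply: measurable_funB => //; exact: measurableT_comp.
have t0 n z : 0 <= t n z by rewrite le_max lexx orbT.
have tv n z : `|t n z| <= `|v z|.
  by rewrite ger0_norm// ge_max normr_ge0 andbT gerBl.
have ts n : summable_fun (t n) by apply: (summable_le (mt n) (summable_norm vS)).
have [n tn] : exists n, line_int (t n) <= e.
  have C : line_int (t n) @[n --> \oo] --> (0 : R).
    have -> : 0 = fine (\int[mu]_z (0 : \bar R))%E by rewrite integral0.
    apply: fine_cvg; rewrite integral0.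
    rewrite (_ : fine 0%E = 0)//.
    have := @dominated_cvg _ _ _ mu setT _ (fun n z => (t n z)%:E) (fun=> 0%E)
      (fun z => `|v z|%:E); rewrite integral0; apply => //.
    - by move=> n; apply/measurable_EFinP; exact: mt.
    - move=> z _; apply: cvg_near_cst; near=> n; congr EFin.
      apply/max_idPr; rewrite subr_le0.
      by near: n; exact: nbhs_infty_ger.
    - exact: summable_norm.
    - by move=> n z _; rewrite /= lee_fin.
  have /cvgrPdist_le /(_ _ e0) [n _ Hn] := C.
  exists n; have := Hn n (leqnn n); rewrite /= sub0r normrN.
  by apply: le_trans; exact: ler_norm.
exists n%:R => // x y x0 xy.
rewrite !int_init -line_intB; try exact: summable_indicM.
have nb z : `|v z| <= t n z + n%:R by rewrite -lerBlDr le_max lexx.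
have [ys E] := line_int_block n%:R xy.
apply: (@le_trans _ _ (line_int (fun z => t n z + n%:R * \1_`[x, y[ z))); last first.
  by rewrite line_intD// E lerD2r.
apply: norm_line_int; [|exact: summableD|].
  by apply: measurable_funB; apply: measurable_funM => //; exact: measurable_indic.
move=> z; rewrite -mulrBr normrM !indicE.
have [zx|xz] := ltP z x.
  rewrite (_ : z \in `[x, y[%classic = false); last by apply/negP; rewrite inE /= in_itv/= leNgt zx.
  rewrite (_ : (z \in `]0, y[%classic) = (z \in `]0, x[%classic)) ?subrr ?normr0 ?mulr0 ?addr0//.
  by apply/idP/idP; rewrite !inE /= !in_itv/= => /andP[-> _]//=; rewrite (lt_le_trans zx).
rewrite (_ : z \in `]0, x[%classic = false); last by apply/negP; rewrite inE /= in_itv/= [z < x]ltNge xz andbF.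
rewrite subr0; have [zy|yz] := ltP z y.
  rewrite (_ : z \in `[x, y[%classic = true); last by apply/mem_set; rewrite /= in_itv/= xz.
  by rewrite mulr1 (le_trans _ (nb z))// ler_piMr//; case: (_ \in _); rewrite ?normr1 ?normr0.
rewrite (_ : z \in `]0, y[%classic = false); last by apply/negP; rewrite inE /= in_itv/= [z < y]ltNge yz andbF.
by rewrite normr0 mulr0 addr_ge0// mulr_ge0.
Unshelve. all: by end_near.
Qed.

(** The initial datum of the heat problems, made odd about (0, 1). *)
Definition odd_init x : R := if 0 <= x then w_init u0 x else 2 - w_init u0 (- x).

Lemma w_init0 : w_init u0 0 = 1.
Proof. by rewrite /w_init set_itvoo0 Rintegral_set0 expR0. Qed.

Lemma w_init_bounds x : expR (- N) <= w_init u0 x <= expR N.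
Proof.
have := int_init_bound x; rewrite /w_init ler_norml => /andP[h1 h2].
by rewrite !ler_expR h1.
Qed.

Lemma w_init_far x : R0 <= x -> w_init u0 x = expR (mass u0).
Proof. by move=> xR; rewrite /w_init int_init_far. Qed.

Lemma odd_initN x : odd_init (- x) = 2 - odd_init x.
Proof.
rewrite /odd_init oppr_ge0 opprK; case: (ltgtP 0 x) => x0.
- by [].
- by rewrite subKr.
- by rewrite -x0 oppr0 w_init0; ring.
Qed.

Lemma odd_init_far x : R0 <= x -> odd_init x = 1 + (expR (mass u0) - 1).
Proof.
by move=> xR; rewrite /odd_init (le_trans (ltW R0pos))// w_init_far//; ring.
Qed.

Lemma odd_init_bound x : `|odd_init x| <= 2 + expR N.
Proof.
have H y : `|w_init u0 y| <= expR N.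
  by rewrite ger0_norm ?expR_ge0//; case/andP: (w_init_bounds y).
rewrite /odd_init; case: ifP => _; first by rewrite (le_trans (H x))// lerDr.
by rewrite (le_trans (ler_normB _ _))// ger0_norm// lerD2l.
Qed.

Lemma expR_lipschitz (a b : R) : `|a| <= N -> `|b| <= N ->
  `|expR a - expR b| <= expR N * `|a - b|.
Proof.
wlog ba : a b / b <= a => [H|].
  by case/orP: (le_total b a) => ab ? ?; [|rewrite distrC [`|a - b|]distrC]; exact: H.
move=> aN _; have a2 : a <= N by exact: le_trans (ler_norm _) aN.
rewrite (ger0_norm (_ : 0 <= a - b)) ?subr_ge0//.
apply: (@MVT_le _ expR expR) => // x /andP[bx xa].
by rewrite ger0_norm ?expR_ge0// ler_expR (le_trans xa).
Qed.

Lemma odd_init_almost_lipschitz : almost_lipschitz odd_init.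
Proof.
move=> e e0; pose E := expR N; have E0 : 0 < E by exact: expR_gt0.
have e2 : 0 < e / (2 * E) by rewrite divr_gt0// mulr_gt0.
have [C C0 HC] := int_init_almost_lipschitz e2.
have H x y : 0 <= x -> x <= y -> `|w_init u0 y - w_init u0 x| <= e / 2 + E * C * (y - x).
  move=> x0 xy; apply: le_trans (expR_lipschitz (int_init_bound _) (int_init_bound _)) _.
  apply: le_trans (ler_wpM2l (ltW E0) (HC x y x0 xy)) _.
  by rewrite mulrDr -/E le_eqVlt; apply/orP; left; apply/eqP; field; rewrite gt_eqF.
have EC : 0 <= E * C by rewrite mulr_ge0// ltW.
exists (E * C) => // x y; wlog xy : x y / x <= y => [K|].
  by case/orP: (le_total x y) => xy; [|rewrite distrC [`|x - y|]distrC]; exact: K.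
rewrite distrC [`|x - y|]distrC (ger0_norm (_ : 0 <= y - x)) ?subr_ge0//.
rewrite /odd_init; have [x0|x0] := leP 0 x.
  by rewrite (le_trans x0 xy); have := H x y x0 xy; lra.
have nx0 : 0 <= - x by rewrite oppr_ge0 ltW.
have [y0|y0] := leP 0 y.
  have := H 0 y (lexx _) y0; have := H 0 (- x) (lexx _) nx0; rewrite w_init0 !subr0 => h1 h2.
  exact: odd_jump h2 h1.
have ny0 : 0 <= - y by rewrite oppr_ge0 ltW.
have := H (- y) (- x) ny0; rewrite lerN2 => /(_ xy).
set a := w_init u0 (- x); set b := w_init u0 (- y); set c := E * C.
rewrite (_ : 2 - b - (2 - a) = a - b); last by ring.
by rewrite (_ : - x - - y = y - x); [lra|ring].
Qed.

End HopfColeDatum.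

(** * Averages of functions supported near a lattice *)

Section Lattice.
Variable R : realType.
Notation mu := (@lebesgue_measure R).

(** Around lam n the weight is at most e^rho q^n with q = e^(-lam), and each
    neighbourhood has length 2 rho: the sum is geometric and proportional to
    rho. *)
Lemma lattice_sum (lam rho B : R) (h : R -> R) : 0 < lam -> 0 < rho ->
  measurable_fun setT h -> (forall y, 0 <= h y <= B * expR (- `|y|)) ->
  (forall y, h y != 0 -> exists n : nat, `| `|y| - lam * n%:R | <= rho) ->
  line_int h <= 4 * rho * expR rho * B / (1 - expR (- lam)).
Proof.
move=> lam0 rho0 mh hb hs; set q := expR (- lam).
have B0 : 0 <= B by have := hb 0; rewrite normr0 oppr0 expR0 mulr1 => /andP[]; exact: le_trans.
have q0 : 0 < q by exact: expR_gt0.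
have q1 : q < 1 by rewrite -expR0 ltr_expR oppr_lt0.
pose I (s : R) (n : nat) : set R := `[s * (lam * n%:R) - rho, s * (lam * n%:R) + rho]%classic.
have mI s n : measurable (I s n) by exact: measurable_itv.
pose g (n : nat) (y : R) := B * expR rho * q ^+ n * (\1_(I 1 n) y + \1_(I (-1) n) y).
have g0 n y : 0 <= g n y.
  by rewrite /g !mulr_ge0 ?expR_ge0 ?exprn_ge0 ?(ltW q0) ?addr_ge0.
have m1 s n : measurable_fun setT (fun y : R => \1_(I s n) y : R) by exact: measurable_indic.
have mi n : measurable_fun setT (fun y : R => \1_(I 1 n) y + \1_(I (-1) n) y : R).
  by apply: measurable_funD; exact: measurable_indic.
have mg n : measurable_fun setT (g n) by apply: measurable_funM.
have muI s n : mu (I s n) = (2 * rho)%:E.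
  rewrite [LHS]lebesgue_measure_itv /= lte_fin ifT; last by rewrite ltrD2l; lra.
  by rewrite -EFinB; congr EFin; ring.
have iI s n : (\int[mu]_x (\1_(I s n) x)%:E = (2 * rho)%:E)%E.
  rewrite integral_indic//; last exact: mI.
  by rewrite setIT; exact: muI.
have ig n : (\int[mu]_x (g n x)%:E = (geometric (4 * rho * expR rho * B) q n)%:E)%E.
  rewrite /g; under eq_integral do rewrite EFinM EFinD.
  rewrite ge0_integralZl_EFin //; last 3 first.
  - by move=> x _; rewrite -EFinD lee_fin addr_ge0.
  - by apply/measurable_EFinP; exact: mi.
  - by rewrite !mulr_ge0 ?expR_ge0 ?exprn_ge0 ?(ltW q0).
  rewrite ge0_integralD//; last 2 first.
  - by apply/measurable_EFinP; exact: m1.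
  - by apply/measurable_EFinP; exact: m1.
  by rewrite !iI -EFinD -EFinM /geometric /=; congr EFin; ring.
have hle : (\int[mu]_x (h x)%:E <= (4 * rho * expR rho * B / (1 - q))%:E)%E.
  apply: (@le_trans _ _ (\int[mu]_x (\sum_(0 <= n <oo) (g n x)%:E))%E).
    apply: ge0_le_integral => //.
    - by move=> x _; rewrite lee_fin; case/andP: (hb x).
    - by apply/measurable_EFinP.
    - apply: ge0_emeasurable_sum => [n x _ _|n _]; first by rewrite lee_fin.
      by apply/measurable_EFinP; exact: mg.
    move=> x _; have [hx|hx] := eqVneq (h x) 0.
      by rewrite hx; apply: nneseries_ge0 => n _ _; rewrite lee_fin.
    have [n xn] := hs x hx.
    apply: le_trans (nneseries_lim_ge n.+1 _); last by move=> k _; rewrite lee_fin.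
    rewrite big_nat_recr//= (le_trans _ (leeDr _ _))//; last first.
      by apply: sume_ge0 => k _; rewrite lee_fin.
    rewrite lee_fin (le_trans (proj2 (andP (hb x))))// /g -!mulrA ler_wpM2l//.
    rewrite mulrA -[q ^+ n]expRM_natl -expRD.
    move: xn; rewrite ler_norml => /andP[x1 x2].
    have xI : 1 <= \1_(I 1 n) x + \1_(I (-1) n) x :> R.
      rewrite !indicE; have [x0|x0] := leP 0 x.
        rewrite ger0_norm// in x1 x2; rewrite (_ : x \in I 1 n) ?lerDl//.
        by apply/mem_set; rewrite /I /= in_itv/=; apply/andP; split; lra.
      rewrite ltr0_norm// in x1 x2; rewrite (_ : x \in I (-1) n) ?lerDr//.
      by apply/mem_set; rewrite /I /= in_itv/=; apply/andP; split; lra.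
    apply: le_trans (ler_peMr (expR_ge0 _) xI); rewrite ler_expR.
    by rewrite mulrC mulNr; lra.
  rewrite integral_nneseries//; last 2 first.
  - by move=> n; apply/measurable_EFinP; exact: mg.
  - by move=> n x _; rewrite lee_fin.
  under eq_eseriesr do rewrite ig.
  apply: lime_le; first by apply: is_cvg_nneseries_cond => n _ _; rewrite lee_fin /geometric /= !mulr_ge0 ?expR_ge0 ?exprn_ge0 ?(ltW q0) ?(ltW rho0).
  apply: nearW => n; rewrite sumEFin lee_fin.
  apply: geometric_le_lim => //; last by rewrite ger0_norm ?(ltW q0).
  by rewrite !mulr_ge0 ?expR_ge0 ?(ltW rho0).
rewrite /line_int /Rintegral -lee_fin fineK//.
rewrite ge0_fin_numE; last by apply: integral_ge0 => x _; rewrite lee_fin; case/andP: (hb x).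
by rewrite (le_lt_trans hle)// ltry.
Qed.

(** The kernel decays faster than e^(-|y|), so the average is proportional to
    the width of the support. *)
Lemma heat_op_lattice (j : nat) (r lam : R) : 0 < lam -> exists2 C, 0 <= C &
  forall A (f : R -> R) rho xi, 0 < rho <= 1 -> measurable_fun setT f ->
    (forall y, `|f y| <= A) ->
    (forall y, f y != 0 -> exists n : nat, `| `|y| - lam * n%:R | <= rho) ->
    `|xi| <= r -> `|heat_op j f xi| <= C * A * rho.
Proof.
move=> lam0; have h2 : 0 < (2^-1 : R) < 1 by apply/andP; split; lra.
have [C C0 HC] := kder_shift_bound j r h2.
have q1 : 0 < 1 - expR (- lam) by rewrite subr_gt0 -expR0 ltr_expR oppr_lt0.
exists (4 * expR 1 * (C * expR 2) / (1 - expR (- lam))).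
  by rewrite !mulr_ge0 ?invr_ge0 ?expR_ge0 ?(ltW q1).
move=> A f rho xi /andP[rho0 rho1] mf fA fs xr.
have A0 : 0 <= A by exact: le_trans (fA 0).
have fG : lin_growth A f by exact: lin_growth_bounded.
have sf := summable_heat_op j xi fG.
apply: (@le_trans _ _ (line_int (fun y => `|kder j (xi - y) * f y|))).
  by apply: norm_line_int => //; [exact: summable_measurable|exact: summable_norm].
apply: le_trans (@lattice_sum lam rho (C * expR 2 * A) _ lam0 rho0 _ _ _) _.
- by apply: measurableT_comp => //; exact: (summable_measurable sf).
- move=> y; rewrite normr_ge0 /= normrM.
  have k1 : `|kder j (xi - y)| <= C * expR (- ((1 - 2^-1) / 4 * y ^+ 2)).
    by apply: le_trans (HC _ _ xr); rewrite ler_peMr// lerDl.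
  (* (|y| - 4)^2 >= 0 trades the Gaussian for the exponential weight. *)
  have k2 : expR (- ((1 - 2^-1) / 4 * y ^+ 2)) <= expR 2 * expR (- `|y|).
    rewrite -expRD ler_expR; have := sqr_ge0 (`|y| - 4).
    by rewrite -(real_normK (num_real y)); set z := `|y|; nra.
  have k3 := ler_pM (normr_ge0 _) (normr_ge0 _) (le_trans k1 (ler_wpM2l C0 k2)) (fA y).
  by apply: le_trans k3 _; rewrite le_eqVlt; apply/orP; left; apply/eqP; ring.
- move=> y; rewrite normr_eq0 mulf_eq0 negb_or => /andP[_]; exact: fs.
have e1 : expR rho <= expR 1 by rewrite ler_expR.
have E0 : 0 <= 4 * rho * (C * expR 2 * A) / (1 - expR (- lam)).
  by rewrite !mulr_ge0 ?invr_ge0 ?expR_ge0 ?(ltW q1) ?(ltW rho0).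
have := ler_wpM2l E0 e1.
set q := 1 - _; set a := expR rho; set b := expR 1; set e := expR 2.
by congr (_ <= _); ring.
Qed.

End Lattice.

(** * The four profiles in the similarity variable *)

Section Profiles.
Variable R : realType.
Implicit Types (c L xi eta delta r : R).

(** What the reflected interval datum becomes for large L; c records the ratio
    of the diffusion length to L. *)
Definition step (d c eta : R) : R := 1 + d * stair (eta * Num.sqrt c).

(** The quotient w_x / w of the Hopf-Cole transform, for w the average of f. *)
Definition log_slope (f : R -> R) xi : R := heat_op 1 f xi / heat_op 0 f xi.

(** What the reflected half-line datum becomes. *)
Definition step0 (d eta : R) : R := 1 + d * Num.sg eta.

Lemma sqrt_time c L : 0 < c -> 0 < L -> Num.sqrt (c * L ^+ 2) = Num.sqrt c * L.
Proof. by move=> c0 L0; rewrite sqrtrM ?ltW// sqrtr_sqr gtr0_norm. Qed.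

Lemma measurable_sg : measurable_fun setT (fun x : R => Num.sg x : R).
Proof.
apply: nondecreasing_measurable => // x y xy.
have [x0|x0|x0] := sgrP x; have [y0|y0|y0] := sgrP y => //; lra.
Qed.

Lemma lin_growth_le (A B : R) (f : R -> R) : A <= B -> lin_growth A f -> lin_growth B f.
Proof.
move=> AB [mf H]; split => // eta; apply: le_trans (H eta) _.
by rewrite ler_wpM2r// addr_ge0.
Qed.

Lemma almost_lipschitz_measurable (f : R -> R) : almost_lipschitz f -> measurable_fun setT f.
Proof. by move=> /almost_lipschitz_growth[A []]. Qed.

Variables (w : R -> R) (d R0 K : R).
Hypothesis wC : almost_lipschitz w.
Hypothesis wN : forall x, w (- x) = 2 - w x.
Hypothesis R0pos : 0 < R0.
Hypothesis w_far : forall x, R0 <= x -> w x = 1 + d.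
Hypothesis w_bound : forall x, `|w x| <= K.

Definition profile c L eta : R := periodized w d L (eta * Num.sqrt (c * L ^+ 2)).

Definition profile_oo c L eta : R := w (eta * Num.sqrt (c * L ^+ 2)).

Let A1 : R := K + 2 + 4 * `|d|.

Let Kpos : 0 <= K. Proof. exact: le_trans (w_bound 0). Qed.

Lemma growth_const_ge c : 0 < c -> A1 <= A1 * (1 + Num.sqrt c).
Proof.
move=> c0; rewrite ler_peMr ?lerDl//.
by rewrite /A1; have := normr_ge0 d; have := Kpos; lra.
Qed.

Lemma measurable_comp_scale (f : R -> R) k : measurable_fun setT f ->
  measurable_fun setT (fun eta => f (eta * k)).
Proof. by move=> mf; apply: measurableT_comp => //; exact: measurable_funM. Qed.

(** All profiles stay within a bounded distance of 1 + d eta sqrt c, or are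
    bounded: one growth constant serves for all of them and for all L. *)
Lemma profile_bound (a b s : R) : 0 <= s -> `|a - (1 + d * (b * s))| <= K + 1 + 3 * `|d| ->
  `|a| <= A1 * (1 + s) * (1 + `|b|).
Proof.
move=> s0 h; have k0 : 0 <= K by exact: Kpos.
rewrite -[a](subrK (1 + d * (b * s))).
apply: le_trans (ler_normD _ _) _.
apply: (@le_trans _ _ (K + 1 + 3 * `|d| + (1 + `|d| * (`|b| * s)))).
  rewrite lerD// (le_trans (ler_normD _ _))// normr1 lerD2l !normrM.
  by rewrite (ger0_norm s0).
have d0 := normr_ge0 d; have b0 := normr_ge0 b.
rewrite /A1; move: k0 d0 b0; set D := `|d|; set B := `|b| => k0 d0 b0.
have bs : 0 <= B * s by exact: mulr_ge0.
have : 0 <= (K + 2 + 3 * D) * (B * s + s + B) by rewrite mulr_ge0 ?addr_ge0 ?mulr_ge0.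
have : 0 <= D * (s + B) by rewrite mulr_ge0 ?addr_ge0.
have -> : (K + 2 + 4 * D) * (1 + s) * (1 + B) =
  K + 2 + 4 * D + (K + 2 + 3 * D) * (B * s + s + B) + D * (s + B) + D * (B * s) by ring.
lra.
Qed.

Lemma profile_growth c L : 0 < c -> R0 <= L ->
  lin_growth (A1 * (1 + Num.sqrt c)) (profile c L).
Proof.
move=> c0 RL; have L0 : 0 < L by exact: lt_le_trans RL.
split; first apply: measurable_comp_scale.
  apply: almost_lipschitz_measurable.
  exact: (periodized_almost_lipschitz wC wN R0pos w_far w_bound).
move=> eta; apply: profile_bound => //.
have := periodized_growth d R0pos w_bound (eta * Num.sqrt (c * L ^+ 2)) RL.
by rewrite {2}sqrt_time// -mulrA mulfK ?gt_eqF// /profile.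
Qed.

Lemma step_growth c : 0 < c -> lin_growth (A1 * (1 + Num.sqrt c)) (step d c).
Proof.
move=> c0; split.
  apply: measurable_funD => //; apply: measurable_funM => //.
  by apply: measurable_comp_scale; exact: measurable_stair.
move=> eta; apply: profile_bound => //.
rewrite /step (_ : _ - _ = d * (stair (eta * Num.sqrt c) - eta * Num.sqrt c)); last by ring.
rewrite normrM; have := ler_wpM2l (normr_ge0 d) (stair_bounded (eta * Num.sqrt c)).
by have := Kpos; have := normr_ge0 d; lra.
Qed.

Lemma profile_oo_growth c L : 0 < c -> lin_growth (A1 * (1 + Num.sqrt c)) (profile_oo c L).
Proof.
move=> c0; apply: lin_growth_le (growth_const_ge c0) _; apply: lin_growth_bounded.
  apply: measurable_comp_scale.
  exact: almost_lipschitz_measurable.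
move=> eta; apply: le_trans (w_bound _) _; rewrite /A1.
by have := normr_ge0 d; lra.
Qed.

Lemma step0_growth c : 0 < c -> lin_growth (A1 * (1 + Num.sqrt c)) (step0 d).
Proof.
move=> c0; apply: lin_growth_le (growth_const_ge c0) _; apply: lin_growth_bounded.
  by apply: measurable_funD => //; apply: measurable_funM => //; exact: measurable_sg.
move=> eta; rewrite /step0 (le_trans (ler_normD _ _))// normr1 normrM.
have := ler_wpM2l (normr_ge0 d) (@norm_sg_le1 _ eta).
by rewrite /A1; have := normr_ge0 d; have := Kpos; lra.
Qed.

Lemma profile_step c L eta : 0 < c -> R0 <= L -> profile c L eta - step d c eta =
  defect w d (eta * Num.sqrt (c * L ^+ 2) - 2 * L * cell (eta * Num.sqrt c)).
Proof.
move=> c0 RL; have L0 : 0 < L by exact: lt_le_trans RL.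
have E : eta * Num.sqrt (c * L ^+ 2) / L = eta * Num.sqrt c.
  by rewrite sqrt_time// mulrA mulfK ?gt_eqF.
by have := periodized_defect w d (eta * Num.sqrt (c * L ^+ 2)) L0; rewrite E.
Qed.

Lemma profile_oo_step c L eta : 0 < c -> 0 < L ->
  profile_oo c L eta - step0 d eta = defect w d (eta * Num.sqrt (c * L ^+ 2)).
Proof.
move=> c0 L0; rewrite /profile_oo /step0 /defect sgrM.
rewrite [Num.sg (Num.sqrt _)]gtr0_sg ?mulr1; first by ring.
by rewrite sqrtr_gt0 mulr_gt0 ?exprn_gt0.
Qed.

(** The differences are copies of the defect, squeezed into neighbourhoods of
    radius R0 / (sqrt c L) of the points 2 n / sqrt c; only n = 0 occurs on the
    half-line. *)
Lemma profile_close j r c : 0 < c -> exists2 C, 0 <= C &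
  forall L xi, R0 <= L -> R0 <= Num.sqrt c * L -> `|xi| <= r ->
  `|heat_op j (profile c L) xi - heat_op j (step d c) xi| <= C * L^-1 /\
  `|heat_op j (profile_oo c L) xi - heat_op j (step0 d) xi| <= C * L^-1.
Proof.
move=> c0; have s0 : 0 < Num.sqrt c by rewrite sqrtr_gt0.
have lam0 : 0 < 2 / Num.sqrt c by exact: divr_gt0.
have [C C0 HC] := heat_op_lattice j r lam0.
have k0 := Kpos; have d0 := normr_ge0 d.
exists (C * (K + 1 + `|d|) * (R0 / Num.sqrt c)).
  by rewrite !mulr_ge0 ?addr_ge0 ?invr_ge0 ?(ltW R0pos) ?(ltW s0).
move=> L xi RL RcL xr; have L0 : 0 < L by exact: lt_le_trans RL.
have sL : 0 < Num.sqrt c * L by exact: mulr_gt0.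
have rho : 0 < R0 / (Num.sqrt c * L) <= 1 by rewrite divr_gt0//= ler_pdivrMr// mul1r.
have E : C * (K + 1 + `|d|) * (R0 / Num.sqrt c) * L^-1 = C * (K + 1 + `|d|) * (R0 / (Num.sqrt c * L)).
  by rewrite invfM; ring.
have sup x : defect w d x != 0 -> `|x| <= R0.
  by apply: contraNT; rewrite -ltNge => /ltW h; apply/eqP/(defect_far wN R0pos w_far).
have PG := profile_growth c0 RL; have SG := step_growth c0.
have OG := profile_oo_growth L c0; have ZG := step0_growth c0.
split; rewrite E.
  rewrite -(heat_opB j xi PG SG); apply: HC => //.
  - by case: (lin_growthB PG SG).
  - by move=> y; rewrite profile_step//; exact: defect_bound.
  move=> y; rewrite profile_step// => /sup; rewrite sqrt_time// => h.
  exists `|Num.floor ((y * Num.sqrt c + 1) / 2)|%N.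
  rewrite natr_absz intr_norm -/(cell (y * Num.sqrt c)).
  rewrite -[X in _ - X * _](gtr0_norm lam0) -normrM.
  apply: le_trans (ler_dist_dist _ _) _.
  rewrite ler_pdivlMr// -[X in _ * X](gtr0_norm sL) -normrM.
  apply: le_trans h; rewrite le_eqVlt; apply/orP; left; apply/eqP; congr `|_|.
  by field; rewrite gt_eqF.
rewrite -(heat_opB j xi OG ZG); apply: HC => //.
- by case: (lin_growthB OG ZG).
- by move=> y; rewrite profile_oo_step//; exact: defect_bound.
move=> y; rewrite profile_oo_step// => /sup; rewrite sqrt_time// => h.
exists 0%N; rewrite mulr0 subr0 normr_id ler_pdivlMr//.
by rewrite -[X in _ * X](gtr0_norm sL) -normrM.
Qed.

(** The data agree for |x| < 2L - R0, that is for |eta| < (2 - R0 / L) / sqrt c.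
    *)
Lemma profile_tail j delta r : 0 < delta < 1 -> exists2 C, 0 <= C &
  forall c L xi, 0 < c -> R0 <= L -> `|xi| <= r ->
  `|heat_op j (profile c L) xi - heat_op j (profile_oo c L) xi| <=
     C * (1 + Num.sqrt c) * expR (- ((1 - delta) / 4 * ((2 - R0 / L) / Num.sqrt c) ^+ 2)).
Proof.
move=> d1; have [C C0 HC] := heat_op_tail j r d1.
have k0 := Kpos; have d0 := normr_ge0 d.
exists (C * (2 * A1)); first by rewrite !mulr_ge0 ?addr_ge0 ?mulr_ge0.
move=> c L xi c0 RL xr; have L0 : 0 < L by exact: lt_le_trans RL.
have s0 : 0 < Num.sqrt c by rewrite sqrtr_gt0.
have PG := profile_growth c0 RL; have OG := profile_oo_growth L c0.
rewrite -(heat_opB j xi PG OG).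
rewrite (_ : C * (2 * A1) * (1 + Num.sqrt c) = C * (A1 * (1 + Num.sqrt c) + A1 * (1 + Num.sqrt c))); last by ring.
apply: HC => //; first exact: lin_growthB.
  rewrite divr_ge0 ?(ltW s0)// subr_ge0 ler_pdivrMr//; move: RL L0; lra.
move=> eta; rewrite ltr_pdivlMr// => h; apply/eqP; rewrite subr_eq0; apply/eqP.
apply: (periodized_near wN R0pos w_far) => //.
rewrite sqrt_time// mulrA normrM (gtr0_norm L0) normrM (gtr0_norm s0).
have := h; rewrite -(ltr_pM2r L0) mulrBl divfK ?gt_eqF//.
Qed.

(** The first step that distinguishes the two functions is at 2 / sqrt c, where
    the Gaussian has size e^(-1/c). *)
Lemma step_tail j delta r : 0 < delta < 1 -> exists2 C, 0 <= C &
  forall c xi, 0 < c -> `|xi| <= r ->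
  `|heat_op j (step d c) xi - heat_op j (step0 d) xi| <=
     C * (1 + Num.sqrt c) * expR (- ((1 - delta) / c)).
Proof.
move=> d1; have [C C0 HC] := heat_op_tail j r d1.
have k0 := Kpos; have d0 := normr_ge0 d.
exists (C * (2 * A1)); first by rewrite !mulr_ge0 ?addr_ge0 ?mulr_ge0.
move=> c xi c0 xr; have s0 : 0 < Num.sqrt c by rewrite sqrtr_gt0.
have SG := step_growth c0; have ZG := step0_growth c0.
rewrite -(heat_opB j xi SG ZG).
rewrite (_ : C * (2 * A1) * (1 + Num.sqrt c) = C * (A1 * (1 + Num.sqrt c) + A1 * (1 + Num.sqrt c))); last by ring.
have -> : (1 - delta) / c = (1 - delta) / 4 * (2 / Num.sqrt c) ^+ 2.
  by rewrite expr_div_n sqr_sqrtr ?ltW//; field; rewrite gt_eqF.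
apply: HC => //; first exact: lin_growthB.
move=> eta; rewrite ltr_pdivlMr// => h.
rewrite /step /step0 stair_sg; last by rewrite normrM (gtr0_norm s0).
by rewrite sgrM [Num.sg (Num.sqrt _)]gtr0_sg// mulr1 subrr.
Qed.

End Profiles.

(** * The explicit limits as logarithmic slopes *)

Section ExplicitProfiles.
Variable R : realType.
Notation mu := (@lebesgue_measure R).
Implicit Types (c xi x y d M : R).

Lemma heat_op_cst xi : heat_op 0 (fun=> 1 : R) xi = 1 /\ heat_op 1 (fun=> 1 : R) xi = 0.
Proof.
have G : lin_growth 1 (fun=> 1 : R) by apply: lin_growth_bounded => // eta; rewrite normr1.
have E x : heat_op 0 (fun=> 1 : R) x = 1.
  have [_ ->] := heat_op_shift 0 x G.
  by rewrite -[RHS](proj2 (line_int_hker R)); apply: eq_line_int => s; rewrite mulr1 kder0E.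
split => //; apply: (@der_unique _ (heat_op 0 (fun=> 1 : R)) xi); first exact: der_heat_op G.
rewrite (_ : heat_op 0 _ = fun=> 1); first exact: der_cst.
by apply/funext => x; rewrite E.
Qed.

Lemma heat_op_affine d A (f : R -> R) xi : lin_growth A f ->
  heat_op 0 (fun eta => 1 + d * f eta) xi = 1 + d * heat_op 0 f xi /\
  heat_op 1 (fun eta => 1 + d * f eta) xi = d * heat_op 1 f xi.
Proof.
move=> fG; have G : lin_growth 1 (fun=> 1 : R) by apply: lin_growth_bounded => // eta; rewrite normr1.
have fZ := lin_growthZ (- d) fG.
have E j : heat_op j (fun eta => 1 + d * f eta) xi = heat_op j (fun=> 1) xi + d * heat_op j f xi.
  rewrite (_ : (fun eta => _) = fun eta => 1 - (- d * f eta)); last first.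
    by apply/funext => eta; ring.
  by rewrite (heat_opB j xi G fZ) (heat_opZ j (- d) xi fG); ring.
have [e0 e1] := heat_op_cst xi.
by split; rewrite E ?e0 ?e1 ?add0r.
Qed.

Lemma heat_op_odd A (f : R -> R) a : lin_growth A f -> (forall x, f (- x) = 2 * a - f x) ->
  heat_op 0 f 0 = a.
Proof.
move=> fG fN; have := heat_flowE 0 (@ltr01 R) fG.
rewrite mul0r sqrtr1; under [in RHS]eq_fun do rewrite mulr1; move=> <-.
by apply: heat_flow_odd fG _ => x; rewrite mulr0 sub0r fN.
Qed.

Lemma PhiE M c xi : 0 < c -> let d := expR M - 1 in
  Phi M c xi = log_slope (step d c) xi.
Proof.
move=> c0 d; have s0 : 0 < Num.sqrt c by rewrite sqrtr_gt0.
have G := lin_growth_scale (ltW s0) (@stair_growth R).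
have [e0 e1] := heat_op_affine d xi G.
rewrite /log_slope /step e0 e1 /Phi -/d /varphi_y.
have -> : (@varphi R) ^~ c = heat_flow (@stair R) ^~ c.
  by apply/funext => y; rewrite varphiE// ltW.
have [/(_ (xi * Num.sqrt c))/der_derive1 -> _ _] := heat_flow_der 0 c0 (@stair_growth R).
rewrite varphiE ?(ltW c0)// (heat_flowE xi c0 (@stair_growth R)) mulfK ?gt_eqF//.
set a := heat_op 1 _ _; set b := _ + _; set s := Num.sqrt c in s0 *.
rewrite [s * _]mulrC mulrAC; congr (_ / _).
by rewrite -mulrA divfK ?gt_eqF.
Qed.

Lemma sg_growth : lin_growth 1 (fun x : R => Num.sg x : R).
Proof. by apply: lin_growth_bounded => [|x]; [exact: measurable_sg|exact: norm_sg_le1]. Qed.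

(** Moving the centre from x to y changes sgn exactly between x and y, by 2, and
    twice the kernel is b. *)
Lemma heat_op_sg_int x y : x <= y ->
  heat_op 0 (fun s : R => Num.sg s) y - heat_op 0 (fun s : R => Num.sg s) x =
  \int[mu]_(z in `[x, y]) b_gauss z.
Proof.
move=> xy; have [sy ->] := heat_op_shift 0 y sg_growth; have [sx ->] := heat_op_shift 0 x sg_growth.
rewrite -line_intB// Rintegral_mkcond /line_int /Rintegral; congr fine.
have mb : measurable_fun setT (@b_gauss R).
  rewrite (_ : @b_gauss R = fun s => 2 * kder 0 s); first by apply: measurable_funM => //; exact: measurable_kder.
  by apply/funext => s; rewrite kder0E /hker; field.
apply: ae_eq_integral => //.
- by apply/measurable_EFinP/measurable_funB; apply: summable_measurable.
- apply/measurable_EFinP.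
  rewrite (_ : patch _ _ _ = fun z => b_gauss z * \1_(`[x, y]%classic : set R) z).
    by apply: measurable_funM => //; exact: measurable_indic.
  by apply/funext => z; rewrite patchE indicE; case: ifP => _; rewrite ?mulr1 ?mulr0.
have n1 (a : R) : {ae mu, forall z, z != a}.
  exists [set a]; split => //; first exact: lebesgue_measure_set1.
  by move=> z /= /negP; rewrite negbK => /eqP.
apply: (negligibleS _ (negligibleU (n1 x) (n1 y))) => z /= nP.
apply: contrapT => /not_orP[/contrapT zx /contrapT zy]; apply: nP => _; congr EFin.
rewrite patchE -mulrBr kder0E /hker.
move: zx zy; rewrite !neq_lt => /orP[zx|xz] /orP[zy|yz].
- rewrite !gtr0_sg ?subr_gt0// subrr mulr0 ifF//.
  by apply/negP => /set_mem /=; rewrite in_itv/= => /andP[]; rewrite leNgt zx.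
- by move: (lt_le_trans zx xy); rewrite ltNge (ltW yz).
- rewrite gtr0_sg ?subr_gt0// ltr0_sg ?subr_lt0// ifT; first by field.
  by apply/mem_set; rewrite /= in_itv/= !ltW.
- rewrite !ltr0_sg ?subr_lt0// subrr mulr0 ifF//.
  by apply/negP => /set_mem /=; rewrite in_itv/= => /andP[_]; rewrite leNgt yz.
Qed.

Lemma heat_op_sg xi : heat_op 1 (fun s : R => Num.sg s) xi = b_gauss xi.
Proof.
pose a : R := xi - 1.
have bC : continuous (@b_gauss R).
  move=> z; apply: (@der_continuous _ _ _ (2 * kder 1 z)).
  rewrite (_ : @b_gauss R = fun s => 2 * kder 0 s); first by apply: der_scale; exact: der_kder.
  by apply/funext => s; rewrite kder0E /hker; field.
have au : xi < xi + 1 by rewrite ltrDl.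
have iB : mu.-integrable [set` Interval (BLeft a) (BRight (xi + 1))] (EFin \o @b_gauss R).
  apply: continuous_compact_integrable; first exact: segment_compact.
  exact: continuous_subspaceT.
have ax : a < xi by rewrite /a gtrBl.
have [dF F1] := continuous_FTC1_closed au iB ax (bC xi).
apply: (@der_unique _ (heat_op 0 (fun s : R => Num.sg s)) xi); first exact: der_heat_op sg_growth.
have D := derivable_der dF; rewrite F1 in D.
have D2 := der_add (der_cst (heat_op 0 (fun s : R => Num.sg s) a) xi) D.
rewrite add0r in D2; apply: der_near D2.
exists 1 => //= y /=; rewrite ltr_norml => /andP[_ yx].
rewrite -heat_op_sg_int; first by rewrite addrC subrK.
by rewrite /a; lra.
Qed.

Lemma f_profE M xi : 0 <= xi -> let d := expR M - 1 in
  f_prof M xi = log_slope (step0 d) xi.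
Proof.
move=> x0 d; rewrite /log_slope /step0.
have [-> ->] := heat_op_affine d xi sg_growth.
rewrite heat_op_sg /f_prof -/d -heat_op_sg_int// (heat_op_odd (a := 0) sg_growth) ?subr0//.
by move=> x; rewrite sgrN mulr0 sub0r.
Qed.

End ExplicitProfiles.

(** * Solutions in similarity variables *)

Section BurgersProfiles.
Variable R : realType.
Implicit Types (c L xi x t : R).
Variables (R0 : R) (u0 : R -> R) (wL : R -> R -> R -> R) (winf : R -> R -> R).
Hypothesis R0pos : 0 < R0.
Hypothesis iu0 : (@lebesgue_measure R).-integrable `]0, +oo[ (EFin \o u0).
Hypothesis supp : {ae @lebesgue_measure R, forall x, R0 < x -> u0 x = 0}.
Hypothesis wL_sol : forall L, R0 <= L -> heat_interval u0 L (wL L).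
Hypothesis winf_sol : heat_halfline u0 winf.

Let d := expR (mass u0) - 1.
Let w := odd_init u0.
Let N := line_int (fun z : R => `|u0 z * \1_`]0, +oo[ z|).
Let K := 2 + expR N.
Let m := expR (- N).

Lemma odd_init_ge x : 0 <= x -> w x = w_init u0 x.
Proof. by rewrite /w /odd_init => ->. Qed.

Let wC : almost_lipschitz w. Proof. exact: odd_init_almost_lipschitz. Qed.
Let wN x : w (- x) = 2 - w x. Proof. exact: odd_initN. Qed.
Let w_far x : R0 <= x -> w x = 1 + d. Proof. exact: odd_init_far. Qed.
Let w_bound x : `|w x| <= K. Proof. exact: odd_init_bound. Qed.

Let d1 : 1 + d = expR (mass u0). Proof. by rewrite /d; ring. Qed.

Lemma w_init_ge x : m <= w_init u0 x.
Proof. by have /andP[] := w_init_bounds iu0 x. Qed.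

Let m1 : m <= 1. Proof. by rewrite -(w_init0 u0); exact: w_init_ge. Qed.

Let md : m <= expR (mass u0).
Proof. by rewrite -(w_init_far iu0 supp (lexx R0)); exact: w_init_ge. Qed.

Lemma interval_flow L x t : R0 <= L -> 0 <= x <= L -> 0 <= t ->
  wL L x t = heat_flow (periodized w d L) x t.
Proof.
move=> RL; have L0 : 0 < L by exact: lt_le_trans RL.
have [cl _ b0 bL i] := wL_sol RL.
apply: (heat_interval_flow L0 (heat_classical_solution cl) b0 bL) => //.
- move=> y /andP[y0 yL]; rewrite i ?y0// -odd_init_ge//.
  (* At the end point the value is fixed by the reflection; when L = R0 it is
     out of reach of the first copy. *)
  move: yL; rewrite le_eqVlt => /predU1P[->|yL].
    have := periodized_reflect wN R0pos w_far L RL; rewrite (_ : 2 * L - L = L); last by ring.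
    by rewrite w_far//; lra.
  rewrite (periodized_near wN R0pos w_far RL)// ger0_norm//; lra.
- exact: (periodized_almost_lipschitz wC wN R0pos w_far w_bound).
- by move=> y; rewrite (periodizedN wN R0pos w_far y RL)//; ring.
- by move=> y; rewrite (periodized_reflect wN R0pos w_far y RL)// d1.
Qed.

Lemma halfline_flow x t : 0 <= x -> 0 <= t -> winf x t = heat_flow w x t.
Proof.
have [cl _ [B wB] b0 i] := winf_sol.
apply: (heat_halfline_flow (heat_classical_solution cl) wB b0 _ wC w_bound).
- by move=> y y0; rewrite (i y y0); symmetry; exact: odd_init_ge.
- by move=> y; rewrite wN; ring.
Qed.

Section AtTime.
Variables (c L : R).
Hypotheses (c0 : 0 < c) (RL : R0 <= L).
Let t := c * L ^+ 2.
Let L0 : 0 < L. Proof. exact: lt_le_trans RL. Qed.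
Let t0 : 0 < t. Proof. by rewrite mulr_gt0// exprn_gt0. Qed.
Let s0 : 0 < Num.sqrt t. Proof. by rewrite sqrtr_gt0. Qed.

Lemma interval_point xi : 0 <= xi -> xi * Num.sqrt c <= 1 ->
  0 <= xi * Num.sqrt t <= L.
Proof.
move=> x0 x1; rewrite mulr_ge0//= sqrt_time// mulrA.
by rewrite ler_piMl// ltW.
Qed.

Lemma hopf_cole_flow (X : set R) (v : R -> R -> R) g A xi : lin_growth A g ->
  X (xi * Num.sqrt t) -> nonisolated X (xi * Num.sqrt t) ->
  (forall y, X y -> v y t = heat_flow g y t) ->
  rescale (hopf_cole X v) xi t =
    log_slope (fun eta => g (eta * Num.sqrt t)) xi.
Proof.
move=> gG Xx acc vg; rewrite /log_slope /rescale /hopf_cole.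
have [D _ _] := heat_flow_der 0 t0 gG.
have [_ ->] := derive_withinE Xx acc vg (D (xi * Num.sqrt t)).
rewrite vg// (heat_flowE xi t0 gG) mulfK ?gt_eqF//.
by rewrite mulrA mulrCA divff ?mulr1// gt_eqF.
Qed.

Lemma interval_profile xi : 0 <= xi -> xi * Num.sqrt c <= 1 ->
  rescale (hopf_cole `[0, L] (wL L)) xi t =
    log_slope (profile w d c L) xi.
Proof.
move=> x0 x1; have xI := interval_point x0 x1.
have [A pG] := almost_lipschitz_growth (periodized_almost_lipschitz wC wN R0pos w_far w_bound RL).
apply: (hopf_cole_flow pG).
- by rewrite /= in_itv.
- by apply: nonisolated_segment => //; rewrite /= in_itv.
- by move=> y; rewrite /= in_itv/= => yI; rewrite interval_flow// ltW.
Qed.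

Lemma halfline_profile xi : 0 <= xi ->
  rescale (hopf_cole `[0, +oo[ winf) xi t =
    log_slope (profile_oo w c L) xi.
Proof.
move=> x0; have xI : 0 <= xi * Num.sqrt t by rewrite mulr_ge0.
have [A pG] := almost_lipschitz_growth wC.
apply: (hopf_cole_flow pG).
- by rewrite /= in_itv/= andbT.
- have H : 0 < xi * Num.sqrt t + 1 by lra.
  apply: nonisolated_sub (nonisolated_segment H _).
    by move=> y /=; rewrite !in_itv/= andbT => /andP[].
  by rewrite /= in_itv/= xI lerDl ler01.
- by move=> y; rewrite /= in_itv/= andbT => y0; rewrite halfline_flow// ltW.
Qed.

(** The maximum principle gives the minimum of the datum on the interval itself;
    the reflected datum may well be negative outside. *)
Lemma profile_ge xi : 0 <= xi -> xi * Num.sqrt c <= 1 ->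
  m <= heat_op 0 (profile w d c L) xi.
Proof.
move=> x0 x1; have xI := interval_point x0 x1.
have [A pG] := almost_lipschitz_growth (periodized_almost_lipschitz wC wN R0pos w_far w_bound RL).
rewrite -(heat_flowE xi t0 pG) -interval_flow ?(ltW t0)//.
have [cl _ b0 bL i] := wL_sol RL.
apply: (interval_comparison L0 (heat_cst_solution _ m) (heat_classical_solution cl)) => //; last exact: ltW.
- by move=> s sp; rewrite b0.
- by move=> s sp; rewrite bL.
- by move=> y yI; rewrite (i y yI); exact: w_init_ge.
Qed.

Lemma profile_oo_ge xi : 0 <= xi -> m <= heat_op 0 (profile_oo w c L) xi.
Proof.
move=> x0; have xI : 0 <= xi * Num.sqrt t by rewrite mulr_ge0.
have [A pG] := almost_lipschitz_growth wC.
rewrite -(heat_flowE xi t0 pG) -halfline_flow ?(ltW t0)//.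
have [cl p _ b0 i] := winf_sol.
apply: (halfline_comparison (K := m) (heat_cst_solution _ m) (heat_classical_solution cl)) => //; last exact: ltW.
- by move=> y s y0 sp; rewrite gerBl ltW// p.
- by move=> s sp; rewrite b0.
- by move=> y yI; rewrite (i y yI); exact: w_init_ge.
Qed.

End AtTime.

End BurgersProfiles.

(** * The gap between the staircase and the step *)

Lemma le_of_large (R : realType) (m s C L1 : R) : 0 <= C ->
  (forall L, L1 <= L -> 0 < L -> m <= s + C * L^-1) -> m <= s.
Proof.
move=> C0 H; apply/ler_addgt0Pr => e e0.
pose L := Num.max (Num.max L1 1) (C / e).
have L11 : L1 <= L by rewrite !le_max lexx.
have Lp : 0 < L by rewrite (lt_le_trans ltr01)// !le_max lexx orbT.
apply: le_trans (H L L11 Lp) _; rewrite lerD2l ler_pdivrMr// mulrC.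
by rewrite -ler_pdivrMr// le_max lexx orbT.
Qed.

Section Stairs.
Variable R : realType.
Implicit Types (y : R).

Lemma stair_cases y (m : int) : m%:~R = cell y :> R -> -1 <= y - 2 * m%:~R < 1 /\
  stair y = 2 * m%:~R + Num.sg (y - 2 * m%:~R).
Proof. by move=> e; rewrite /stair e cell_itv. Qed.

Lemma stair_ge1 y : 0 < y -> 1 <= stair y.
Proof.
move=> y0; have [] := @stair_cases y (Num.floor ((y + 1) / 2)) erefl.
set m := Num.floor _ => /andP[h1 h2] ->.
have : 0 <= m by rewrite -ltzD1 -(ltr_int R) intrD; lra.
rewrite le_eqVlt => /predU1P[<-|m1].
  by rewrite mulr0 add0r subr0 gtr0_sg.
have : 1 <= m%:~R :> R by rewrite (ler_int R 1).
by have := @norm_sg_le1 _ (y - 2 * m%:~R); rewrite ler_norml => /andP[]; lra.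
Qed.

Lemma stair_leN1 y : y < 0 -> stair y <= -1.
Proof.
move=> y0; have [] := @stair_cases y (Num.floor ((y + 1) / 2)) erefl.
set m := Num.floor _ => /andP[h1 h2] ->.
have : m <= 0 by rewrite -ltzD1 -(ltr_int R) intrD; lra.
rewrite le_eqVlt => /predU1P[->|m1].
  by rewrite mulr0 add0r subr0 ltr0_sg.
have : m%:~R <= -1 :> R by rewrite (ler_int R m (-1)) -ltzD1.
by have := @norm_sg_le1 _ (y - 2 * m%:~R); rewrite ler_norml => /andP[]; lra.
Qed.

Lemma stair_ge2 y : 2 <= y -> 2 <= stair y.
Proof.
move=> y2; have [] := @stair_cases y (Num.floor ((y + 1) / 2)) erefl.
set m := Num.floor _ => /andP[h1 h2] ->.
have : 1 <= m by rewrite -ltzD1 -(ltr_int R) intrD; lra.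
rewrite le_eqVlt => /predU1P[e|m1].
  have := @sgr_ge0 R (y - 2 * m%:~R); rewrite -e; lra.
have : 2 <= m%:~R :> R by rewrite (ler_int R 2).
by have := @norm_sg_le1 _ (y - 2 * m%:~R); rewrite ler_norml => /andP[]; lra.
Qed.

Let q c (eta : R) : R := stair (eta * Num.sqrt c) - Num.sg eta.

(** At xi = 0 all averages equal 1, so this is the difference of the two
    logarithmic slopes there. *)
Definition gap (d c : R) : R := heat_op 1 (step d c) 0 - heat_op 1 (step0 d) 0.

Definition gap_const (d : R) : R := `|d| * ((2 * Num.sqrt pi)^-1 * expR (- 4^-1)).

Lemma gapE (d c : R) : 0 < c -> gap d c = d * heat_op 1 (q c) 0.
Proof.
move=> c0; have s0 : 0 < Num.sqrt c by rewrite sqrtr_gt0.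
have G := lin_growth_scale (ltW s0) (@stair_growth R).
rewrite /gap.
have [_ ->] := heat_op_affine d 0 G; have [_ ->] := heat_op_affine d 0 (@sg_growth R).
by rewrite -mulrBr -(heat_opB 1 0 G (@sg_growth R)).
Qed.

(** The integrand (eta / 2) G(eta) (stair (eta sqrt c) - sgn eta), with G the
    kernel, is nonnegative, and on the unit interval that starts at a = 2 / sqrt
    c it is at least G(a + 1). *)
Lemma gap_lower (d c : R) : 0 < c <= 1 ->
  gap_const d * expR (- (c^-1 + (Num.sqrt c)^-1)) <= `|gap d c|.
Proof.
move=> /andP[c0 c1]; have s0 : 0 < Num.sqrt c by rewrite sqrtr_gt0.
rewrite gapE// normrM -mulrA ler_wpM2l//.
apply: le_trans (ler_norm _).
pose s := Num.sqrt c; pose a := 2 / s.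
have ss : s ^+ 2 = c by rewrite sqr_sqrtr// ltW.
have s1 : s <= 1 by rewrite -(sqrtr1 R) ler_sqrt.
have a2 : 2 <= a by rewrite ler_pdivlMr//; move: s1; lra.
have qG := lin_growthB (lin_growth_scale (ltW s0) (@stair_growth R)) (@sg_growth R).
have ax : a <= a + 1 by rewrite lerDl.
have [bS bE] := line_int_block (hker (a + 1)) ax.
have h1 : hker (a + 1) = (2 * Num.sqrt pi)^-1 * expR (- 4^-1) * expR (- (c^-1 + s^-1)).
  rewrite /hker /b_gauss -mulrA -expRD invfM.
  rewrite (_ : - 4^-1 - (c^-1 + s^-1) = - ((a + 1) ^+ 2 / 4)); last first.
    by rewrite -ss /a; field; rewrite gt_eqF.
  by rewrite mulrAC; congr (_ * _); rewrite mulrC.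
rewrite -h1; apply: (@le_trans _ _ (hker (a + 1) * (a + 1 - a))); first by rewrite [a + 1]addrC addrK mulr1.
rewrite -bE; apply: le_line_int => //; first exact: (summable_heat_op 1 0 qG).
move=> eta; rewrite sub0r kder1E hkerN /q -/s (_ : - (- eta / 2) = eta / 2); last by ring.
have hp := hker_gt0 eta; rewrite indicE; case: (boolP (eta \in _)) => etaI.
  move: etaI => /set_mem /=; rewrite in_itv/= mulr1 => /andP[ea ea1].
  have e2 : 2 <= eta by exact: le_trans ea.
  have st : 2 <= stair (eta * s) by apply: stair_ge2; rewrite -ler_pdivrMr.
  have sg1 : Num.sg eta = 1 :> R by rewrite gtr0_sg//; lra.
  have hm : hker (a + 1) <= hker eta.
    rewrite /hker ler_pM2r ?invr_gt0// /b_gauss ler_wpM2l ?invr_ge0//.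
    rewrite ler_expR lerN2 ler_pM2r ?invr_gt0// ler_sqr ?nnegrE; lra.
  apply: le_trans hm _; rewrite sg1 mulrAC ler_peMl ?(ltW hp)//.
  have := @ler_pM _ 1 (eta / 2) 1 (stair (eta * s) - 1); rewrite mulr1; apply; lra.
rewrite mulr0; have [e0|e0|<-] := ltrgtP 0 eta.
- rewrite mulr_ge0//; first by rewrite mulr_ge0 ?(ltW hp)// divr_ge0// ltW.
  by rewrite gtr0_sg// subr_ge0 stair_ge1// mulr_gt0.
- rewrite mulr_le0//; last by rewrite ltr0_sg// opprK; have : stair (eta * s) <= -1 by [apply: stair_leN1; rewrite pmulr_llt0]; lra.
  by rewrite mulr_le0_ge0 ?(ltW hp)// ler_pdivrMr// mul0r ltW.
- by rewrite !mul0r.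
Qed.

End Stairs.

(** * Closeness of the logarithmic slopes *)

Section Comparison.
Variable R : realType.
Implicit Types (c L xi r : R).

Lemma log_slope_close k r (D : nat -> R) (m A : R) : 0 < m -> 0 < r ->
  (forall j, 0 <= D j) -> exists2 C, 0 <= C & forall e (f g F : R -> R), 0 <= e ->
    lin_growth A f -> lin_growth A g ->
    (forall x, 0 <= x <= r -> m <= heat_op 0 f x /\ m <= heat_op 0 g x) ->
    (forall j x, `|x| <= r -> `|heat_op j f x - heat_op j g x| <= D j * e) ->
    (forall x, 0 <= x <= r -> F x = log_slope f x - log_slope g x) ->
    (Ck_norm `[0%R, r] k F <= (C * e)%:E)%E.
Proof.
move=> m0 r0 D0.
have /choice[U HU] j : exists C, 0 <= C /\ forall B (f : R -> R) x,
    lin_growth B f -> `|x| <= r -> `|heat_op j f x| <= C * B.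
  by have [C C0 HC] := heat_op_growth j r; exists C.
have [C C0 HC] := log_derivative_close (fun j => D j + U j * A) k m0.
exists C => // e f g F e0 fG gG lo cl FE; have A0 := lin_growth_ge0 fG.
apply: (HC r e (fun j => heat_op j f) (fun j => heat_op j g) F r0 e0 _ _ lo _ FE) => j x.
- exact: der_heat_op fG.
- exact: der_heat_op gG.
move=> /andP[x0 xr]; have xx : `|x| <= r by rewrite ger0_norm.
have [U0 ub] := HU j.
split; [by apply: le_trans (ub _ _ _ fG xx) _; rewrite lerDr|by apply: le_trans (ub _ _ _ gG xx) _; rewrite lerDr|].
by apply: le_trans (cl j x xx) _; rewrite ler_wpM2r// lerDl mulr_ge0.
Qed.

Variables (w : R -> R) (d R0 K m : R).
Hypothesis wC : almost_lipschitz w.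
Hypothesis wN : forall x, w (- x) = 2 - w x.
Hypothesis R0pos : 0 < R0.
Hypothesis w_far : forall x, R0 <= x -> w x = 1 + d.
Hypothesis w_bound : forall x, `|w x| <= K.
Hypothesis m0 : 0 < m.
Hypothesis profile_low : forall c L xi, 0 < c -> R0 <= L -> 0 <= xi ->
  xi * Num.sqrt c <= 1 -> m <= heat_op 0 (profile w d c L) xi.
Hypothesis profile_oo_low : forall c L xi, 0 < c -> R0 <= L -> 0 <= xi ->
  m <= heat_op 0 (profile_oo w c L) xi.

Let growth c s f : Num.sqrt c <= s ->
  lin_growth ((K + 2 + 4 * `|d|) * (1 + Num.sqrt c)) f ->
  lin_growth ((K + 2 + 4 * `|d|) * (1 + s)) f.
Proof.
move=> cs; apply: lin_growth_le; rewrite ler_wpM2l ?lerD2l//.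
by rewrite !addr_ge0 ?mulr_ge0// (le_trans (normr_ge0 (w 0))).
Qed.

Let close := profile_close wC wN R0pos w_far w_bound.

(** The lower bound is inherited in the limit of large L, where the profile
    tends to the staircase. *)
Lemma step_ge c xi : 0 < c -> 0 <= xi -> xi * Num.sqrt c <= 1 ->
  m <= heat_op 0 (step d c) xi.
Proof.
move=> c0 x0 x1; have [C C0 HC] := close 0 xi c0.
have s0 : 0 < Num.sqrt c by rewrite sqrtr_gt0.
apply: (@le_of_large _ _ _ C (Num.max R0 (R0 / Num.sqrt c))) => // L.
rewrite ge_max ler_pdivrMr// => /andP[L1 L2] Lp.
have xx : `|xi| <= xi by rewrite ger0_norm.
rewrite mulrC in L2; have [H _] := HC L xi L1 L2 xx.
have := profile_low c0 L1 x0 x1.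
by move: H; rewrite ler_norml => /andP[_]; lra.
Qed.

Lemma step0_ge xi : 0 <= xi -> m <= heat_op 0 (step0 d) xi.
Proof.
move=> x0; have [C C0 HC] := close 0 xi ltr01.
apply: (@le_of_large _ _ _ C R0) => // L L1 Lp.
have xx : `|xi| <= xi by rewrite ger0_norm.
have L2 : R0 <= Num.sqrt 1 * L by rewrite sqrtr1 mul1r.
have [_ H] := HC L xi L1 L2 xx.
have := profile_oo_low ltr01 L1 x0.
by move: H; rewrite ler_norml => /andP[_]; lra.
Qed.

Lemma edge_le c r xi : r * Num.sqrt c <= 1 -> 0 <= xi <= r -> xi * Num.sqrt c <= 1.
Proof. by move=> h /andP[x0 xr]; apply: le_trans h; rewrite ler_wpM2r. Qed.

Lemma profile_step_Ck c k r : 0 < c -> 0 < r -> r * Num.sqrt c <= 1 ->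
  exists C, \forall L \near +oo, forall F,
    (forall xi, 0 <= xi <= r -> F xi = log_slope (profile w d c L) xi - log_slope (step d c) xi) ->
    (Ck_norm `[0%R, r] k F <= (C * L^-1)%:E)%E.
Proof.
move=> c0 r0 rc; have s0 : 0 < Num.sqrt c by rewrite sqrtr_gt0.
have /choice[D HD] j : exists C, 0 <= C /\ forall L xi, R0 <= L -> R0 <= Num.sqrt c * L -> `|xi| <= r ->
    `|heat_op j (profile w d c L) xi - heat_op j (step d c) xi| <= C * L^-1.
  have [C C0 HC] := close j r c0; exists C; split => // L xi L1 L2 xr.
  by case: (HC L xi L1 L2 xr).
have [C C0 HC] := log_slope_close k ((K + 2 + 4 * `|d|) * (1 + Num.sqrt c)) m0 r0 (fun j => (HD j).1).
exists C; near=> L => F FE.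
have L0 : 0 < L by near: L; exact: nbhs_pinfty_gt.
have L1 : R0 <= L by near: L; apply: nbhs_pinfty_ge; rewrite num_real.
have L2 : R0 <= Num.sqrt c * L.
  by rewrite mulrC -ler_pdivrMr//; near: L; apply: nbhs_pinfty_ge; rewrite num_real.
have e0 : 0 <= L^-1 by rewrite invr_ge0 ltW.
apply: (HC L^-1 _ _ F e0 (profile_growth wC wN R0pos w_far w_bound c0 L1) (step_growth d w_bound c0)) => //.
- move=> x xr; have xc := edge_le rc xr; case/andP: xr => x0 _.
  by split; [exact: profile_low|exact: step_ge].
- by move=> j x xx; exact: (HD j).2.
Unshelve. all: by end_near. Qed.

Lemma step_Ck k r delta : 0 < r -> 0 < delta < 1 ->
  exists2 C, 0 <= C & forall c F, 0 < c -> c <= 1 -> r * Num.sqrt c <= 1 ->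
    (forall xi, 0 <= xi <= r -> F xi = log_slope (step d c) xi - log_slope (step0 d) xi) ->
    (Ck_norm `[0%R, r] k F <= (C * expR (- ((1 - delta) / c)))%:E)%E.
Proof.
move=> r0 d1.
have /choice[D HD] j : exists C, 0 <= C /\ forall c xi, 0 < c -> c <= 1 -> `|xi| <= r ->
    `|heat_op j (step d c) xi - heat_op j (step0 d) xi| <= C * expR (- ((1 - delta) / c)).
  have [C C0 HC] := step_tail d w_bound j r d1; exists (C * 2); split => [|c xi c0 c1 xr].
    by rewrite mulr_ge0.
  apply: le_trans (HC c xi c0 xr) _; rewrite ler_wpM2r ?expR_ge0// ler_wpM2l//.
  have : Num.sqrt c <= Num.sqrt 1 by rewrite ler_sqrt.
  by rewrite sqrtr1; lra.
have [C C0 HC] := log_slope_close k ((K + 2 + 4 * `|d|) * (1 + 1)) m0 r0 (fun j => (HD j).1).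
exists C => // c F c0 c1 rc FE.
have s1 : Num.sqrt c <= 1 by rewrite -(sqrtr1 R) ler_sqrt.
apply: (HC (expR (- ((1 - delta) / c))) _ _ F (expR_ge0 _) (growth s1 (step_growth d w_bound c0)) (growth s1 (step0_growth d w_bound c0))) => //.
- move=> x xr; have xc := edge_le rc xr; case/andP: xr => x0 _.
  by split; [exact: step_ge|exact: step0_ge].
- by move=> j x xx; exact: (HD j).2.
Qed.

Lemma profile_oo_Ck k r eps : 0 < r -> 0 < eps < 1 ->
  exists2 C, 0 <= C & exists2 L0, 0 < L0 & forall c L F, 0 < c -> r * Num.sqrt c <= 1 ->
    R0 <= L -> L0 <= L ->
    (forall xi, 0 <= xi <= r -> F xi = log_slope (profile w d c L) xi - log_slope (profile_oo w c L) xi) ->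
    (Ck_norm `[0%R, r] k F <= (C * expR (- (1 - eps) / c))%:E)%E.
Proof.
(* Half of eps is spent on the Gaussian tail, half on the shift R0 / L of its
   edge: (1 - delta) (1 - delta / 2)^2 >= 1 - eps. *)
move=> r0 /andP[e0 e1]; pose delta := eps / 2.
have d1 : 0 < delta < 1 by rewrite /delta; apply/andP; split; lra.
have sr c : r * Num.sqrt c <= 1 -> Num.sqrt c <= r^-1.
  by move=> h; rewrite -[r^-1]mul1r ler_pdivlMr// mulrC.
have r1 : 0 <= 1 + r^-1 by rewrite addr_ge0// invr_ge0 ltW.
have /choice[D HD] j : exists C, 0 <= C /\ forall c L xi, 0 < c -> r * Num.sqrt c <= 1 -> R0 <= L ->
    R0 / delta <= L -> `|xi| <= r ->
    `|heat_op j (profile w d c L) xi - heat_op j (profile_oo w c L) xi| <= C * expR (- (1 - eps) / c).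
  have [C C0 HC] := profile_tail wC wN R0pos w_far w_bound j r d1.
  exists (C * (1 + r^-1)); split => [|c L xi c0 rc L1 L2 xr]; first by rewrite mulr_ge0.
  apply: le_trans (HC c L xi c0 L1 xr) _.
  have Lp : 0 < L by exact: lt_le_trans L1.
  apply: ler_pM; rewrite ?expR_ge0//.
  - by rewrite mulr_ge0// addr_ge0// sqrtr_ge0.
  - by rewrite ler_wpM2l// lerD2l sr.
  rewrite ler_expR mulNr lerN2 expr_div_n sqr_sqrtr ?(ltW c0)// mulrA ler_pM2r ?invr_gt0//.
  have : R0 / L <= delta by rewrite ler_pdivrMr// mulrC -ler_pdivrMr//; lra.
  have : 0 <= R0 / L by rewrite divr_ge0 ?(ltW R0pos) ?(ltW Lp).
  rewrite /delta; set u := R0 / L; move=> u0 u1.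
  have u2 : (2 - eps / 2) ^+ 2 <= (2 - u) ^+ 2 by rewrite ler_sqr ?nnegrE; lra.
  have u3 : 0 <= (1 - eps / 2) / 4 by rewrite divr_ge0//; lra.
  apply: le_trans (ler_wpM2l u3 u2).
  nra.
have [C C0 HC] := log_slope_close k ((K + 2 + 4 * `|d|) * (1 + r^-1)) m0 r0 (fun j => (HD j).1).
exists C => //; exists (R0 / delta).
  by rewrite divr_gt0//; case/andP: d1.
move=> c L F c0 rc L1 L2 FE.
apply: (HC (expR (- (1 - eps) / c)) _ _ F (expR_ge0 _) (growth (sr c rc) (profile_growth wC wN R0pos w_far w_bound c0 L1)) (growth (sr c rc) (profile_oo_growth d wC w_bound L c0))) => //.
- move=> x xr; have xc := edge_le rc xr; case/andP: xr => x0 _.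
  by split; [exact: profile_low|exact: profile_oo_low].
- by move=> j x xx; exact: (HD j).2.
Qed.

End Comparison.

(** * The exact exponential rate *)

Section Rate.
Variable R : realType.
Implicit Types (c d x y e : R).

Lemma stairN y : stair (- y) = - stair y.
Proof.
rewrite -(cvg_lim _ (@stair_approx_cvg R (- y)))//; apply/cvg_lim => //.
under eq_cvg do rewrite stair_approxN.
by apply: cvgN; exact: stair_approx_cvg.
Qed.

Lemma log_slope_odd A (f : R -> R) : lin_growth A f -> (forall x, f (- x) = 2 - f x) ->
  log_slope f 0 = heat_op 1 f 0.
Proof.
move=> fG fN; rewrite /log_slope (heat_op_odd (a := 1) fG) ?divr1//.
by move=> x; rewrite fN mulr1.
Qed.

(** The growth bounds are stated along with a datum w; the pure staircase and
    step are covered by w = 0. *)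
Lemma zero_bound x : `|(fun=> 0 : R) x| <= 0. Proof. by rewrite normr0. Qed.

Lemma log_slope_gap d c : 0 < c -> log_slope (step d c) 0 - log_slope (step0 d) 0 = gap d c.
Proof.
move=> c0; rewrite (log_slope_odd (step_growth d zero_bound c0)).
  rewrite (log_slope_odd (step0_growth d zero_bound c0))// => x.
  by rewrite /step0 sgrN; ring.
by move=> x; rewrite /step mulNr stairN; ring.
Qed.

Lemma gap_upper d delta : 0 < delta < 1 -> exists2 C, 0 < C &
  forall c, 0 < c <= 1 -> `|gap d c| <= C * expR (- ((1 - delta) / c)).
Proof.
move=> d1; have [C C0 HC] := step_tail d zero_bound 1 0 d1.
exists (C * 2 + 1) => [|c /andP[c0 c1]].
  by apply: ltr_wpDl => //; exact: mulr_ge0.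
have z : `|0 : R| <= 0 by rewrite normr0.
apply: le_trans (HC c 0 c0 z) _; rewrite ler_wpM2r ?expR_ge0//.
have s1 : Num.sqrt c <= 1 by rewrite -(sqrtr1 R) ler_sqrt.
have := @ler_wpM2l _ C C0 (1 + Num.sqrt c) 2; lra.
Qed.

Lemma gap_const_gt0 d : d != 0 -> 0 < gap_const d.
Proof.
move=> d0; rewrite mulr_gt0 ?normr_gt0// mulr_gt0 ?expR_gt0// invr_gt0.
by rewrite mulr_gt0// sqrtr_gt0 pi_gt0.
Qed.

(** For every small delta the quantity lies between 1 - delta - c ln C and 1 +
    sqrt c - c ln k, the lower bound on the gap being k e^(-1/c - 1/sqrt c). *)
Lemma gap_rate d : d != 0 -> - c * ln `|gap d c| @[c --> 0^'+] --> (1 : R).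
Proof.
move=> d0; have k0 := gap_const_gt0 d0; set k := gap_const d in k0.
apply/cvgrPdist_le => e e0.
pose delta := Num.min (e / 2) (2^-1 : R).
have d1 : 0 < delta < 1.
  by rewrite /delta lt_min gt_min; apply/andP; split; [apply/andP; split|apply/orP; right]; lra.
have de : delta <= e / 2 by rewrite ge_min lexx.
have [C C0 HC] := gap_upper d d1.
have pos (x : R) : 0 < e / 2 / (1 + `|x|).
  by rewrite divr_gt0 ?divr_gt0// ltr_pwDl.
near=> c.
have c0 : 0 < c by near: c; exact: nbhs_right_gt.
have c1 : c <= 1 by near: c; exact: nbhs_right_le.
have c2 : c <= (e / 2) ^+ 2 by near: c; apply: nbhs_right_le; rewrite exprn_gt0// divr_gt0.
have c3 : c <= e / 2 / (1 + `|ln C|) by near: c; exact: nbhs_right_le.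
have c4 : c <= e / 2 / (1 + `|ln k|) by near: c; exact: nbhs_right_le.
have s0 : 0 < Num.sqrt c by rewrite sqrtr_gt0.
have c01 : 0 < c <= 1 by rewrite c0.
have lo := gap_lower d c01; have up := HC c c01.
have g0 : 0 < `|gap d c| by apply: lt_le_trans lo; rewrite mulr_gt0// expR_gt0.
have s2 : Num.sqrt c <= e / 2.
  have : Num.sqrt c <= Num.sqrt ((e / 2) ^+ 2) by rewrite ler_sqrt// sqr_ge0.
  by rewrite sqrtr_sqr ger0_norm// ltW// divr_gt0.
have cc : c / Num.sqrt c = Num.sqrt c.
  by rewrite -{1}(sqr_sqrtr (ltW c0)) expr2 mulfK// gt_eqF.
have small (x : R) : c <= e / 2 / (1 + `|x|) -> `|c * x| <= e / 2.
  rewrite ler_pdivlMr; last by rewrite ltr_pwDl.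
  by rewrite normrM (gtr0_norm c0) mulrDr mulr1; have := ltW c0; lra.
have lnlo : ln k - (c^-1 + (Num.sqrt c)^-1) <= ln `|gap d c|.
  by rewrite -[X in _ + X]expRK -lnM ?posrE ?expR_gt0// ler_ln ?posrE// mulr_gt0// expR_gt0.
have lnup : ln `|gap d c| <= ln C - (1 - delta) / c.
  by rewrite -[X in _ + X]expRK -lnM ?posrE ?expR_gt0// ler_ln ?posrE// mulr_gt0// expR_gt0.
have h1 := ler_wpM2l (ltW c0) lnlo; have h2 := ler_wpM2l (ltW c0) lnup.
have e1 : c * (ln k - (c^-1 + (Num.sqrt c)^-1)) = c * ln k - 1 - Num.sqrt c.
  by rewrite mulrBr mulrDr divff ?gt_eqF// cc; ring.
have e2 : c * (ln C - (1 - delta) / c) = c * ln C - (1 - delta).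
  by rewrite mulrBr mulrCA divff ?gt_eqF// mulr1.
rewrite e1 in h1; rewrite e2 in h2.
have := small _ c3; have := small _ c4; rewrite !ler_norml => /andP[k1 k2] /andP[l1 l2].
by rewrite mulNr; apply/andP; split; lra.
Unshelve. all: by end_near. Qed.

(** Along c = s^(-2) the lower bound on the gap is of order e^(-s^2 - s), which
    is not O(e^(-gamma s^2)) for gamma > 1. *)
Lemma gap_beats_exp d r gamma C : d != 0 -> 0 < r -> 1 < gamma -> 0 < C ->
  ~ (forall c, 0 < c < r ^- 2 -> `|gap d c| <= C * expR (- gamma / c)).
Proof.
move=> d0 r0 g1 C0 H; have k0 := gap_const_gt0 d0.
have g0 : 0 < gamma - 1 by rewrite subr_gt0.
pose a := Num.max (r + 1) (Num.max (2 / (gamma - 1)) (C / gap_const d)).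
have a1 : r + 1 <= a by rewrite le_max lexx.
have a2 : 2 / (gamma - 1) <= a by rewrite !le_max lexx orbT.
have a3 : C / gap_const d <= a by rewrite !le_max lexx !orbT.
pose s := a + 1.
have s1 : r + 1 <= s by rewrite /s; lra.
have s2 : 2 / (gamma - 1) <= s by rewrite /s; lra.
have s3 : C / gap_const d < s by rewrite /s; lra.
have s0 : 0 < s by lra.
pose c := s ^- 2.
have sc : Num.sqrt c = s^-1 by rewrite /c -exprVn sqrtr_sqr ger0_norm// invr_ge0 ltW.
have c0 : 0 < c by rewrite invr_gt0 exprn_gt0.
have c1 : c <= 1 by rewrite invf_le1 ?exprn_gt0// exprn_ege1//; lra.
have cr : c < r ^- 2 by rewrite ltf_pV2 ?posrE ?exprn_gt0// ltr_sqr ?nnegrE; lra.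
have := gap_lower d (_ : 0 < c <= 1); rewrite c0 => /(_ c1).
have := H c; rewrite c0 => /(_ cr) h2 h1; have := le_trans h1 h2.
rewrite sc /c !invrK => h.
have : gap_const d <= C * expR (- s).
  rewrite -(ler_pM2r (expR_gt0 (- (s ^+ 2 + s)))).
  apply: le_trans h _; rewrite -mulrA -expRD ler_wpM2l ?(ltW C0)// ler_expR.
  have : s * 2 <= s * (s * (gamma - 1)) by rewrite ler_pM2l// -ler_pdivrMr.
  by rewrite expr2; lra.
have : s * expR (- s) <= 1.
  by rewrite expRN ler_pdivrMr ?expR_gt0// mul1r; have := expR_ge1Dx s; lra.
move: s3; rewrite ltr_pdivrMr//; set E := expR _ => s3 sE kE.
have E0 : 0 < E by exact: expR_gt0.
have : s * gap_const d <= C by apply: le_trans (ler_wpM2l (ltW s0) kE) _; rewrite mulrCA ler_piMr// ltW.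
by rewrite leNgt s3.
Qed.

End Rate.

Section Optimality.
Variable R : realType.
Variables (w : R -> R) (d R0 K : R).
Hypothesis wC : almost_lipschitz w.
Hypothesis wN : forall x, w (- x) = 2 - w x.
Hypothesis R0pos : 0 < R0.
Hypothesis w_far : forall x, R0 <= x -> w x = 1 + d.
Hypothesis w_bound : forall x, `|w x| <= K.

Lemma log_slope_profile0 c L : 0 < c -> R0 <= L ->
  log_slope (profile w d c L) 0 - log_slope (profile_oo w c L) 0 =
  heat_op 1 (profile w d c L) 0 - heat_op 1 (profile_oo w c L) 0.
Proof.
move=> c0 RL; rewrite (log_slope_odd (profile_growth wC wN R0pos w_far w_bound c0 RL)).
  rewrite (log_slope_odd (profile_oo_growth d wC w_bound L c0))// => x.
  by rewrite /profile_oo mulNr wN.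
by move=> x; rewrite /profile mulNr (periodizedN wN R0pos w_far).
Qed.

(** At fixed c the profiles tend to the staircase and the step as L tends to
    infinity, so a bound that is uniform in L holds for the gap. *)
Lemma gap_le_profiles c L0 E : 0 < c ->
  (forall L, R0 <= L -> L0 <= L ->
     `|log_slope (profile w d c L) 0 - log_slope (profile_oo w c L) 0| <= E) ->
  `|gap d c| <= E.
Proof.
move=> c0 H; have s0 : 0 < Num.sqrt c by rewrite sqrtr_gt0.
have [C C0 HC] := profile_close wC wN R0pos w_far w_bound 1 0 c0.
apply: (@le_of_large _ _ _ (2 * C) (Num.max (Num.max R0 L0) (R0 / Num.sqrt c))); first by rewrite mulr_ge0.
move=> L; rewrite !ge_max ler_pdivrMr// => /andP[/andP[L1 L2] L3] Lp.
have := H L L1 L2; rewrite log_slope_profile0//.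
have z : `|0 : R| <= 0 by rewrite normr0.
rewrite mulrC in L3; have [] := HC L 0 L1 L3 z.
rewrite /gap; set a := heat_op _ _ _; set b := heat_op _ _ _; set a' := heat_op _ _ _; set b' := heat_op _ _ _.
move=> h1 h2 h3; rewrite (_ : b - b' = (a - a') - (a - b) + (a' - b')); last by ring.
apply: le_trans (ler_normD _ _) _; have := ler_normB (a - a') (a - b); lra.
Qed.

End Optimality.

(** * The staircase at large scale *)

Section LargeTime.
Variable R : realType.
Implicit Types (c d x y e : R).

Lemma heat_op_id x : heat_op 0 (@id R) x = x /\ heat_op 1 (@id R) x = 1.
Proof.
have G := lin_growth_id R.
have E z : heat_op 0 (@id R) z = z.
  have := heat_flowE z (@ltr01 R) G; rewrite sqrtr1 mulr1 heat_flow_id => {2}->.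
  by congr (heat_op 0 _ _); apply/funext => eta; rewrite mulr1.
split => //; apply: (@der_unique _ (heat_op 0 (@id R)) x); first exact: der_heat_op G.
by rewrite (_ : heat_op 0 _ = id); [exact: der_id|apply/funext => z; rewrite E].
Qed.

Let st c eta : R := stair (eta * Num.sqrt c).

Lemma stair_slope_large : exists2 C, 0 <= C & forall c x, 0 < c ->
  `|heat_op 1 (st c) x - Num.sqrt c| <= C.
Proof.
have [C C0 HC] := heat_op_bounded R 1; exists (C * 2) => [|c x c0]; first by rewrite mulr_ge0.
have s0 : 0 < Num.sqrt c by rewrite sqrtr_gt0.
have G := lin_growth_scale (ltW s0) (@stair_growth R).
have iG1 := lin_growth_id R; have iG := lin_growth_scale (ltW s0) iG1.
have -> : Num.sqrt c = heat_op 1 (fun eta : R => eta * Num.sqrt c) x.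
  rewrite (_ : (fun eta => _) = fun eta => Num.sqrt c * id eta); last by apply/funext => eta; rewrite mulrC.
  by rewrite (heat_opZ 1 (Num.sqrt c) x iG1) (proj2 (heat_op_id x)) mulr1.
rewrite -(heat_opB 1 x G iG); apply: HC.
  by case: (lin_growthB G iG).
by move=> eta; exact: stair_bounded.
Qed.

(** The slope is 1 up to O(1/sqrt c), as stair - id is bounded. The average
    itself is then recovered by integrating from 0, where it vanishes: estimated
    directly, its error would only be O(1). *)
Lemma stair_flat_large : exists2 C, 0 <= C & forall c y, 0 < c -> 0 <= y <= 1 ->
  `|heat_op 1 (st c) (y / Num.sqrt c) / Num.sqrt c - 1| <= C / Num.sqrt c /\
  `|heat_op 0 (st c) (y / Num.sqrt c) - y| <= C / Num.sqrt c.
Proof.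
have [C C0 HC] := stair_slope_large; exists C => // c y c0 /andP[y0 y1].
have s0 : 0 < Num.sqrt c by rewrite sqrtr_gt0.
have G := lin_growth_scale (ltW s0) (@stair_growth R).
have slope z : `|heat_op 1 (st c) (z / Num.sqrt c) / Num.sqrt c - 1| <= C / Num.sqrt c.
  rewrite -[X in _ - X](divff (lt0r_neq0 s0)) -mulrBl normrM ler_pM ?HC//.
  by rewrite ger0_norm// invr_ge0 ltW.
split => //.
pose D z := heat_op 0 (st c) (z / Num.sqrt c) - z.
have D0 : D 0 = 0.
  rewrite /D subr0 mul0r; apply: (heat_op_odd (a := 0) G) => z.
  by rewrite mulNr stairN; ring.
have dD (z : R) : is_derive z 1 D (heat_op 1 (st c) (z / Num.sqrt c) / Num.sqrt c - 1).
  apply: der_sub (der_id z); apply: (der_comp (f := heat_op 0 (st c)) (g := fun z => z / Num.sqrt c)); first exact: der_heat_op G.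
  by have := der_scale (Num.sqrt c)^-1 (der_id z); rewrite mulr1; under eq_fun do rewrite mulrC.
have CC : 0 <= C / Num.sqrt c by rewrite divr_ge0 ?(ltW s0).
have := @MVT_le _ D _ 0 y (C / Num.sqrt c) y0 _ (fun z _ => slope z).
rewrite D0 !subr0 => H; apply: le_trans (H _) _ => //.
by rewrite ler_piMr.
Qed.

Lemma quotient_close (d D a b y h mu : R) : 0 < mu -> mu <= 1 + d * y -> `|d| <= D ->
  `|a - 1| <= h -> `|b - y| <= h -> D * h <= mu / 2 -> 0 <= y <= 1 ->
  `|d * a / (1 + d * b) - d / (1 + d * y)| <= D * (1 + 2 * D) * h * (2 / mu ^+ 2).
Proof.
move=> mu0 my dD ah bh Dh /andP[y0 y1].
have h0 : 0 <= h by exact: le_trans ah.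
have D0 : 0 <= D by exact: le_trans dD.
have db : `|d * (b - y)| <= mu / 2.
  by rewrite normrM; apply: le_trans Dh; apply: ler_pM.
have mb : mu / 2 <= 1 + d * b.
  by move: db; rewrite ler_norml => /andP[]; lra.
have mb0 : 0 < 1 + d * b by lra.
have my0 : 0 < 1 + d * y by lra.
rewrite (_ : _ - _ = d * ((a - 1) * (1 + d * y) - d * (b - y)) * ((1 + d * b) * (1 + d * y))^-1); last first.
  by field; rewrite !gt_eqF.
have E1 : `|(a - 1) * (1 + d * y) - d * (b - y)| <= (1 + 2 * D) * h.
  apply: le_trans (ler_normB _ _) _; rewrite !normrM.
  have n1 : `|1 + d * y| <= 1 + D.
    apply: le_trans (ler_normD _ _) _; rewrite normr1 lerD2l normrM (ger0_norm y0).
    by rewrite -[D]mulr1; apply: ler_pM.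
  have := ler_pM (normr_ge0 _) (normr_ge0 _) ah n1; have := ler_pM (normr_ge0 _) (normr_ge0 _) dD bh.
  by lra.
have E2 : `|((1 + d * b) * (1 + d * y))^-1| <= 2 / mu ^+ 2.
  rewrite normfV ger0_norm; last by rewrite mulr_ge0 ?ltW.
  have -> : 2 / mu ^+ 2 = (mu / 2 * mu)^-1 by field; rewrite gt_eqF.
  have m2 : 0 < mu / 2 by rewrite divr_gt0.
  by rewrite lef_pV2 ?posrE ?mulr_gt0//; apply: ler_pM => //; exact: ltW.
rewrite normrM normrM -[D * _ * h]mulrA.
exact: (ler_pM (mulr_ge0 _ _) _ (ler_pM _ _ dD E1) E2).
Qed.

End LargeTime.

Section Limits.
Variable R : realType.
Implicit Types (c d r x y e : R).

Lemma sqrt_large x c : x ^+ 2 <= c -> x <= Num.sqrt c.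
Proof.
move=> xc; have : Num.sqrt (x ^+ 2) <= Num.sqrt c by rewrite ler_sqrt// (le_trans (sqr_ge0 x)).
by rewrite sqrtr_sqr; apply: le_trans; exact: ler_norm.
Qed.

Lemma edge_of_time r c : 0 < r -> c <= r ^- 2 -> r * Num.sqrt c <= 1.
Proof.
move=> r0 cr; have : Num.sqrt c <= Num.sqrt (r ^- 2).
  by rewrite ler_sqrt// invr_ge0 exprn_ge0// ltW.
rewrite -exprVn sqrtr_sqr ger0_norm ?invr_ge0 ?(ltW r0)// => h.
by rewrite mulrC -ler_pdivlMr// mul1r.
Qed.

Lemma step_flat_large d e : -1 < d -> 0 < e -> \forall c \near +oo, forall y, 0 <= y <= 1 ->
  `|(Num.sqrt c)^-1 * log_slope (step d c) (y / Num.sqrt c) - d / (1 + d * y)| < e.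
Proof.
move=> d1 e0; have [C C0 HC] := stair_flat_large R.
(* The denominator 1 + d y lies between its values at the end points 0 and 1. *)
pose mu := Num.min 1 (1 + d); have mu0 : 0 < mu by rewrite lt_min ltr01/=; lra.
pose D := `|d|; have D0 : 0 <= D by exact: normr_ge0.
have P0 : 0 <= D * (1 + 2 * D) by rewrite mulr_ge0// addr_ge0// mulr_ge0.
pose B := D * (1 + 2 * D) * C * (2 / mu ^+ 2).
have B0 : 0 <= B by rewrite /B; apply: mulr_ge0; [exact: mulr_ge0|rewrite divr_ge0// sqr_ge0].
near=> c => y yI.
have c0 : 0 < c by near: c; exact: nbhs_pinfty_gt.
have s0 : 0 < Num.sqrt c by rewrite sqrtr_gt0.
have c1 : D * C / (mu / 2) <= Num.sqrt c.
  by apply: sqrt_large; near: c; apply: nbhs_pinfty_ge; rewrite num_real.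
have c2 : (B + 1) / e <= Num.sqrt c.
  by apply: sqrt_large; near: c; apply: nbhs_pinfty_ge; rewrite num_real.
have [h1 h0] := HC c y c0 yI.
have G := lin_growth_scale (ltW s0) (@stair_growth R).
have [e0' e1'] := heat_op_affine d (y / Num.sqrt c) G.
rewrite /log_slope /step e0' e1'.
set a := heat_op 1 _ _ in h1 *; set b := heat_op 0 _ _ in h0 *.
have -> : (Num.sqrt c)^-1 * (d * a / (1 + d * b)) = d * (a / Num.sqrt c) / (1 + d * b) by ring.
have my : mu <= 1 + d * y.
  have m1 : mu <= 1 by rewrite ge_min lexx.
  have m2 : mu <= 1 + d by rewrite ge_min lexx orbT.
  have {}yI := yI; case/andP: yI => y0 y1.
  have H (v : R) : v <= 1 -> v <= 1 + d -> v <= 1 + d * y by clear -y0 y1; nra.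
  exact: H.
apply: le_lt_trans (quotient_close mu0 my (lexx _) h1 h0 _ yI) _.
  have m2 : 0 < mu / 2 by rewrite divr_gt0.
  by rewrite mulrA ler_pdivrMr// [_ * Num.sqrt c]mulrC -(ler_pdivrMr _ _ m2); exact: c1.
rewrite -/D (_ : _ * _ = B / Num.sqrt c); last by rewrite /B; ring.
by rewrite ltr_pdivrMr// mulrC -ltr_pdivrMr//; apply: lt_le_trans c2; rewrite ltr_pM2r ?invr_gt0// ltrDl.
Unshelve. all: by end_near. Qed.

Lemma exp_inv_le c : 0 < c -> expR (- ((1 - 2^-1) / c)) <= 2 * c.
Proof.
move=> c0; rewrite expRN -[2 * c]invrK lef_pV2 ?posrE ?expR_gt0 ?invr_gt0 ?mulr_gt0//.
apply: le_trans (expR_ge1Dx _); rewrite invfM (_ : 1 - 2^-1 = 2^-1); lra.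
Qed.

End Limits.

Theorem theorem1p1 (R : realType) (R0 : R) (u0 : R -> R) (M : R)
    (wL : R -> R -> R -> R) (winf : R -> R -> R)
    (hR0 : 0 < R0)
    (hu0 : (@lebesgue_measure R).-integrable `]0, +oo[ (EFin \o u0))
    (hsupp : {ae @lebesgue_measure R, forall x, R0 < x -> u0 x = 0})
    (hM : M = mass u0)
    (hwL : forall L, R0 <= L -> heat_interval u0 L (wL L))
    (hwinf : heat_halfline u0 winf) :
  let uL L := hopf_cole `[0, L] (wL L) in
  let uinf := hopf_cole `[0, +oo[ winf in
  let vL L := rescale (uL L) in
  let vinf := rescale uinf in
  (* 1 *)
  (forall (c : R) (k : nat) (r : R), 0 < c -> 0 < r < (Num.sqrt c)^-1 ->
     exists C : R, \forall L \near +oo,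
       (Ck_norm `[0%R, r] k (fun xi => vL L xi (c * L ^+ 2)%R - Phi M c xi)%R
          <= (C * L^-1)%:E)%E) /\
  (* 2 *)
  ((forall (r : R) (k : nat), 0 < r ->
      Ck_norm `[0, r] k (fun xi => Phi M c xi - f_prof M xi) @[c --> 0^'+]
        --> 0%E) /\
   (M <> 0 ->
      - c * ln `|Phi M c 0 - f_prof M 0| @[c --> 0^'+] --> (1 : R))) /\
  (* 3 *)
  {uniform `[0, 1]%classic,
    (fun (c y : R) => (Num.sqrt c)^-1 * Phi M c (y / Num.sqrt c)) @ +oo
      --> U_prof M} /\
  (* 4 *)
  ((forall (r : R) (k : nat) (eps : R), 0 < r -> 0 < eps < 1 ->
      exists C L0 : R, [/\ 0 < C, 0 < L0 &
        forall c L : R, 0 < c < r ^- 2 -> R0 <= L -> L0 <= L ->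
          (Ck_norm `[0%R, r] k
             (fun xi => vL L xi (c * L ^+ 2)%R - vinf xi (c * L ^+ 2)%R)%R
             <= (C * expR (- (1 - eps) / c))%:E)%E]) /\
   (M <> 0 ->
    forall (r : R) (k : nat) (gamma : R), 0 < r -> 1 < gamma ->
      ~ exists C L0 : R, [/\ 0 < C, 0 < L0 &
        forall c L : R, 0 < c < r ^- 2 -> R0 <= L -> L0 <= L ->
          (Ck_norm `[0%R, r] k
             (fun xi => vL L xi (c * L ^+ 2)%R - vinf xi (c * L ^+ 2)%R)%R
             <= (C * expR (- gamma / c))%:E)%E])).
Proof.
move=> uL uinf vL vinf; rewrite {}hM {M}.
pose d := expR (mass u0) - 1; pose w := odd_init u0.
pose N := line_int (fun z : R => `|u0 z * \1_`]0, +oo[ z|).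
have wC : almost_lipschitz w by exact: odd_init_almost_lipschitz.
have wN x : w (- x) = 2 - w x by exact: odd_initN.
have w_far x : R0 <= x -> w x = 1 + d by exact: odd_init_far.
have w_bound x : `|w x| <= 2 + expR N by exact: odd_init_bound.
have m0 : 0 < expR (- N) by exact: expR_gt0.
have pG c L xi : 0 < c -> R0 <= L -> 0 <= xi -> xi * Num.sqrt c <= 1 ->
  expR (- N) <= heat_op 0 (profile w d c L) xi.
  by move=> c0 RL; exact: (profile_ge hR0 hu0 hsupp hwL c0 RL).
have oG c L xi : 0 < c -> R0 <= L -> 0 <= xi -> expR (- N) <= heat_op 0 (profile_oo w c L) xi.
  by move=> c0 RL; exact: (profile_oo_ge hR0 hu0 hwinf c0 RL).
have vLE c L xi : 0 < c -> R0 <= L -> 0 <= xi -> xi * Num.sqrt c <= 1 ->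
  vL L xi (c * L ^+ 2) = log_slope (profile w d c L) xi.
  by move=> c0 RL; exact: (interval_profile hR0 hu0 hsupp hwL c0 RL).
have viE c L xi : 0 < c -> R0 <= L -> 0 <= xi ->
  vinf xi (c * L ^+ 2) = log_slope (profile_oo w c L) xi.
  by move=> c0 RL; exact: (halfline_profile hR0 hu0 hwinf c0 RL).
have d0 : mass u0 <> 0 -> d != 0.
  by move=> M0; rewrite subr_eq0 -expR0; apply/negP => /eqP/expR_inj.
split; last split; last split.
- move=> c k r c0 /andP[r0 rc].
  have rc1 : r * Num.sqrt c <= 1 by rewrite -ler_pdivlMr ?sqrtr_gt0// mul1r ltW.
  have [C HC] := profile_step_Ck wC wN hR0 w_far w_bound m0 pG k c0 r0 rc1.
  exists C; apply: filterS2 (nbhs_pinfty_ge (num_real R0)) HC => L RL HC.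
  apply: HC => xi xr; have x1 := edge_le rc1 xr; case/andP: xr => x0 _.
  by rewrite vLE// PhiE.
- split => [r k r0|M0].
    have h2 : 0 < (2^-1 : R) < 1 by apply/andP; split; lra.
    have [C C0 HC] := step_Ck wC wN hR0 w_far w_bound m0 pG oG k r0 h2.
    apply: (@squeeze_cvge _ _ _ _ (fun=> 0%E) _ (fun c => (C * (2 * c))%:E)).
    - near=> c; rewrite Ck_norm_ge0/=.
      have c0 : 0 < c by near: c; exact: nbhs_right_gt.
      have c1 : c <= 1 by near: c; exact: nbhs_right_le.
      have rc : r * Num.sqrt c <= 1.
        apply: edge_of_time => //; near: c; apply: nbhs_right_le.
        by rewrite invr_gt0 exprn_gt0.
      apply: le_trans (HC c _ c0 c1 rc _) _ => [xi /andP[x0 _]|].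
        by rewrite PhiE// f_profE.
      by rewrite lee_fin ler_wpM2l// exp_inv_le.
    - exact: cvg_cst.
    apply: cvg_EFin; first exact: nearW.
    apply: cvg_at_right_filter.
    have : (C * (2 * c)) @[c --> (0 : R)] --> C * (2 * 0).
      by apply: cvgM; [exact: cvg_cst|apply: cvgM; [exact: cvg_cst|exact: cvg_id]].
    by rewrite !mulr0.
  apply: cvg_trans (gap_rate (d0 M0)); apply: near_eq_cvg; near=> c.
  have c0 : 0 < c by near: c; exact: nbhs_right_gt.
  by rewrite PhiE// f_profE// log_slope_gap.
- move=> P /uniform_nbhs[E [entE EP]].
  move: entE; rewrite -entourage_ballE => -[e /= e0 eE].
  have d1 : -1 < d by rewrite /d ltrBrDl subrr expR_gt0.
  apply: filterS2 (nbhs_pinfty_gt (num_real 0)) (step_flat_large d1 e0) => c c0 Hc.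
  apply: EP => y /=; rewrite in_itv/= => yI; apply: eE.
  by rewrite /ball /= distrC PhiE//; exact: Hc.
split => [r k eps r0 e1|M0 r k gamma r0 g1 [C [L0 [C0 Lp H]]]].
  have [C C0 [L0 Lp HC]] := profile_oo_Ck wC wN hR0 w_far w_bound m0 pG oG k r0 e1.
  exists (C + 1), L0; split => //; first by rewrite ltr_wpDl.
  move=> c L /andP[c0 cr] RL LL; have rc := edge_of_time r0 (ltW cr).
  apply: le_trans (HC c L _ c0 rc RL LL _) _ => [xi xr|].
    have x1 := edge_le rc xr; case/andP: xr => x0 _.
    by rewrite vLE// viE.
  by rewrite lee_fin ler_wpM2r ?expR_ge0// lerDl.
apply: (gap_beats_exp (d0 M0) r0 g1 C0) => c /andP[c0 cr].
apply: (gap_le_profiles wC wN hR0 w_far w_bound c0 (L0 := L0)) => L RL LL.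
have cI : 0 < c < r ^- 2 by rewrite c0.
have := Ck_norm_point _ (H c L cI RL LL); move=> /(_ 0).
rewrite vLE ?viE ?mul0r//; apply.
by rewrite /= in_itv/= lexx ltW.
Unshelve. all: by end_near. Qed.
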